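(* Let $t\in\mathbb{R}$. The Frobenius form $\langle\,,\rangle$ on the algebra $M(t)$ is positive semidefinite if and only if $t\in[0,\frac16]$. The form is positive semidefinite but not positive definite if and only if $t\in\{0,\frac16\}$.
   Context: Algebras are commutative but not necessarily associative, over a commutative ring $R$ with $1$ containing $\mathbb{R}$ as a subfield. For an idempotent $a\in V$ and $\lambda\in R$ put $V_\lambda^{(a)}=\{v\in V: a\cdot v=\lambda v\}$, and for $\Lambda\subseteq R$ put $V_\Lambda^{(a)}=\bigoplus_{\lambda\in\Lambda}V_\lambda^{(a)}$ ($V_\emptyset^{(a)}=0$). The Monster fusion rule $(\mathcal{M},* )$ has $\mathcal{M}=\{1,0,\frac14,\frac1{32}\}$ and symmetric $*$ with $1*1=\{1\}$, $1*0=\emptyset$, $0*0=\{0\}$, $1*\frac14=0*\frac14=\{\frac14\}$, $\frac14*\frac14=\{1,0\}$, $\lambda*\frac1{32}=\{\frac1{32}\}$ for $\lambda\in\{1,0,\frac14\}$, $\frac1{32}*\frac1{32}=\{1,0,\frac14\}$. An idempotent $a$ is an $(\mathcal{M},* )$-axis if $V=\bigoplus_{\lambda\in\mathcal{M}}V_\lambda^{(a)}$ and $V_\lambda^{(a)}\cdot V_\mu^{(a)}\subseteq V_{\lambda*\mu}^{(a)}$ for all $\lambda,\mu\in\mathcal{M}$; it is primitive if $V_1^{(a)}=Ra$. A primitive Frobenius $(\mathcal{M},* )$-axial algebra is an algebra generated by a set $A$ of primitive $(\mathcal{M},* )$-axes with a Frobenius form, i.e. a nonzero $R$-bilinear form $\langle\,,\rangle$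 with $\langle u,v\cdot w\rangle=\langle u\cdot v,w\rangle$, normalised by $\langle a,a\rangle=1$ for axes $a\in A$. The Miyamoto involution $\tau(a)$ acts as $1$ on $V_1^{(a)}\oplus V_0^{(a)}\oplus V_{1/4}^{(a)}$ and as $-1$ on $V_{1/32}^{(a)}$. Property $\mathcal{P}$: $A=\{a_1,a_{-1},a_2,a_{-2},a_3,a_{-3}\}$ and on $A$, $\tau(a_1)=\tau(a_{-1})=(a_2,a_{-2})(a_3,a_{-3})$, $\tau(a_2)=\tau(a_{-2})=(a_1,a_{-1})(a_3,a_{-3})$, $\tau(a_3)=\tau(a_{-3})=(a_1,a_{-1})(a_2,a_{-2})$. Shape $4A$: for all distinct $i,j\in\{1,2,3\}$ the subalgebra $\langle\langle a_i,a_j\rangle\rangle$ generated by $a_i,a_j$ is of type $4A$, i.e. it is spanned by $a_{\pm i},a_{\pm j}$ and an idempotent $v=v_{(i,j)}=v_{(j,i)}$ such that, for all signs $\epsilon,\delta$: $a_{\epsilon i}\cdot a_{\delta j}=\frac1{64}(3a_{\epsilon i}+3a_{\delta j}+a_{-\epsilon i}+a_{-\delta j}-3v)$, $a_{\epsilon i}\cdot v=\frac1{16}(5a_{\epsilon i}-a_{-\epsilon i}-2a_j-2a_{-j}+3v)$, $a_{\delta j}\cdot v=\frac1{16}(5a_{\delta j}-a_{-\delta j}-2a_i-2a_{-i}+3v)$, $a_i\cdot a_{-i}=a_j\cdot a_{-j}=0$, $\langle a_{\epsilon i},a_{\delta j}\rangle=\frac1{32}$, $\langle a_i,a_{-i}\rangle=\langle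 a_j,a_{-j}\rangle=0$, $\langle a_{\epsilon i},v\rangle=\langle a_{\delta j},v\rangle=\frac38$, $\langle v,v\rangle=2$. Universal algebra: let $\hat X$ be the free commutative non-associative magma on $\hat a_{\pm1},\hat a_{\pm2},\hat a_{\pm3}$; let $\sim$ be the equivalence relation on $\hat X\times\hat X$ generated by $(\hat x\cdot\hat y,\hat z)\sim(\hat x,\hat y\cdot\hat z)$; let $\hat R=\mathbb{R}[\lambda_{[\hat x,\hat y]}]$ be the polynomial ring with one indeterminate for each $\sim$-class; let $\hat M=\hat R\hat X$ be the algebra of formal $\hat R$-linear combinations of elements of $\hat X$, with $\hat R$-bilinear form $\langle\hat x,\hat y\rangle=\lambda_{[\hat x,\hat y]}$. For ideals $I$ of $\hat M$ and $J\ne\hat R$ of $\hat R$ with $J\hat M\subseteq I$ and $\langle I,\hat M\rangle\subseteq J$, the quotient $\hat M/I$ is an algebra with form over its coefficient ring $\hat R/J$, with marked generators $a_{\pm i}$ the images of $\hat a_{\pm i}$. Let $\mathcal{C}_{4A}$ be the class of such quotients which are primitive Frobenius $(\mathcal{M},* )$-axial algebras (with axes the marked generators) satisfying property $\mathcal{P}$ and having shape $4A$. $M_{4A}$ denotes the universal member of $\mathcal{C}_{4A}$ (given by the smallest pair $(I,J)$; all members of $\mathcal{C}_{4A}$ are quotients of it), and $R_{4A}=\hat R/J$ its coefficient ring. Specialisation: $R_{4A}$ is the polynomial ring $\mathbb{R}[t]$ in $t=\langle a_1,v_{(2,3)}\rangle$. For a real number $t_0$, $M(t_0)$ denotes the real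 algebra $M_{4A}/(t-t_0)M_{4A}$ obtained by letting $t$ take the value $t_0$ (a $12$-dimensional axial algebra of Monster type), with axes the images of $a_{\pm1},a_{\pm2},a_{\pm3}$ and with the induced Frobenius form. *)

(* Defs.v *)
From HB Require Import structures.
From mathcomp Require Import all_boot all_algebra.
From mathcomp Require Import boolp classical_sets reals.
From mathcomp Require Import finmap.
From mathcomp.multinomials Require Import monalg.
From Stdlib Require Import Relations.

Set Implicit Arguments.
Unset Strict Implicit.
Unset Printing Implicit Defensive.

Import GRing.Theory Num.Theory.

Local Open Scope classical_set_scope.
Local Open Scope ring_scope.
Local Open Scope quotient_scope.

(* [fa_coef] is only a [comPzRingType] (it may be the zero ring), because the
   quotients below are defined for all ideals; the coefficient ring contains
   the reals as a subfield exactly when it is nonzero, and this is required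
   where it matters (see [C_4A]). *)
Record formed_algebra (K : realType) := FormedAlgebra {
  fa_coef : comPzRingType;
  fa_emb : {rmorphism K -> fa_coef};
  fa_car :> lmodType fa_coef;
  fa_mul : fa_car -> fa_car -> fa_car;
  fa_form : fa_car -> fa_car -> fa_coef;
  fa_mulC : commutative fa_mul;
  fa_mul_linear : forall u, linear (fa_mul u);
  fa_form_linearl : forall v, scalar (fa_form^~ v);
  fa_form_linearr : forall u, scalar (fa_form u)
}.

Arguments fa_emb {K} V : rename.

Section AxialAlgebras.
Variables (K : realType) (V : formed_algebra K).

Local Notation "x ∘ y" := (@fa_mul K V x y) (at level 40, left associativity).
Local Notation "⟪ x , y ⟫" := (@fa_form K V x y) (at level 0).
Local Notation "c %:e" := (fa_emb V c) (at level 2, format "c %:e").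

Definition subalgebra (S : set V) : Prop :=
  [/\ S 0, (forall (c : fa_coef V) u v, S u -> S v -> S (c *: u + v)) &
      forall u v, S u -> S v -> S (u ∘ v)].

Definition generated (A : set V) : set V :=
  [set u | forall S, subalgebra S -> A `<=` S -> S u].

Definition eigspace (a : V) (l : K) : set V := [set v | a ∘ v = l%:e *: v].

(* Sum of the eigenspaces for the eigenvalues in [L]; it is {0} if [L] is
   empty. *)
Definition eigensum (a : V) (L : seq K) : set V :=
  [set v | exists2 f : K -> V,
     forall l, l \in L -> eigspace a l (f l) & v = \sum_(l <- L) f l].

Definition eigensum_direct (a : V) (L : seq K) : Prop :=
  forall f : K -> V, (forall l, l \in L -> eigspace a l (f l)) ->
    \sum_(l <- L) f l = 0 -> forall l, l \in L -> f l = 0.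

Definition monster : seq K := [:: 1; 0; 4^-1; 32^-1].

(* Only meaningful on [monster]. *)
Definition monster_fusion (l m : K) : seq K :=
  if (l == 32^-1) && (m == 32^-1) then [:: 1; 0; 4^-1]
  else if (l == 32^-1) || (m == 32^-1) then [:: 32^-1]
  else if (l == 4^-1) && (m == 4^-1) then [:: 1; 0]
  else if (l == 4^-1) || (m == 4^-1) then [:: 4^-1]
  else if l == m then [:: l] else [::].

Definition monster_axis (a : V) : Prop :=
  [/\ a ∘ a = a, eigensum a monster = [set: V], eigensum_direct a monster &
      forall l m u v, l \in monster -> m \in monster ->
        eigspace a l u -> eigspace a m v ->
        eigensum a (monster_fusion l m) (u ∘ v)].

Definition primitive (a : V) : Prop :=
  eigspace a 1 = [set c *: a | c in [set: fa_coef V]].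

Definition frobenius_form (A : set V) : Prop :=
  [/\ forall u v w, ⟪u, v ∘ w⟫ = ⟪u ∘ v, w⟫,
      exists u v, ⟪u, v⟫ <> 0 &
      forall a, A a -> ⟪a, a⟫ = 1].

Definition primitive_frobenius_axial (A : set V) : Prop :=
  [/\ generated A = [set: V],
      forall a, A a -> monster_axis a /\ primitive a &
      frobenius_form A].

Definition is_miyamoto (a : V) (tau : V -> V) : Prop :=
  (forall v, eigensum a [:: 1; 0; 4^-1] v -> tau v = v) /\
  (forall v, eigspace a 32^-1 v -> tau v = - v).

(* A family [a] of six axes: [a i false] is a_i and [a i true] is a_{-i}; the
   indices 1, 2, 3 are the elements 0, 1, 2 of ['I_3]. *)

Definition property_P (a : 'I_3 -> bool -> V) : Prop :=
  forall i e, exists tau : {linear V -> V},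
    is_miyamoto (a i e) tau /\
    forall j d, tau (a j d) = a j (if j == i then d else ~~ d).

Definition type_4A (a : 'I_3 -> bool -> V) (i j : 'I_3) (v : V) : Prop :=
  [/\ v ∘ v = v,
      generated [set a i false; a j false] =
        [set u | exists c1 c2 c3 c4 c5 : fa_coef V,
           u = c1 *: a i false + c2 *: a i true
             + c3 *: a j false + c4 *: a j true + c5 *: v],
      forall e d,
      [/\ a i e ∘ a j d = (64^-1)%:e *:
            (a i e *+ 3 + a j d *+ 3 + a i (~~ e) + a j (~~ d) - v *+ 3),
          a i e ∘ v = (16^-1)%:e *:
            (a i e *+ 5 - a i (~~ e) - a j false *+ 2 - a j true *+ 2 + v *+ 3)
        & a j d ∘ v = (16^-1)%:e *:
            (a j d *+ 5 - a j (~~ d) - a i false *+ 2 - a i true *+ 2 + v *+ 3)],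
      a i false ∘ a i true = 0 /\ a j false ∘ a j true = 0 &
      (forall e d, [/\ ⟪a i e, a j d⟫ = (32^-1)%:e,
                       ⟪a i e, v⟫ = (3 / 8)%:e & ⟪a j d, v⟫ = (3 / 8)%:e]) /\
      [/\ ⟪a i false, a i true⟫ = 0, ⟪a j false, a j true⟫ = 0 &
          ⟪v, v⟫ = 2]].

Definition shape_4A (a : 'I_3 -> bool -> V) : Prop :=
  exists v : 'I_3 -> 'I_3 -> V,
    (forall i j, v i j = v j i) /\
    (forall i j, i != j -> type_4A a i j (v i j)).

(* The formula for a_i · a_j in type 4A, solved for v_(i,j). *)
Definition v_4A (a : 'I_3 -> bool -> V) (i j : 'I_3) : V :=
  a i false + a j false + (3^-1)%:e *: (a i true + a j true)
  - (64 / 3)%:e *: (a i false ∘ a j false).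

Lemma type_4A_v (a : 'I_3 -> bool -> V) (i j : 'I_3) (v : V) :
  type_4A a i j v -> v = v_4A a i j.
Proof.
case=> _ _ /(_ false false)[+ _ _] _ _; rewrite /v_4A => ->.
have e3 : (3^-1)%:e * 3%:R = 1 :> fa_coef V.
  rewrite -(rmorph_nat (fa_emb V)) -rmorphM /= mulVf ?rmorph1 //.
  by rewrite pnatr_eq0.
rewrite scalerA -rmorphM /=.
have -> : 64 / 3 * 64^-1 = 3^-1 :> K.
  by rewrite mulrAC divff ?mul1r // pnatr_eq0.
have s3 (x : V) : (3^-1)%:e *: (x *+ 3) = x.
  by rewrite -scaler_nat scalerA e3 scale1r.
have sD (p q r s t : V) : (3^-1)%:e *: (p + q + r + s - t) =
    (3^-1)%:e *: p + (3^-1)%:e *: q + (3^-1)%:e *: (r + s) - (3^-1)%:e *: t.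
  by rewrite scalerBr !scalerDr !addrA.
by rewrite sD !s3 opprB addrC subrK.
Qed.

(* Meant for a coefficient ring isomorphic to [K] through [fa_emb]: it need not
   be literally [K], so values of the form are compared with 0 through
   [fa_emb]. *)
Definition positive_semidefinite : Prop :=
  forall u : V, exists2 r : K, 0 <= r & ⟪u, u⟫ = r%:e.

Definition positive_definite : Prop :=
  forall u : V, u <> 0 -> exists2 r : K, 0 < r & ⟪u, u⟫ = r%:e.

End AxialAlgebras.

Section Quotients.
Variables (K : realType) (V : formed_algebra K).

(* A pair (I, J) of ideals of [V] and of its coefficient ring R (J = R is
   allowed). The form induces a form on V/I with values in R/J only if both
   <I, V> and <V, I> lie in J. For the algebra [hatM] below, whose form is not
   symmetric on pairs of generators, the second inclusion follows from the first
   as soon as the generators a are idempotent modulo I, since then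
   <a, w> = <a·a, w> = <a, w·a> = <a·w, a> modulo J. *)
Record ideal_pair := IdealPair {
  idealM : {pred V};
  idealR : {pred fa_coef V};
  idealM_submod : submod_closed idealM;
  idealM_mul : forall u w, u \in idealM -> fa_mul u w \in idealM;
  idealR_submod : submod_closed (idealR : {pred (fa_coef V)^o});
  ideal_scale : forall r (u : V), r \in idealR -> r *: u \in idealM;
  ideal_forml : forall u w, u \in idealM -> fa_form u w \in idealR;
  ideal_formr : forall u w, u \in idealM -> fa_form w u \in idealR
}.

Lemma idealM_zmod (P : ideal_pair) : zmod_closed (idealM P).
Proof.
have [I0 IZ] := idealM_submod P; split=> // u v Iu Iv.
by rewrite addrC -scaleN1r IZ.
Qed.

Lemma idealR_zmod (P : ideal_pair) : zmod_closed (idealR P).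
Proof.
have [I0 IZ] := idealR_submod P; split=> // u v Iu Iv.
by rewrite addrC -mulN1r; exact: IZ.
Qed.

HB.instance Definition _ (P : ideal_pair) :=
  GRing.isZmodClosed.Build V (idealM P) (idealM_zmod P).
HB.instance Definition _ (P : ideal_pair) :=
  GRing.isZmodClosed.Build (fa_coef V) (idealR P) (idealR_zmod P).

Variable P : ideal_pair.

Definition quotR := Quotient.quot (idealR P).
Definition quotM := Quotient.quot (idealM P).

HB.instance Definition _ := GRing.Zmodule.on quotR.
HB.instance Definition _ := GRing.Zmodule.on quotM.

Definition piR : fa_coef V -> quotR := \pi_quotR.
Definition piM : V -> quotM := \pi_quotM.

Lemma piR_eq (r s : fa_coef V) : r - s \in idealR P -> piR r = piR s.
Proof. by rewrite Quotient.idealrBE => /eqP. Qed.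

Lemma piM_eq (u v : V) : u - v \in idealM P -> piM u = piM v.
Proof. by rewrite Quotient.idealrBE => /eqP. Qed.

Lemma reprR (r : fa_coef V) : repr (piR r) - r \in idealR P.
Proof. by rewrite Quotient.idealrBE reprK. Qed.

Lemma reprM (u : V) : repr (piM u) - u \in idealM P.
Proof. by rewrite Quotient.idealrBE reprK. Qed.

Lemma piRD : {morph piR : r s / r + s}.
Proof. exact: raddfD. Qed.

Lemma piMD : {morph piM : u v / u + v}.
Proof. exact: raddfD. Qed.

Lemma piRP (Q : quotR -> Prop) : (forall r, Q (piR r)) -> forall x, Q x.
Proof. exact: quotW. Qed.

Lemma piMP (Q : quotM -> Prop) : (forall u, Q (piM u)) -> forall x, Q x.
Proof. exact: quotW. Qed.

Lemma idealR_mulr (r s : fa_coef V) : s \in idealR P -> r * s \in idealR P.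
Proof.
have [I0 IZ] := idealR_submod P => Is.
by rewrite -[r * s]addr0; exact: (IZ r _ _ Is I0).
Qed.

Lemma idealM_scale r (u : V) : u \in idealM P -> r *: u \in idealM P.
Proof.
have [I0 IZ] := idealM_submod P => Iu.
by rewrite -[r *: u]addr0; exact: (IZ r _ _ Iu I0).
Qed.

Definition quotR_mul (x y : quotR) : quotR := piR (repr x * repr y).

Lemma quotR_mulE (r s : fa_coef V) : quotR_mul (piR r) (piR s) = piR (r * s).
Proof.
apply: piR_eq; set r' := repr _; set s' := repr _.
have -> : r' * s' - r * s = r' * (s' - s) + s * (r' - r).
  by rewrite !mulrBr [s * r']mulrC [s * r]mulrC addrA subrK.
by apply: rpredD; apply: idealR_mulr; exact: reprR.
Qed.

Lemma quotR_mulA : associative quotR_mul.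
Proof.
by elim/piRP=> r; elim/piRP=> s; elim/piRP=> t; rewrite !quotR_mulE mulrA.
Qed.

Lemma quotR_mulC : commutative quotR_mul.
Proof. by elim/piRP=> r; elim/piRP=> s; rewrite !quotR_mulE mulrC. Qed.

Lemma quotR_mul1 : left_id (piR 1) quotR_mul.
Proof. by elim/piRP=> r; rewrite quotR_mulE mul1r. Qed.

Lemma quotR_mulDl : left_distributive quotR_mul +%R.
Proof.
elim/piRP=> r; elim/piRP=> s; elim/piRP=> t.
by rewrite -piRD !quotR_mulE mulrDl piRD.
Qed.

HB.instance Definition _ := GRing.Zmodule_isComPzRing.Build quotR
  quotR_mulA quotR_mulC quotR_mul1 quotR_mulDl.

Definition quotR_emb (c : K) : quotR := piR (fa_emb V c).

Lemma quotR_emb_zmod : zmod_morphism quotR_emb.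
Proof. by move=> c d; rewrite /quotR_emb rmorphB; exact: raddfB. Qed.

Lemma quotR_emb_monoid : monoid_morphism quotR_emb.
Proof.
split=> [|c d]; first by rewrite /quotR_emb rmorph1.
by rewrite /quotR_emb rmorphM; apply/esym; exact: quotR_mulE.
Qed.

HB.instance Definition _ :=
  GRing.isZmodMorphism.Build K quotR quotR_emb quotR_emb_zmod.
HB.instance Definition _ :=
  GRing.isMonoidMorphism.Build K quotR quotR_emb quotR_emb_monoid.

Definition quotM_scale (x : quotR) (u : quotM) : quotM :=
  piM (repr x *: repr u).

Lemma quotM_scaleE r (u : V) : quotM_scale (piR r) (piM u) = piM (r *: u).
Proof.
apply: piM_eq; set r' := repr _; set u' := repr _.
have -> : r' *: u' - r *: u = (r' - r) *: u' + r *: (u' - u).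
  by rewrite scalerBl scalerBr addrA subrK.
apply: rpredD; first by apply: ideal_scale; exact: reprR.
by apply: idealM_scale; exact: reprM.
Qed.

Lemma quotM_scaleA (x y : quotR) (u : quotM) :
  quotM_scale x (quotM_scale y u) = quotM_scale (x * y) u.
Proof.
elim/piRP: x => r; elim/piRP: y => s; elim/piMP: u => u.
by rewrite [_ * _]quotR_mulE !quotM_scaleE scalerA.
Qed.

Lemma quotM_scale1 : left_id 1 quotM_scale.
Proof. by elim/piMP=> u; rewrite quotM_scaleE scale1r. Qed.

Lemma quotM_scaleDr : right_distributive quotM_scale +%R.
Proof.
elim/piRP=> r; elim/piMP=> u; elim/piMP=> v.
by rewrite -piMD !quotM_scaleE scalerDr piMD.
Qed.

Lemma quotM_scaleDl (u : quotM) : {morph quotM_scale^~ u : x y / x + y}.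
Proof.
elim/piMP: u => u; elim/piRP=> r; elim/piRP=> s.
by rewrite -piRD !quotM_scaleE scalerDl piMD.
Qed.

HB.instance Definition _ := GRing.Zmodule_isLmodule.Build quotR quotM
  quotM_scaleA quotM_scale1 quotM_scaleDr quotM_scaleDl.

Definition quotM_mul (x y : quotM) : quotM := piM (fa_mul (repr x) (repr y)).

Definition quotM_form (x y : quotM) : quotR := piR (fa_form (repr x) (repr y)).

Lemma quotM_mulE (u v : V) : quotM_mul (piM u) (piM v) = piM (fa_mul u v).
Proof.
apply: piM_eq; set u' := repr _; set v' := repr _.
have mulB (x y z : V) : fa_mul x (y - z) = fa_mul x y - fa_mul x z.
  by rewrite addrC -scaleN1r (fa_mul_linear x) scaleN1r addrC.
have -> : fa_mul u' v' - fa_mul u v =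
    fa_mul u' (v' - v) + fa_mul v (u' - u).
  by rewrite !mulB (fa_mulC v u') (fa_mulC v u) addrA subrK.
by apply: rpredD; rewrite fa_mulC; apply: idealM_mul; exact: reprM.
Qed.

Lemma quotM_formE (u v : V) : quotM_form (piM u) (piM v) = piR (fa_form u v).
Proof.
apply: piR_eq; set u' := repr _; set v' := repr _.
have formBr (x y z : V) : fa_form x (y - z) = fa_form x y - fa_form x z.
  by rewrite addrC -scaleN1r (fa_form_linearr x) mulN1r addrC.
have formBl (x y z : V) : fa_form (y - z) x = fa_form y x - fa_form z x.
  by rewrite addrC -scaleN1r (fa_form_linearl x) mulN1r addrC.
have -> : fa_form u' v' - fa_form u v =
    fa_form u' (v' - v) + fa_form (u' - u) v.
  by rewrite formBr formBl addrA subrK.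
apply: rpredD; first by apply: ideal_formr; exact: reprM.
by apply: ideal_forml; exact: reprM.
Qed.

Lemma quotM_mulC : commutative quotM_mul.
Proof. by elim/piMP=> u; elim/piMP=> v; rewrite !quotM_mulE fa_mulC. Qed.

Lemma quotM_mul_linear (x : quotM) : linear (quotM_mul x).
Proof.
elim/piMP: x => w; elim/piRP=> r; elim/piMP=> u; elim/piMP=> v.
rewrite [_ *: piM u]quotM_scaleE -piMD !quotM_mulE.
by rewrite [_ *: piM _]quotM_scaleE -piMD fa_mul_linear.
Qed.

Lemma quotM_form_linearl (x : quotM) : scalar (quotM_form^~ x).
Proof.
elim/piMP: x => w; elim/piRP=> r; elim/piMP=> u; elim/piMP=> v.
rewrite [_ *: piM u]quotM_scaleE -piMD !quotM_formE.
by rewrite [_ * piR _]quotR_mulE -piRD fa_form_linearl.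
Qed.

Lemma quotM_form_linearr (x : quotM) : scalar (quotM_form x).
Proof.
elim/piMP: x => w; elim/piRP=> r; elim/piMP=> u; elim/piMP=> v.
rewrite [_ *: piM u]quotM_scaleE -piMD !quotM_formE.
by rewrite [_ * piR _]quotR_mulE -piRD fa_form_linearr.
Qed.

Definition quotient : formed_algebra K :=
  FormedAlgebra quotR_emb quotM_mulC quotM_mul_linear
    quotM_form_linearl quotM_form_linearr.

End Quotients.

Section PairConstructions.
Variables (K : realType) (V : formed_algebra K).

Definition pair_le (P Q : ideal_pair V) : Prop :=
  (forall u, u \in idealM P -> u \in idealM Q) /\
  (forall r, r \in idealR P -> r \in idealR Q).

Section Meet.
Variable C : set (ideal_pair V).

Let meetM : {pred V} := fun u => `[< forall P, C P -> u \in idealM P >].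
Let meetR : {pred fa_coef V} := fun r => `[< forall P, C P -> r \in idealR P >].

Let meetM_submod : submod_closed meetM.
Proof.
split=> [|c u v Iu Iv]; apply/asboolP => P CP; have [I0 IZ] := idealM_submod P.
  exact: I0.
by apply: IZ; [exact: (asboolW Iu) | exact: (asboolW Iv)].
Qed.

Let meetM_mul u w : u \in meetM -> fa_mul u w \in meetM.
Proof.
by move=> Iu; apply/asboolP=> P CP; exact: idealM_mul (asboolW Iu _ CP).
Qed.

Let meetR_submod : submod_closed (meetR : {pred (fa_coef V)^o}).
Proof.
split=> [|c u v Iu Iv]; apply/asboolP => P CP; have [I0 IZ] := idealR_submod P.
  exact: I0.
by apply: IZ; [exact: (asboolW Iu) | exact: (asboolW Iv)].
Qed.

Let meet_scale r (u : V) : r \in meetR -> r *: u \in meetM.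
Proof.
by move=> Ir; apply/asboolP=> P CP; exact: ideal_scale (asboolW Ir _ CP).
Qed.

Let meet_forml u w : u \in meetM -> fa_form u w \in meetR.
Proof.
by move=> Iu; apply/asboolP=> P CP; exact: ideal_forml (asboolW Iu _ CP).
Qed.

Let meet_formr u w : u \in meetM -> fa_form w u \in meetR.
Proof.
by move=> Iu; apply/asboolP=> P CP; exact: ideal_formr (asboolW Iu _ CP).
Qed.

Definition meet_pair : ideal_pair V :=
  IdealPair meetM_submod meetM_mul meetR_submod meet_scale meet_forml
    meet_formr.

Lemma meet_pair_least (P : ideal_pair V) :
    C P -> (forall Q, C Q -> pair_le P Q) ->
  idealM P =i idealM meet_pair /\ idealR P =i idealR meet_pair.
Proof.
move=> CP leP; split=> x; apply/idP/idP => Ix.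
- by apply/asboolP => Q /leP[+ _]; apply.
- exact: (asboolW Ix).
- by apply/asboolP => Q /leP[_]; apply.
- exact: (asboolW Ix).
Qed.

End Meet.

Section Scalar.
Variable x : fa_coef V.

Let scalM : {pred V} := fun u => `[< exists v : V, u = x *: v >].
Let scalR : {pred fa_coef V} := fun r => `[< exists s, r = x * s >].

Let scalM_submod : submod_closed scalM.
Proof.
split=> [|c u v]; first by apply/asboolP; exists 0; rewrite scaler0.
move=> /asboolW[u' ->] /asboolW[v' ->]; apply/asboolP; exists (c *: u' + v').
by rewrite scalerDr !scalerA mulrC.
Qed.

Let scalM_mul u w : u \in scalM -> fa_mul u w \in scalM.
Proof.
move=> /asboolW[v ->]; apply/asboolP; exists (fa_mul w v).
have mul0 : fa_mul w 0 = 0.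
  by have := fa_mul_linear w (-1) 0 0; rewrite scaler0 addr0 scaleN1r addNr.
by have := fa_mul_linear w x v 0; rewrite mul0 !addr0 fa_mulC.
Qed.

Let scalR_submod : submod_closed (scalR : {pred (fa_coef V)^o}).
Proof.
split=> [|c u v]; first by apply/asboolP; exists 0; rewrite mulr0.
move=> /asboolW[u' ->] /asboolW[v' ->]; apply/asboolP; exists (c * u' + v').
by rewrite mulrDr mulrCA.
Qed.

Let scal_scale r (u : V) : r \in scalR -> r *: u \in scalM.
Proof.
by move=> /asboolW[s ->]; apply/asboolP; exists (s *: u); rewrite scalerA.
Qed.

Let scal_forml u w : u \in scalM -> fa_form u w \in scalR.
Proof.
move=> /asboolW[v ->]; apply/asboolP; exists (fa_form v w).
have form0 : fa_form 0 w = 0.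
  by have := fa_form_linearl w (-1) 0 0; rewrite scaler0 addr0 mulN1r addNr.
by have := fa_form_linearl w x v 0; rewrite form0 !addr0.
Qed.

Let scal_formr u w : u \in scalM -> fa_form w u \in scalR.
Proof.
move=> /asboolW[v ->]; apply/asboolP; exists (fa_form w v).
have form0 : fa_form w 0 = 0.
  by have := fa_form_linearr w (-1) 0 0; rewrite scaler0 addr0 mulN1r addNr.
by have := fa_form_linearr w x v 0; rewrite form0 !addr0.
Qed.

(* The pair (xV, xR). *)
Definition scalar_pair : ideal_pair V :=
  IdealPair scalM_submod scalM_mul scalR_submod scal_scale scal_forml
    scal_formr.

End Scalar.
End PairConstructions.

(* Bilinear extensions to formal linear combinations of an operation [op] and
   of a scalar-valued function [lam] on a set [T]. *)
Section MagmaAlgebra.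
Variables (S : comNzRingType) (T : choiceType).
Variables (op : T -> T -> T) (lam : T -> T -> S).

Definition magma_mul (u v : {malg S[T]}) : {malg S[T]} :=
  \sum_(x <- msupp u) \sum_(y <- msupp v) << u@_x * v@_y *g op x y >>.

Definition magma_form (u v : {malg S[T]}) : S :=
  \sum_(x <- msupp u) \sum_(y <- msupp v) u@_x * v@_y * lam x y.

Lemma magma_mulE (A B : {fset T}) (u v : {malg S[T]}) :
    (msupp u `<=` A)%fset -> (msupp v `<=` B)%fset ->
  magma_mul u v = \sum_(x <- A) \sum_(y <- B) << u@_x * v@_y *g op x y >>.
Proof.
move=> uA vB; rewrite /magma_mul (big_fset_incl _ uA); last first.
  by move=> x _ /mcoeff_outdom ->; rewrite big1 // => y _; rewrite mul0r monalgU0.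
apply: eq_bigr => x _; apply: big_fset_incl vB _ => y _ /mcoeff_outdom ->.
by rewrite mulr0 monalgU0.
Qed.

Lemma magma_formE (A B : {fset T}) (u v : {malg S[T]}) :
    (msupp u `<=` A)%fset -> (msupp v `<=` B)%fset ->
  magma_form u v = \sum_(x <- A) \sum_(y <- B) u@_x * v@_y * lam x y.
Proof.
move=> uA vB; rewrite /magma_form (big_fset_incl _ uA); last first.
  by move=> x _ /mcoeff_outdom ->; rewrite big1 // => y _; rewrite !mul0r.
apply: eq_bigr => x _; apply: big_fset_incl vB _ => y _ /mcoeff_outdom ->.
by rewrite mulr0 mul0r.
Qed.

Lemma magma_mulC (opC : commutative op) : commutative magma_mul.
Proof.
move=> u v; rewrite /magma_mul exchange_big; apply: eq_bigr => y _.
by apply: eq_bigr => x _; rewrite mulrC opC.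
Qed.

Lemma magma_mul_linear (u : {malg S[T]}) : linear (magma_mul u).
Proof.
move=> c v w; set B := (msupp (c *: v + w) `|` (msupp v `|` msupp w))%fset.
have Bv : (msupp v `<=` B)%fset.
  exact: fsubset_trans (fsubsetUl _ _) (fsubsetUr _ _).
have Bw : (msupp w `<=` B)%fset.
  exact: fsubset_trans (fsubsetUr _ _) (fsubsetUr _ _).
have uu := fsubset_refl (msupp u).
rewrite (magma_mulE uu (fsubsetUl _ _ : _ `<=` B)%fset).
rewrite (magma_mulE uu Bv) (magma_mulE uu Bw) scaler_sumr -big_split.
apply: eq_bigr => x _; rewrite /= scaler_sumr -big_split.
apply: eq_bigr => y _ /=; rewrite mcoeffD mcoeffZ mulrDr monalgUD.
congr (_ + _); apply/malgP => z.
by rewrite mcoeffZ !mcoeffU mulrCA mulrnAr.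
Qed.

Lemma magma_form_linearr (u : {malg S[T]}) : scalar (magma_form u).
Proof.
move=> c v w; set B := (msupp (c *: v + w) `|` (msupp v `|` msupp w))%fset.
have Bv : (msupp v `<=` B)%fset.
  exact: fsubset_trans (fsubsetUl _ _) (fsubsetUr _ _).
have Bw : (msupp w `<=` B)%fset.
  exact: fsubset_trans (fsubsetUr _ _) (fsubsetUr _ _).
have uu := fsubset_refl (msupp u).
rewrite (magma_formE uu (fsubsetUl _ _ : _ `<=` B)%fset).
rewrite (magma_formE uu Bv) (magma_formE uu Bw) mulr_sumr -big_split.
apply: eq_bigr => x _; rewrite /= mulr_sumr -big_split.
apply: eq_bigr => y _ /=; rewrite mcoeffD mcoeffZ mulrDr mulrDl.
by rewrite mulrCA -!mulrA.
Qed.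

Lemma magma_form_linearl (v : {malg S[T]}) : scalar (magma_form^~ v).
Proof.
move=> c u w; set B := (msupp (c *: u + w) `|` (msupp u `|` msupp w))%fset.
have Bu : (msupp u `<=` B)%fset.
  exact: fsubset_trans (fsubsetUl _ _) (fsubsetUr _ _).
have Bw : (msupp w `<=` B)%fset.
  exact: fsubset_trans (fsubsetUr _ _) (fsubsetUr _ _).
have vv := fsubset_refl (msupp v).
rewrite (magma_formE (fsubsetUl _ _ : _ `<=` B)%fset vv).
rewrite (magma_formE Bu vv) (magma_formE Bw vv) mulr_sumr -big_split.
apply: eq_bigr => x _; rewrite /= mulr_sumr -big_split.
apply: eq_bigr => y _ /=; rewrite mcoeffD mcoeffZ !mulrDl.
by rewrite -!mulrA.
Qed.

End MagmaAlgebra.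

(* Free commutative magma on the six generators: binary trees modulo the
   congruence generated by x·y = y·x. The leaf [(i, e)] stands for the generator
   â_i if [e] is [false] and â_{-i} if [e] is [true], with [i] as above. *)

Inductive tree := Leaf of 'I_3 * bool | Node of tree & tree.

Fixpoint tree_encode (x : tree) : GenTree.tree ('I_3 * bool) :=
  match x with
  | Leaf g => GenTree.Leaf g
  | Node x y => GenTree.Node 0 [:: tree_encode x; tree_encode y]
  end.

Fixpoint tree_decode (t : GenTree.tree ('I_3 * bool)) : option tree :=
  match t with
  | GenTree.Leaf g => Some (Leaf g)
  | GenTree.Node _ [:: x; y] =>
      if (tree_decode x, tree_decode y) is (Some x', Some y')
      then Some (Node x' y') else None
  | _ => None
  end.

Lemma tree_encodeK : pcancel tree_encode tree_decode.
Proof. by elim=> //= x -> y ->. Qed.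

HB.instance Definition _ := Choice.copy tree (pcan_type tree_encodeK).

Inductive tree_cong : tree -> tree -> Prop :=
  | TreeRefl x : tree_cong x x
  | TreeSym x y : tree_cong x y -> tree_cong y x
  | TreeTrans y x z : tree_cong x y -> tree_cong y z -> tree_cong x z
  | TreeNode x x' y y' :
      tree_cong x x' -> tree_cong y y' -> tree_cong (Node x y) (Node x' y')
  | TreeComm x y : tree_cong (Node x y) (Node y x).

Definition tree_eq : rel tree := fun x y => `[< tree_cong x y >].

Lemma tree_eq_equiv : equiv_class_of tree_eq.
Proof.
split=> [x|x y|y x z]; first by exact/asboolP/TreeRefl.
- by apply/asboolP/asboolP; exact: TreeSym.
- by move=> xy yz; apply/asboolP; exact: TreeTrans (asboolW xy) (asboolW yz).
Qed.

Canonical tree_equiv_rel := EquivRelPack tree_eq_equiv.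

Canonical tree_encModRel := defaultEncModRel tree_eq.

Definition magma := {eq_quot tree_eq}.

Definition gen (i : 'I_3) (e : bool) : magma := \pi_magma (Leaf (i, e)).

Definition mop (x y : magma) : magma := \pi_magma (Node (repr x) (repr y)).

Lemma mop_pi (x y : tree) : mop (\pi_magma x) (\pi_magma y) = \pi_magma (Node x y).
Proof.
have reprE z : tree_cong (repr (\pi_magma z)) z.
  suff: tree_eq (repr (\pi_magma z)) z by move/asboolP.
  by rewrite -(@pi_eq_quot _ _ magma) reprK.
by apply/eqP; rewrite (@pi_eq_quot _ _ magma); apply/asboolP/TreeNode.
Qed.

Lemma mopC : commutative mop.
Proof.
move=> x y; apply/eqP; rewrite (@pi_eq_quot _ _ magma).
by apply/asboolP/TreeComm.
Qed.

(* Indeterminates λ_[x,y]: pairs modulo (x·y, z) ~ (x, y·z). *)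

Inductive assoc_step : magma * magma -> magma * magma -> Prop :=
  AssocStep x y z : assoc_step (mop x y, z) (x, mop y z).

Definition pair_eq : rel (magma * magma) :=
  fun p q => `[< clos_refl_sym_trans _ assoc_step p q >].

Lemma pair_eq_equiv : equiv_class_of pair_eq.
Proof.
split=> [x|x y|y x z]; first by apply/asboolP/rst_refl.
- by apply/asboolP/asboolP; exact: rst_sym.
- by move=> xy yz; apply/asboolP; exact: rst_trans (asboolW xy) (asboolW yz).
Qed.

Canonical pair_equiv_rel := EquivRelPack pair_eq_equiv.

Canonical pair_encModRel := defaultEncModRel pair_eq.

Definition indet := {eq_quot pair_eq}.

Section Universal.
Variable K : realType.

(* Polynomial ring over [K] in the indeterminates [indet]: the monoid algebra
   of the free commutative monoid [{cmonom indet}]. *)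
Definition hatR := {malg K[{cmonom indet}]}.

Definition lambda (x y : magma) : hatR :=
  << ucm (\pi_indet (x, y)) >>%R.

Definition hatM := {malg hatR[magma]}.

Definition hat_gen (i : 'I_3) (e : bool) : hatM := << gen i e >>%R.

Definition hat_algebra : formed_algebra K :=
  @FormedAlgebra K hatR (@malgC {cmonom indet} K)%function hatM
    (magma_mul mop) (magma_form lambda)
    (magma_mulC mopC) (magma_mul_linear mop)
    (magma_form_linearl lambda) (magma_form_linearr lambda).

Definition marked (P : ideal_pair hat_algebra) (i : 'I_3) (e : bool) :
  quotient P := piM P (hat_gen i e : hat_algebra).

Definition C_4A : set (ideal_pair hat_algebra) :=
  [set P | [/\ 1 \notin idealR P,
      primitive_frobenius_axial [set a | exists i e, a = marked P i e],
      property_P (marked P) & shape_4A (marked P)]].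

(* The smallest pair of the class, obtained as the intersection of all pairs of
   the class; see [meet_pair_least]. *)
Definition pair_4A : ideal_pair hat_algebra := meet_pair C_4A.

Definition M_4A : formed_algebra K := quotient pair_4A.

(* <a_1, v_(2,3)>; the formula [v_4A] for v_(2,3) is justified by [type_4A_v]. *)
Definition t_4A : fa_coef M_4A :=
  fa_form (marked pair_4A 0 false) (v_4A (marked pair_4A) 1 2).

Definition M (t0 : K) : formed_algebra K :=
  quotient (scalar_pair (t_4A - fa_emb M_4A t0)).

End Universal.

(* Main.v *)
(* M(t) has a basis of twelve elements: the axes a_{±i}, the idempotents
   v_i = v_(j,k) and the elements u_i = a_i v_i - t a_i. That they span follows
   from the fusion rules, which pass from the members of C_4A to M_4A: applied to
   the 0- and 1/4-eigenvectors of an axis in the two subalgebras of type 4A that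
   contain it, they determine the products with the axes and the values of the
   form, and the resurrection principle shows that the span is closed under the
   remaining products. That they are independent follows from an explicit algebra
   with these structure constants, which is shown to be a member of C_4A, so that
   M_4A maps onto it. The Gram matrix of the basis decomposes under the
   symmetries into the differences a_i - a_{-i}, of norm 2, and two
   3x3 blocks (trivial and standard representation of S_3) whose determinants
   are positive multiples of t (1/6 - t) (9/4 - t)^2. *)

Require Import Defs.
From HB Require Import structures.
From Stdlib Require Import ZArith QArith Relations.
From mathcomp Require Import all_boot all_order all_algebra.
From mathcomp Require Import boolp classical_sets reals finmap.
From mathcomp.zify Require Import ssrZ.
From mathcomp Require Import lra.
From mathcomp.multinomials Require Import monalg.

Set Implicit Arguments.
Unset Strict Implicit.
Unset Printing Implicit Defensive.

Import Order.TTheory GRing.Theory Num.Theory.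

Local Open Scope classical_set_scope.
Local Open Scope ring_scope.
Local Open Scope quotient_scope.

(** * Formal coordinates with coefficients in Q[t] *)

Local Arguments Qred : simpl never.
Local Arguments Qplus : simpl never.
Local Arguments Qmult : simpl never.

(** The pair [pair_4A] is an intersection, and it is not evident that it belongs to [C_4A]: the
    eigenspace decomposition and primitivity assert that certain elements exist, and existence does
    not pass from the members to the intersection. The proof therefore works with [fusion_family],
    which consists of equations and implications between equations; primitivity survives there as a
    formula, through the form, for the 1-component of a product. Not all products of M_4A are
    computed either: v_i u_j and u_i u_j are only shown to stay in the span over K[t]. This
    suffices, because all values of the form then lie in K[t], and independence is tested in a model
    over K for one value of t at a time. The coefficient rings of M_4A and M(t) are abstract
    quotients, in which nothing can be computed. All calculations are made on vectors with
    coefficients in Q[t] and transported into the algebra at hand by [vev]. Products not yet known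
    enter them as additional coordinates, so that each use of a fusion rule becomes a linear
    relation between these unknowns. *)

Definition tpoly := seq Q.

(** Coefficients are listed by increasing degree; [Qred] keeps the fractions in lowest terms, so
    that long computations stay small. *)
Fixpoint padd (p q : tpoly) : tpoly :=
  match p, q with
  | [::], _ => q
  | _, [::] => p
  | x :: p', y :: q' => Qred (x + y) :: padd p' q'
  end.

Definition pscal (c : Q) (p : tpoly) : tpoly := [seq Qred (c * x) | x <- p].

Fixpoint pmul (p q : tpoly) : tpoly :=
  if p is x :: p' then padd (pscal x q) (Qmake 0 1 :: pmul p' q) else [::].

Definition pnull (p : tpoly) : bool := all (fun x => Qeq_bool x 0) p.

Definition tvec := seq tpoly.

Fixpoint vadd (u v : tvec) : tvec :=
  match u, v with
  | [::], _ => v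
  | _, [::] => u
  | p :: u', q :: v' => padd p q :: vadd u' v'
  end.

Definition vscal (p : tpoly) (v : tvec) : tvec := [seq pmul p q | q <- v].

Definition atom (n : nat) : tvec := ncons n [::] [:: [:: Qmake 1 1]].

Definition vnull (v : tvec) : bool := all pnull v.

Definition cst (c : Q) : tpoly := [:: c].
Definition lint (c d : Q) : tpoly := [:: c; d].
Definition quadt (c d e : Q) : tpoly := [:: c; d; e].

Declare Scope tvec_scope.
Delimit Scope tvec_scope with tv.
Bind Scope tvec_scope with tvec.
Notation "u + v" := (vadd u v) : tvec_scope.
Notation "- u" := (vscal (cst (-1)) u) : tvec_scope.
Notation "u - v" := (vadd u (vscal (cst (-1)) v)) : tvec_scope.
Notation "p *: v" := (vscal p v) : tvec_scope.

Definition veq (u v : tvec) : bool := vnull (u - v)%tv.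

Definition obind2 {A B C : Type} (f : A -> B -> C) x y : option C :=
  if x is Some x' then if y is Some y' then Some (f x' y') else None else None.

(* The product of two coordinate vectors is defined as soon as the products of
   basis vectors that it involves are given by the partial table [T]. *)
Section Product.
Variable T : nat -> nat -> option tvec.

Fixpoint vmul_atom (i j : nat) (p : tpoly) (v : tvec) : option tvec :=
  if v is q :: v' then
    if pnull q then vmul_atom i j.+1 p v'
    else obind2 vadd (omap (vscal (pmul p q)) (T i j)) (vmul_atom i j.+1 p v')
  else Some [::].

Fixpoint vmul_from (i : nat) (u v : tvec) : option tvec :=
  if u is p :: u' then
    if pnull p then vmul_from i.+1 u' v
    else obind2 vadd (vmul_atom i 0 p v) (vmul_from i.+1 u' v)
  else Some [::].

Definition vmul (u v : tvec) : option tvec := vmul_from 0 u v.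

Definition vmul_eq (u v w : tvec) : bool :=
  if vmul u v is Some z then veq z w else false.
End Product.

Definition peq (p q : tpoly) : bool := pnull (padd p (pscal (-1) q)).

Section FormProduct.
Variable G : nat -> nat -> option tpoly.

Fixpoint vform_atom (i j : nat) (p : tpoly) (v : tvec) : option tpoly :=
  if v is q :: v' then
    if pnull q then vform_atom i j.+1 p v'
    else obind2 padd (omap (pmul (pmul p q)) (G i j)) (vform_atom i j.+1 p v')
  else Some [::].

Fixpoint vform_from (i : nat) (u v : tvec) : option tpoly :=
  if u is p :: u' then
    if pnull p then vform_from i.+1 u' v
    else obind2 padd (vform_atom i 0 p v) (vform_from i.+1 u' v)
  else Some [::].

Definition vform (u v : tvec) : option tpoly := vform_from 0 u v.

Definition vform_eq (u v : tvec) (r : tpoly) : bool :=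
  if vform u v is Some z then peq z r else false.
End FormProduct.

(** * Bilinearity of the product and of the form *)

Section FormedAlgebraTheory.
Variables (K : realType) (V : formed_algebra K).
Implicit Types (u v w : V) (r : fa_coef V).

Lemma fa_mulDr u v w : fa_mul u (v + w) = fa_mul u v + fa_mul u w.
Proof. by have := fa_mul_linear u 1 v w; rewrite !scale1r. Qed.
Lemma fa_mulDl u v w : fa_mul (u + v) w = fa_mul u w + fa_mul v w.
Proof. by rewrite ![fa_mul _ w]fa_mulC fa_mulDr. Qed.
Lemma fa_mulr0 u : fa_mul u 0 = 0.
Proof. by apply: (@addrI _ (fa_mul u 0)); rewrite -fa_mulDr !addr0. Qed.
Lemma fa_mul0r u : fa_mul 0 u = 0.
Proof. by rewrite fa_mulC fa_mulr0. Qed.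
Lemma fa_mulZr u r v : fa_mul u (r *: v) = r *: fa_mul u v.
Proof. by have := fa_mul_linear u r v 0; rewrite !(addr0, fa_mulr0). Qed.
Lemma fa_mulZl u r v : fa_mul (r *: u) v = r *: fa_mul u v.
Proof. by rewrite fa_mulC fa_mulZr fa_mulC. Qed.
Lemma fa_mulNr u v : fa_mul u (- v) = - fa_mul u v.
Proof. by rewrite -scaleN1r fa_mulZr scaleN1r. Qed.
Lemma fa_mulBr u v w : fa_mul u (v - w) = fa_mul u v - fa_mul u w.
Proof. by rewrite fa_mulDr fa_mulNr. Qed.
Lemma fa_mulBl u v w : fa_mul (u - v) w = fa_mul u w - fa_mul v w.
Proof. by rewrite ![fa_mul _ w]fa_mulC fa_mulBr. Qed.
Lemma fa_mul_sumr (I : Type) (s : seq I) (P : pred I) (F : I -> V) u :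
  fa_mul u (\sum_(i <- s | P i) F i) = \sum_(i <- s | P i) fa_mul u (F i).
Proof.
by elim/big_rec2: _ => [|i x y _ <-]; rewrite ?fa_mulr0 ?fa_mulDr.
Qed.
Lemma fa_mul_suml (I : Type) (s : seq I) (P : pred I) (F : I -> V) u :
  fa_mul (\sum_(i <- s | P i) F i) u = \sum_(i <- s | P i) fa_mul (F i) u.
Proof. by rewrite fa_mulC fa_mul_sumr; under eq_bigr do rewrite fa_mulC. Qed.

Lemma fa_formDr u v w : fa_form u (v + w) = fa_form u v + fa_form u w.
Proof. by have := fa_form_linearr u 1 v w; rewrite scale1r mul1r. Qed.
Lemma fa_formDl u v w : fa_form (u + v) w = fa_form u w + fa_form v w.
Proof. by have := fa_form_linearl w 1 u v; rewrite scale1r mul1r. Qed.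
Lemma fa_formr0 u : fa_form u 0 = 0.
Proof. by apply: (@addrI _ (fa_form u 0)); rewrite -fa_formDr !addr0. Qed.
Lemma fa_form0r u : fa_form 0 u = 0.
Proof. by apply: (@addrI _ (fa_form 0 u)); rewrite -fa_formDl !addr0. Qed.
Lemma fa_formZr u r v : fa_form u (r *: v) = r * fa_form u v.
Proof. by have := fa_form_linearr u r v 0; rewrite !(addr0, fa_formr0). Qed.
Lemma fa_formZl u r v : fa_form (r *: u) v = r * fa_form u v.
Proof. by have := fa_form_linearl v r u 0; rewrite !(addr0, fa_form0r). Qed.
Lemma fa_formNr u v : fa_form u (- v) = - fa_form u v.
Proof. by rewrite -scaleN1r fa_formZr mulN1r. Qed.
Lemma fa_formNl u v : fa_form (- u) v = - fa_form u v.
Proof. by rewrite -scaleN1r fa_formZl mulN1r. Qed.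
Lemma fa_formBr u v w : fa_form u (v - w) = fa_form u v - fa_form u w.
Proof. by rewrite fa_formDr fa_formNr. Qed.
Lemma fa_formBl u v w : fa_form (u - v) w = fa_form u w - fa_form v w.
Proof. by rewrite fa_formDl fa_formNl. Qed.
Lemma fa_form_sumr (I : Type) (s : seq I) (P : pred I) (F : I -> V) u :
  fa_form u (\sum_(i <- s | P i) F i) = \sum_(i <- s | P i) fa_form u (F i).
Proof.
by elim/big_rec2: _ => [|i x y _ <-]; rewrite ?fa_formr0 ?fa_formDr.
Qed.
Lemma fa_form_suml (I : Type) (s : seq I) (P : pred I) (F : I -> V) u :
  fa_form (\sum_(i <- s | P i) F i) u = \sum_(i <- s | P i) fa_form (F i) u.
Proof.
by elim/big_rec2: _ => [|i x y _ <-]; rewrite ?fa_form0r ?fa_formDl.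
Qed.
End FormedAlgebraTheory.

(** * Rational numbers as elements of the real field *)

Section Rationals.
Variable K : realType.

Definition zval (z : Z) : K := (int_of_Z z)%:~R.

Definition qval (q : Q) : K := zval (Qnum q) / zval (Zpos (Qden q)).

Lemma zvalD : {morph zval : x y / Z.add x y >-> x + y}.
Proof. by move=> x y; rewrite /zval (raddfD int_of_Z) rmorphD. Qed.
Lemma zvalM : {morph zval : x y / Z.mul x y >-> x * y}.
Proof. by move=> x y; rewrite /zval (rmorphM int_of_Z) rmorphM. Qed.
Lemma zval_pos p : zval (Zpos p) != 0.
Proof.
rewrite /zval intr_eq0; apply/eqP => /(congr1 Z_of_int).
by rewrite int_of_ZK.
Qed.

Lemma qval_eq (p q : Q) : Qeq p q -> qval p = qval q.
Proof.
move=> pq; apply/eqP; rewrite /qval eqr_div ?zval_pos //.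
by rewrite -!zvalM (pq : Z.mul _ _ = Z.mul _ _).
Qed.
Lemma qvalD (p q : Q) : qval (Qplus p q) = qval p + qval q.
Proof.
rewrite /qval /= addf_div ?zval_pos // zvalD !zvalM.
by rewrite (zvalM (Zpos _) (Zpos _)).
Qed.
Lemma qvalM (p q : Q) : qval (Qmult p q) = qval p * qval q.
Proof. by rewrite /qval /= mulf_div zvalM (zvalM (Zpos _) (Zpos _)). Qed.
Lemma qval0 : qval 0 = 0.
Proof. by rewrite /qval mul0r. Qed.
Lemma qval1 : qval 1 = 1.
Proof. by rewrite /qval divff // zval_pos. Qed.
Lemma qvalN1 : qval (-1) = -1.
Proof. exact: (divr1 (-1)). Qed.
End Rationals.

(** * Evaluation of formal coordinates in an algebra *)

Section Evaluation.
Variables (K : realType) (V : formed_algebra K) (t : fa_coef V) (b : nat -> V).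
Implicit Types (p q : tpoly) (u v w : tvec).
Local Notation R := (fa_coef V).

Definition qev (c : Q) : R := fa_emb V (qval K c).

Fixpoint pev p : R := if p is c :: p' then qev c + t * pev p' else 0.

Fixpoint vev_from (n : nat) v : V :=
  if v is p :: v' then pev p *: b n + vev_from n.+1 v' else 0.

Definition vev v : V := vev_from 0 v.

Lemma qev_eq (c d : Q) : Qeq c d -> qev c = qev d.
Proof. by move=> cd; rewrite /qev (qval_eq K cd). Qed.
Lemma qev_red c : qev (Qred c) = qev c.
Proof. by apply: qev_eq; exact: Qred_correct. Qed.
Lemma qevD (c d : Q) : qev (Qplus c d) = qev c + qev d.
Proof. by rewrite /qev qvalD rmorphD. Qed.
Lemma qevM (c d : Q) : qev (Qmult c d) = qev c * qev d.
Proof. by rewrite /qev qvalM rmorphM. Qed.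
Lemma qev0 : qev (Qmake 0 1) = 0. Proof. by rewrite /qev qval0 rmorph0. Qed.
Lemma qev1 : qev (Qmake 1 1) = 1. Proof. by rewrite /qev qval1 rmorph1. Qed.
Lemma qevN1 : qev (Qmake (-1) 1) = -1.
Proof. by rewrite /qev qvalN1 rmorphN1. Qed.

Lemma pevD p q : pev (padd p q) = pev p + pev q.
Proof.
elim: p q => [|c p IH] [|d q] /=; rewrite ?add0r ?addr0 //.
by rewrite qev_red qevD IH mulrDr addrACA.
Qed.
Lemma pev_scal c p : pev (pscal c p) = qev c * pev p.
Proof.
elim: p => [|d p IH] /=; first by rewrite mulr0.
by rewrite qev_red qevM IH mulrDr mulrCA.
Qed.
Lemma pevM p q : pev (pmul p q) = pev p * pev q.
Proof.
elim: p => [|c p IH] /=; first by rewrite mul0r.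
by rewrite pevD pev_scal /= qev0 add0r IH mulrDl mulrA.
Qed.
Lemma pev_null p : pnull p -> pev p = 0.
Proof.
elim: p => //= c p IH /andP[/Qeq_bool_eq c0 /IH ->].
by rewrite (qev_eq c0) qev0 mulr0 addr0.
Qed.
Lemma pev_eq p q : peq p q -> pev p = pev q.
Proof.
move=> /pev_null/eqP; rewrite pevD pev_scal qevN1 mulN1r subr_eq0.
by move=> /eqP.
Qed.
Lemma pev_cst c : pev (cst c) = qev c.
Proof. by rewrite /= mulr0 addr0. Qed.

Lemma vev_fromD n u v : vev_from n (u + v)%tv = vev_from n u + vev_from n v.
Proof.
elim: u v n => [|p u IH] [|q v] n /=; rewrite ?add0r ?addr0 //.
by rewrite pevD IH scalerDl addrACA.
Qed.
Lemma vevD u v : vev (u + v)%tv = vev u + vev v.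
Proof. exact: vev_fromD. Qed.
Lemma vev_fromZ n p v : vev_from n (p *: v)%tv = pev p *: vev_from n v.
Proof.
elim: v n => [|q v IH] n /=; first by rewrite scaler0.
by rewrite pevM IH scalerDr scalerA.
Qed.
Lemma vevZ p v : vev (p *: v)%tv = pev p *: vev v.
Proof. exact: vev_fromZ. Qed.
Lemma vevN v : vev (- v)%tv = - vev v.
Proof. by rewrite vevZ pev_cst qevN1 scaleN1r. Qed.
Lemma vevB u v : vev (u - v)%tv = vev u - vev v.
Proof. by rewrite vevD vevN. Qed.
Lemma vev_atom n : vev (atom n) = b n.
Proof.
suff H m : vev_from m (atom n) = b (m + n) by exact: H.
rewrite /atom; elim: n m => [|n IH] m /=.
  by rewrite qev1 mulr0 !addr0 scale1r addn0.
by rewrite scale0r add0r IH addSnnS.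
Qed.
Lemma vev_null v : vnull v -> vev v = 0.
Proof.
rewrite /vev; elim: v 0%N => //= p v IH n /andP[/pev_null -> /IH ->].
by rewrite scale0r addr0.
Qed.
Lemma vev_eq u v : veq u v -> vev u = vev v.
Proof. by move=> /vev_null/eqP; rewrite vevB subr_eq0 => /eqP. Qed.

Section Tables.
Variables (T : nat -> nat -> option tvec) (G : nat -> nat -> option tpoly).
Hypothesis TP : forall i j v, T i j = Some v -> fa_mul (b i) (b j) = vev v.
Hypothesis GP : forall i j p, G i j = Some p -> fa_form (b i) (b j) = pev p.

Lemma vmul_atomP i j p v w : vmul_atom T i j p v = Some w ->
  fa_mul (pev p *: b i) (vev_from j v) = vev w.
Proof.
elim: v j w => [|q v IH] j w /=; first by case=> <-; rewrite fa_mulr0.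
case: ifP => [/pev_null q0 /IH <-|_]; first by rewrite q0 scale0r add0r.
case E: (T i j) => [z|] //=; case E': (vmul_atom _ _ _ _ _) => [z'|] //= -[<-].
rewrite fa_mulDr (IH _ _ E') vevD vevZ pevM -(TP E).
by rewrite fa_mulZl fa_mulZr scalerA.
Qed.
(** Soundness of the partial product for any table whose entries hold for [b]. The same computation
    thus serves for the complete table of the model and for the incomplete tables of the products
    that are known at some stage of the argument in M_4A. *)
Lemma vmulP u v w : vmul T u v = Some w -> fa_mul (vev u) (vev v) = vev w.
Proof.
move: w; rewrite /vmul {1}/vev; elim: u {1 2}0%N => [|p u IH] i w /=.
  by case=> <-; rewrite fa_mul0r.
case: ifP => [/pev_null p0 /IH <-|_]; first by rewrite p0 scale0r add0r.
case E: (vmul_atom _ _ _ _ _) => [z|] //=.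
case E': (vmul_from _ _ _ _) => [z'|] //= -[<-].
by rewrite fa_mulDl (IH _ _ E') vevD (vmul_atomP E).
Qed.
Lemma vmul_eqP u v w : vmul_eq T u v w -> fa_mul (vev u) (vev v) = vev w.
Proof.
by rewrite /vmul_eq; case E: vmul => [z|] // /vev_eq <-; exact: vmulP.
Qed.

Lemma vform_atomP i j p v r : vform_atom G i j p v = Some r ->
  fa_form (pev p *: b i) (vev_from j v) = pev r.
Proof.
elim: v j r => [|q v IH] j r /=; first by case=> <-; rewrite fa_formr0.
case: ifP => [/pev_null q0 /IH <-|_]; first by rewrite q0 scale0r add0r.
case E: (G i j) => [z|] //=; case E': (vform_atom _ _ _ _ _) => [z'|] //= -[<-].
rewrite fa_formDr (IH _ _ E') pevD !pevM -(GP E).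
by rewrite fa_formZl fa_formZr mulrA.
Qed.
Lemma vformP u v r : vform G u v = Some r -> fa_form (vev u) (vev v) = pev r.
Proof.
move: r; rewrite /vform {1}/vev; elim: u {1 2}0%N => [|p u IH] i r /=.
  by case=> <-; rewrite fa_form0r.
case: ifP => [/pev_null p0 /IH <-|_]; first by rewrite p0 scale0r add0r.
case E: (vform_atom _ _ _ _ _) => [z|] //=.
case E': (vform_from _ _ _ _) => [z'|] //= -[<-].
by rewrite fa_formDl (IH _ _ E') pevD (vform_atomP E).
Qed.
Lemma vform_eqP u v r : vform_eq G u v r -> fa_form (vev u) (vev v) = pev r.
Proof.
by rewrite /vform_eq; case E: vform => [z|] // /pev_eq <-; exact: vformP.
Qed.
End Tables.
End Evaluation.

(** * The structure constants of M(t) *)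

(* The basis is numbered a_1, a_{-1}, a_2, a_{-2}, a_3, a_{-3}, v_1, v_2, v_3,
   u_1, u_2, u_3, where v_i = v_(j,k) for {i, j, k} = {1, 2, 3} and
   u_i = a_i v_i - t a_i = a_{-i} v_i - t a_{-i}. *)
Inductive basis_symbol := SA of nat & bool | SV of nat | SU of nat.

Definition symbol (n : nat) : basis_symbol :=
  if (n < 6)%N then SA n./2 (odd n)
  else if (n < 9)%N then SV (n - 6) else SU (n - 9).

Definition xa (i : nat) (e : bool) : tvec := atom (i.*2 + e).
Definition xv (i : nat) : tvec := atom (6 + i).
Definition xu (i : nat) : tvec := atom (9 + i).
Definition xs (i : nat) : tvec := (xa i false + xa i true)%tv.
(** The indices are 0, 1, 2, and their sum is 3. *)
Definition third (i j : nat) : nat := 3 - i - j.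

Section Tables.
Local Open Scope tvec_scope.

Definition prod_aa i e j d : tvec :=
  if i == j then if e == d then xa i e else [::]
  else cst (1#64) *: (cst 3 *: (xa i e + xa j d) + xa i (~~ e) + xa j (~~ d)
                      - cst 3 *: xv (third i j)).

Definition prod_av i e j : tvec :=
  if i == j then lint 0 1 *: xa i e + xu i
  else cst (1#16) *: (cst 5 *: xa i e - xa i (~~ e) - cst 2 *: xs (third i j)
                      + cst 3 *: xv j).

Definition prod_au i e j : tvec :=
  if i == j then cst (1#4) *: xu i
  else let k := third i j in
    lint 0 (1#64) *: (cst 9 *: xa i e - xa i (~~ e) + cst 2 *: xs j
                      - cst 4 *: xs k + cst 3 *: xv k)
    + cst (1#16) *: (xu i + cst 2 *: xu j - cst 2 *: xu k).

Definition prod_vv i j : tvec :=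
  if i == j then xv i
  else let k := third i j in
    cst (1#4) *: (xv i + xv j - xv k) - lint 0 (2#3) *: (xs i + xs j)
    + cst (4#3) *: (cst 2 *: xu k - xu i - xu j).

(** This product and [prod_uu] serve to define the model, where the checks below certify them. In
    M_4A the corresponding products are only located in the span of the twelve elements. *)
Definition prod_vu i j : tvec :=
  if i == j then
    quadt 0 (1#4) (-1#2) *: xs i + lint 0 (1#4) *: xv i + lint (1#2) (-1) *: xu i
  else let k := third i j in
    cst (1#4) *: (xu j + xu k)
    - lint 0 (1#48) *: (cst 8 *: xs j + cst 4 *: xs k + cst 3 *: xv i).

Definition prod_uu i j : tvec :=
  if i == j then
    quadt 0 (1#16) (-1#8) *: xs i + lint 0 (1#16) *: xv i
    - lint 0 (1#4) *: xu i
  else let k := third i j in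
    quadt 0 0 (-1#16) *: (xs i + xs j) + quadt 0 (-1#32) (1#16) *: xs k
    + lint 0 (1#64) *: (xv i + xv j) + quadt 0 (1#32) (-3#64) *: xv k
    + lint 0 (1#16) *: (cst 2 *: xu k - xu i - xu j).

Definition symbol_prod (x y : basis_symbol) : tvec :=
  match x, y with
  | SA i e, SA j d => prod_aa i e j d
  | SA i e, SV j | SV j, SA i e => prod_av i e j
  | SA i e, SU j | SU j, SA i e => prod_au i e j
  | SV i, SV j => prod_vv i j
  | SV i, SU j | SU j, SV i => prod_vu i j
  | SU i, SU j => prod_uu i j
  end.
End Tables.

Definition symbol_form (x y : basis_symbol) : tpoly :=
  match x, y with
  | SA i e, SA j d =>
      if i == j then if e == d then cst 1 else [::] else cst (1#32)
  | SA i e, SV j | SV j, SA i e => if i == j then lint 0 1 else cst (3#8)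
  | SA i e, SU j | SU j, SA i e => if i == j then [::] else lint 0 (5#32)
  | SV i, SV j => if i == j then cst 2 else lint (1#2) (-8#3)
  | SV i, SU j | SU j, SV i =>
      if i == j then quadt 0 1 (-1) else lint 0 (-5#8)
  | SU i, SU j =>
      if i == j then quadt 0 (1#4) (-1#4) else quadt 0 (1#16) (-7#32)
  end.

Definition prod_rows : seq (seq tvec) := Eval vm_compute in
  [seq [seq symbol_prod (symbol i) (symbol j) | j <- iota 0 12]
     | i <- iota 0 12].

Definition form_rows : seq (seq tpoly) := Eval vm_compute in
  [seq [seq symbol_form (symbol i) (symbol j) | j <- iota 0 12]
     | i <- iota 0 12].

Definition prod_table (i j : nat) : option tvec :=
  if (i < 12)%N && (j < 12)%N then Some (nth [::] (nth [::] prod_rows i) j)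
  else None.

Definition form_table (i j : nat) : option tpoly :=
  if (i < 12)%N && (j < 12)%N then Some (nth [::] (nth [::] form_rows i) j)
  else None.

(** The comparison is between polynomials in t, so one computation over all triples of basis vectors
    gives the associativity of the form for every value of t. *)
Definition frobenius_check : bool :=
  let I := iota 0 12 in
  all (fun i => all (fun j => all (fun k =>
    match prod_table j k, prod_table i j with
    | Some x, Some y =>
      match vform form_table (atom i) x, vform form_table y (atom k) with
      | Some p, Some q => peq p q
      | _, _ => false
      end
    | _, _ => false
    end) I) I) I.

Lemma frobenius_checked : frobenius_check.
Proof. by vm_compute. Qed.

(** * Eigenspaces of an axis *)

Section Eigenspaces.
Variables (K : realType) (V : formed_algebra K).
Local Notation "c %:e" := (fa_emb V c) (at level 2, format "c %:e").
Implicit Types (a u v : V) (l m : K) (L : seq K).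

Lemma embK (c : K) : c != 0 -> c^-1%:e * c%:e = 1.
Proof. by move=> c0; rewrite -rmorphM mulVf // rmorph1. Qed.

Lemma emb_scale_inj (c : K) v : c != 0 -> c%:e *: v = 0 -> v = 0.
Proof.
by move=> c0 /(congr1 (fun w => c^-1%:e *: w)); rewrite scalerA embK // scale1r
  scaler0.
Qed.

Lemma eigspaceD a l u v : eigspace a l u -> eigspace a l v ->
  eigspace a l (u + v).
Proof. by rewrite /eigspace /= fa_mulDr scalerDr => -> ->. Qed.

Lemma eigspaceZ a l c v : eigspace a l v -> eigspace a l (c *: v).
Proof. by rewrite /eigspace /= fa_mulZr => ->; rewrite !scalerA mulrC. Qed.

Lemma eigspace_0 a l : eigspace a l 0.
Proof. by rewrite /eigspace /= fa_mulr0 scaler0. Qed.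

Lemma eigensum0 a L : eigensum a L 0.
Proof.
by exists (fun=> 0); [move=> *; exact: eigspace_0 | rewrite big1].
Qed.

Lemma eigensumD a L u v : eigensum a L u -> eigensum a L v ->
  eigensum a L (u + v).
Proof.
move=> [f fe ->] [g ge ->]; exists (fun l => f l + g l).
  by move=> l Ll; apply: eigspaceD; [exact: fe | exact: ge].
by rewrite big_split.
Qed.

Lemma eigensumZ a L c v : eigensum a L v -> eigensum a L (c *: v).
Proof.
move=> [f fe ->]; exists (fun l => c *: f l); last by rewrite scaler_sumr.
by move=> l Ll; apply: eigspaceZ; exact: fe.
Qed.

Lemma eigensum_sum a L (I : Type) (s : seq I) (P : pred I) (F : I -> V) :
  (forall i, P i -> eigensum a L (F i)) ->
  eigensum a L (\sum_(i <- s | P i) F i).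
Proof.
by move=> H; apply: big_ind => //; [exact: eigensum0 | exact: eigensumD].
Qed.

Lemma eigspace_sum a l (I : Type) (s : seq I) (P : pred I) (F : I -> V) :
  (forall i, P i -> eigspace a l (F i)) ->
  eigspace a l (\sum_(i <- s | P i) F i).
Proof.
by move=> H; apply: big_ind => //; [exact: eigspace_0 | exact: eigspaceD].
Qed.

Lemma eigspace_eigensum a L l v : uniq L -> l \in L -> eigspace a l v ->
  eigensum a L v.
Proof.
move=> uL Ll av; exists (fun m => if m == l then v else 0).
  by move=> m _; case: eqP => [->|_] //; exact: eigspace_0.
by rewrite (bigD1_seq l) //= eqxx big1 ?addr0 // => m /negPf ->.
Qed.

(* Applying (ad_a - m) for all m <> l in L kills every eigencomponent but the
   one of l. *)
Lemma eigensum_directT a L : uniq L -> eigensum_direct a L.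
Proof.
move=> uL f fe f0 l Ll.
pose P s v := foldr (fun m w => fa_mul a w - m%:e *: w) v s.
have PD s u v : P s (u + v) = P s u + P s v.
  by elim: s => //= m s ->; rewrite fa_mulDr scalerDr opprD addrACA.
have P0 s : P s 0 = 0.
  by elim: s => //= m s ->; rewrite fa_mulr0 scaler0 subr0.
have PE s m v : eigspace a m v -> P s v = (\prod_(l <- s) (m - l))%:e *: v.
  move=> av; elim: s => /= [|k s ->]; first by rewrite big_nil rmorph1 scale1r.
  rewrite big_cons fa_mulZr av !scalerA -scalerBl; congr (_ *: _).
  by rewrite -!rmorphM -rmorphB mulrC -mulrBl.
have : P (rem l L) (\sum_(m <- L) f m) = 0 by rewrite f0 P0.
have Psum s r : P s (\sum_(m <- r) f m) = \sum_(m <- r) P s (f m).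
  by elim: r => [|m r IH]; rewrite ?big_nil ?P0 // !big_cons PD IH.
rewrite Psum.
rewrite (bigD1_seq l) //= big_seq_cond big1 ?addr0; last first.
  move=> m /andP[Lm ml]; rewrite (PE _ m); last exact: fe.
  rewrite (bigD1_seq m) ?rem_uniq //= ?subrr ?mul0r ?rmorph0 ?scale0r //.
  by rewrite mem_rem_uniq // inE ml.
rewrite (PE _ l); last exact: fe.
(* Differences of distinct eigenvalues are images of nonzero reals, hence units, although the
   coefficient ring need not be a domain. *)
apply: emb_scale_inj; rewrite prodf_seq_neq0; apply/allP => m.
by rewrite mem_rem_uniq // inE => /andP[ml _]; rewrite subr_eq0 eq_sym.
Qed.
End Eigenspaces.

(* A Monster eigenvalue is encoded by its position in [monster]. *)
Definition code_val (n : nat) : Q := 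
  nth (Qmake 0 1) [:: Qmake 1 1; Qmake 0 1; Qmake 1 4; Qmake 1 32] n.

Definition code_fusion (n m : nat) : seq nat :=
  if (n == 3)%N && (m == 3)%N then [:: 0; 1; 2]%N
  else if (n == 3)%N || (m == 3)%N then [:: 3]%N
  else if (n == 2)%N && (m == 2)%N then [:: 0; 1]%N
  else if (n == 2)%N || (m == 2)%N then [:: 2]%N
  else if n == m then [:: n] else [::].

Section Codes.
Variable K : realType.

Definition code (n : nat) : K := nth 0 (monster K) n.

Lemma monster_uniq : uniq (monster K).
Proof.
rewrite /monster /= !inE !negb_or !andbT.
by repeat (apply/andP; split); apply/eqP; lra.
Qed.

Lemma monster_code l : l \in monster K -> exists2 n, (n < 4)%N & l = code n.
Proof.
move=> Ll; exists (index l (monster K)); first by rewrite -index_mem in Ll.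
by rewrite /code nth_index.
Qed.

Lemma code_eq n m : (n < 4)%N -> (m < 4)%N -> (code n == code m) = (n == m).
Proof. by move=> n4 m4; rewrite nth_uniq // monster_uniq. Qed.

Lemma code_fusionE n m : (n < 4)%N -> (m < 4)%N ->
  monster_fusion (code n) (code m) = [seq code i | i <- code_fusion n m].
Proof.
move=> n4 m4; rewrite /monster_fusion -[32^-1]/(code 3) -[4^-1]/(code 2).
rewrite -[1]/(code 0) -[0 as X in [:: _; X]]/(code 1) !code_eq //.
rewrite /code_fusion.
by do ! case: ifP => //.
Qed.
End Codes.

(** * M(t) is an axial algebra of Monster type *)

Definition sign_q (d : bool) : Q := if d then Qmake (-1) 1 else Qmake 1 1.

Section EigenvectorTables.
Local Open Scope tvec_scope.

(* The 0- and 1/4-eigenvectors of the axis a_i in the subalgebra of type 4A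
   generated by a_i and a_j. *)
Definition eig0 i e j : tvec :=
  xv (third i j) + cst 2 *: xs j - cst (1#2) *: xa i e.
Definition eig4 i j : tvec :=
  xv (third i j) - cst (1#3) *: (xs i + cst 2 *: xs j).

Definition succ3 (i : nat) : nat := if i == 2 then 0%N else i.+1.

(** The eigenvalues 1, 0, 1/4, 1/32 occur with multiplicities 1, 5, 4, 2. As a_i v_i = t a_i + u_i
    and a_i u_i = u_i/4, the vector v_i - t a_i - 4 u_i is annihilated by a_i. The order of the list
    fixes the coordinate numbers used in [eigencoords]. *)
Definition eigenbasis i e : seq (nat * tvec) :=
  let j := succ3 i in let k := third i j in
  [:: (0%N, xa i e);
      (1%N, xa i (~~ e)); (1%N, eig0 i e j); (1%N, eig0 i e k);
      (1%N, xv i - lint 0 1 *: xa i e - cst 4 *: xu i);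
      (1%N, xu j + xu k - cst (1#2) *: xu i + lint 0 (1#2) *: (xs j + xs k)
            - lint 0 (3#8) *: xa i e);
      (2%N, xu i); (2%N, eig4 i j); (2%N, eig4 i k);
      (2%N, xu j - xu k + lint 0 (1#2) *: (xs j - xs k));
      (3%N, xa j false - xa j true); (3%N, xa k false - xa k true)].

Definition eigencoords i e (n : nat) : tvec :=
  let j := succ3 i in let k := third i j in
  (* [y 0] and [y 1] are a_j + a_{-j} and a_k + a_{-k} in eigencoordinates: the difference of [eig0]
     and [eig4] for j is 8/3 (a_j + a_{-j}) - 1/6 a_i + 1/3 a_{-i}, with a_i standing for the axis
     [xa i e], and v cancels. *)
  let y m := cst (3#8) *: (atom (2 + m) - atom (7 + m)) + cst (1#16) *: atom 0
             - cst (1#8) *: atom 1 in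
  match symbol n with
  | SA l d => if l == i then atom (d != e)
              else let m := (l == k) : nat in
                cst (1#2) *: (y m + cst (sign_q d) *: atom (10 + m))
  | SV l => if l == i then atom 4 + lint 0 1 *: atom 0 + cst 4 *: atom 6
            (* The selector compares with j and not with k, because v_k belongs to the subalgebra
               generated by a_i and a_j. *)
            else let m := (l == j) : nat in
              atom (2 + m) - cst 2 *: y m + cst (1#2) *: atom 0
  | SU l => if l == i then atom 6
            else let m := (l == k) : nat in
              cst (1#2) *: (atom 5 + cst (sign_q (m == 1%N)) *: atom 9)
              + cst (1#4) *: atom 6 + lint 0 (3#16) *: atom 0
              - lint 0 (1#2) *: y m
  end.
End EigenvectorTables.

Fixpoint vcomb (c : tvec) (E : seq tvec) : tvec :=
  if c is p :: c' then if E is x :: E' then (p *: x + vcomb c' E')%tv else [::]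
  else [::].

(** Membership of z in a sum of eigenspaces is decided without searching for its components. If 1 is
    among several eigenvalues, the 1-component must be <a, z> a, because <a, a> = 1 and the other
    eigenvectors are orthogonal to a. The rest is then annihilated by a, or its image under a is a
    1/4-eigenvector. *)
Definition eigensum_check (a : tvec) (F : seq nat) (z : tvec) : bool :=
  if F == [::] then vnull z
  else if F is [:: n] then vmul_eq prod_table a z (cst (code_val n) *: z)%tv
  else if vform form_table a z is Some c then
    let z1 := (z - c *: a)%tv in
    if F == [:: 0; 1]%N then vmul_eq prod_table a z1 [::]
    else if F == [:: 0; 1; 2]%N then
      if vmul prod_table a z1 is Some y then
        vmul_eq prod_table a y (cst (1#4) *: y)%tv
      else false
    else false
  else false.

Definition axis_check (ie : nat * bool) : bool :=
  let a := xa ie.1 ie.2 in let E := eigenbasis ie.1 ie.2 in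
  [&& all (fun p => (p.1 < 4)%N &&
        vmul_eq prod_table a p.2 (cst (code_val p.1) *: p.2)%tv) E,
      all (fun n => veq (atom n)
        (vcomb (eigencoords ie.1 ie.2 n) [seq p.2 | p <- E])) (iota 0 12),
      (* Coordinates beyond the twelfth would be silently dropped by [vcomb]. *)
      all (fun n => (size (eigencoords ie.1 ie.2 n) <= 12)%N) (iota 0 12) &
      all (fun p => all (fun q =>
        if vmul prod_table p.2 q.2 is Some z then
          eigensum_check a (code_fusion p.1 q.1) z
        else false) E) E].

Lemma axis_checked (i : nat) (e : bool) : (i < 3)%N -> axis_check (i, e).
Proof.
have : all axis_check [seq (i, e) | i <- iota 0 3, e <- [:: false; true]].
  by vm_compute.
move/allP => H i3; apply: H; apply/allpairsP; exists (i, e).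
by rewrite mem_iota /=; split=> //; case: e.
Qed.

Lemma qval_code (K : realType) n : (n < 4)%N -> qval K (code_val n) = code K n.
Proof.
case: n => [|[|[|[|]]]] // _; rewrite /code /code_val /=.
- exact: qval1.
- exact: qval0.
- by rewrite -[LHS]/(1 / _) div1r.
- by rewrite -[LHS]/(1 / _) div1r.
Qed.

(** Formulated for an arbitrary formed algebra because two instances occur: the concrete algebra of
    row vectors, and the quotient of [hat_algebra] by the kernel of the evaluation into it, which is
    the actual member of [C_4A]. *)
Record model_basis (K : realType) (V : formed_algebra K) (t : fa_coef V)
    (b : nat -> V) : Prop := ModelBasis {
  mb_nz : 1 != 0 :> fa_coef V;
  mb_mul : forall i j v, prod_table i j = Some v ->
    fa_mul (b i) (b j) = vev t b v;
  mb_form : forall i j p, form_table i j = Some p ->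
    fa_form (b i) (b j) = pev t p;
  mb_span : forall u, exists c : nat -> fa_coef V,
    u = \sum_(n < 12) c n *: b n;
  mb_free : forall c : nat -> fa_coef V, \sum_(n < 12) c n *: b n = 0 ->
    forall n, (n < 12)%N -> c n = 0
}.

Section Model.
Variables (K : realType) (V : formed_algebra K) (t : fa_coef V) (b : nat -> V).
Hypothesis bV : model_basis t b.
Local Notation "x ∘ y" := (@fa_mul K V x y) (at level 40, left associativity).
Local Notation "⟪ x , y ⟫" := (@fa_form K V x y) (at level 0).
Local Notation ev := (vev t b).

Let mul_eqP u v w : vmul_eq prod_table u v w -> ev u ∘ ev v = ev w.
Proof. exact: (vmul_eqP (mb_mul bV)). Qed.
Let formP u v r : vform form_table u v = Some r -> ⟪ev u, ev v⟫ = pev t r.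
Proof. exact: (vformP (mb_form bV)). Qed.

Lemma model_ind (P : V -> Prop) : P 0 ->
    (forall c u v, P u -> P v -> P (c *: u + v)) ->
    (forall n, (n < 12)%N -> P (b n)) ->
  forall u, P u.
Proof.
move=> P0 PD Pb u; have [c ->] := mb_span bV u.
apply: big_ind => // [x y Px Py|n _]; first by rewrite -[x]scale1r; exact: PD.
by rewrite -[_ *: _]addr0; apply: PD => //; exact: Pb.
Qed.

Lemma model_frobenius u v w : ⟪u, v ∘ w⟫ = ⟪u ∘ v, w⟫.
Proof.
move: u; apply: model_ind => [|c u u' Hu Hu'|i i12].
- by rewrite fa_mul0r !fa_form0r.
- by rewrite fa_mulDl !fa_formDl fa_mulZl !fa_formZl Hu Hu'.
move: v; apply: model_ind => [|c u u' Hu Hu'|j j12].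
- by rewrite fa_mul0r fa_mulr0 fa_formr0 fa_form0r.
- rewrite fa_mulDl fa_mulDr fa_formDl fa_formDr fa_mulZl fa_mulZr.
  by rewrite fa_formZl fa_formZr Hu Hu'.
move: w; apply: model_ind => [|c u u' Hu Hu'|k k12].
- by rewrite fa_mulr0 !fa_formr0.
- by rewrite fa_mulDr !fa_formDr fa_mulZr !fa_formZr Hu Hu'.
have := frobenius_checked => /allP/(_ i); rewrite mem_iota => /(_ i12).
move=> /allP/(_ j); rewrite mem_iota => /(_ j12).
move=> /allP/(_ k); rewrite mem_iota => /(_ k12).
case Ejk: prod_table => [x|] //; case Eij: prod_table => [y|] //.
case Ex: vform => [p|] //; case Ey: vform => [q|] //.
move=> /(pev_eq t) pq.
by rewrite (mb_mul bV Ejk) (mb_mul bV Eij) -!(vev_atom t b) (formP Ex)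
  (formP Ey).
Qed.

Section Axis.
Variables (i : nat) (e : bool).
Hypothesis i3 : (i < 3)%N.
Let a : V := ev (xa i e).
Let E := eigenbasis i e.
Let EV (m : nat) : V := ev (nth (0%N, [::]) E m).2.
Let Ecode (m : nat) : nat := (nth (0%N, [::]) E m).1.

Let EP (P : nat * tvec -> bool) m : all P E -> (m < 12)%N ->
  P (nth (0%N, [::]) E m).
Proof. by move=> /(all_nthP (0%N, [::])) H m12; exact: H. Qed.

Lemma eigenbasis_code m : (m < 12)%N -> (Ecode m < 4)%N.
Proof.
have /and4P[H _ _ _] := axis_checked e i3.
by move=> /(EP H)/andP[].
Qed.

Lemma eigenbasisP m : (m < 12)%N -> eigspace a (code K (Ecode m)) (EV m).
Proof.
move=> m12; have /and4P[H _ _ _] := axis_checked e i3.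
have /andP[m4 /mul_eqP] := EP H m12.
by rewrite /eigspace /= vevZ pev_cst /qev qval_code.
Qed.

Lemma vev_comb c (F : seq tvec) : (size c <= size F)%N ->
  ev (vcomb c F) = \sum_(m < size F) pev t (nth [::] c m) *: ev (nth [::] F m).
Proof.
elim: c F => [|p c IH] [|x F] //= => [_|_|cF]; rewrite ?big_ord0 //.
  rewrite big1 // => m _; first by rewrite nth_nil scale0r.
by rewrite vevD vevZ IH // big_ord_recl.
Qed.

Lemma eigenbasis_span u : exists c : nat -> fa_coef V,
  u = \sum_(m < 12) c m *: EV m.
Proof.
move: u; apply: model_ind => [|c u v [f ->] [g ->]|n n12].
- by exists (fun=> 0); rewrite big1 // => m _; rewrite scale0r.
- exists (fun m => c * f m + g m); rewrite scaler_sumr -big_split.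
  by apply: eq_bigr => m _; rewrite scalerDl scalerA.
have /and4P[_ /allP/(_ n) + /allP/(_ n) + _] := axis_checked e i3.
rewrite mem_iota => /(_ n12)/(vev_eq t b) + /(_ n12) nE.
rewrite vev_atom => ->; exists (fun m => pev t (nth [::] (eigencoords i e n) m)).
rewrite vev_comb ?size_map //.
by apply: eq_bigr => m _; rewrite (nth_map (0%N, [::])) //; case: m; rewrite size_map.
Qed.

Lemma eigenbasis_split u : exists c : nat -> fa_coef V,
  (forall n, (n < 4)%N -> eigspace a (code K n)
     (\sum_(m < 12 | Ecode m == n) c m *: EV m)) /\
  u = \sum_(n < 4) \sum_(m < 12 | Ecode m == n) c m *: EV m.
Proof.
have [c ->] := eigenbasis_span u; exists c; split=> [n n4|].
  apply: eigspace_sum => m /eqP <-; apply: eigspaceZ; exact: eigenbasisP.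
rewrite (partition_big (fun m : 'I_12 => inord (Ecode m) : 'I_4) xpredT) //=.
apply: eq_bigr => n _; apply: eq_bigl => m.
by rewrite -val_eqE /= inordK // eigenbasis_code.
Qed.

Lemma sum_monster (F : K -> V) :
  \sum_(l <- monster K) F l = \sum_(n < 4) F (code K n).
Proof. by rewrite (big_nth 0) big_mkord. Qed.

(** Subtracting u from its own component of code n gives a family of eigenvectors with sum zero;
    since the sum of the eigenspaces is direct, all its members vanish. *)
Lemma eigenbasis_eigspace n u : (n < 4)%N -> eigspace a (code K n) u ->
  exists c : nat -> fa_coef V, u = \sum_(m < 12 | Ecode m == n) c m *: EV m.
Proof.
move=> n4 au; have [c [aF uE]] := eigenbasis_split u; exists c.
set F := fun n => \sum_(m < 12 | Ecode m == n) c m *: EV m in aF uE *.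
pose k l := index l (monster K).
have kK m : (m < 4)%N -> k (code K m) = m.
  by move=> m4; rewrite /k index_uniq // monster_uniq.
pose f l := F (k l) - (if k l == n then u else 0).
have := eigensum_directT (a := a) (monster_uniq K).
move=> /(_ f) /(_ _ _ (code K n)); rewrite /f kK // eqxx => H.
apply/esym/eqP; rewrite -subr_eq0; apply/eqP; apply: H.
- move=> l /monster_code[m m4 ->]; rewrite kK //.
  apply: eigspaceD; first exact: aF.
  case: eqP => [->|_]; last by rewrite oppr0; exact: eigspace_0.
  by rewrite -scaleN1r; apply: eigspaceZ.
- rewrite sumrB !sum_monster.
  have -> : \sum_(m < 4) F (k (code K m)) = u.
    by rewrite [RHS]uE; apply: eq_bigr => m _; rewrite kK.
  rewrite (bigD1 (Ordinal n4)) //= kK // eqxx big1 ?addr0 ?subrr // => m.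
  by rewrite -val_eqE /= kK // => /negPf ->.
- exact: mem_nth.
Qed.
End Axis.
End Model.

(** The action of the Miyamoto involution of a_{±i} on the basis. That this permutation is the right
    one is tested on the eigenbasis, where exactly the vectors of code 3 have to change sign. *)
Definition flip_symbol (i n : nat) : nat :=
  if (6 <= n)%N || (n./2 == i) then n else (n./2.*2 + ~~ odd n)%N.

Definition flip_check (ie : nat * bool) : bool :=
  all (fun p => (size p.2 <= 12)%N &&
    veq (vcomb p.2 [seq atom (flip_symbol ie.1 n) | n <- iota 0 12])
        (if p.1 == 3 then - p.2 else p.2)%tv) (eigenbasis ie.1 ie.2).

Lemma flip_checked (i : nat) (e : bool) : (i < 3)%N -> flip_check (i, e).
Proof.
have : all flip_check [seq (i, e) | i <- iota 0 3, e <- [:: false; true]].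
  by vm_compute.
move/allP => H i3; apply: H; apply/allpairsP; exists (i, e).
by rewrite mem_iota /=; split=> //; case: e.
Qed.

Definition dihedral_index (i j : nat) : seq nat :=
  [:: i.*2; i.*2.+1; j.*2; j.*2.+1; (6 + third i j)%N].

Definition dihedral_v (i j : nat) (w : tvec) : tvec :=
  (xa i false + xa j false + cst (1#3) *: (xa i true + xa j true)
   - cst (64#3) *: w)%tv.

Definition dihedral_check (ij : nat * nat) : bool :=
  let: (i, j) := ij in let I := dihedral_index i j in
  let a := xa i false in let b := xa j false in
  (i == j) || [&&
    all (fun p => all (fun q =>
      if prod_table p q is Some z then
        veq z (vcomb [seq nth [::] z n | n <- I] [seq atom n | n <- I])
      else false) I) I,
    all (fun e => all (fun d =>
      let z := (cst (1#64) *: (cst 3 *: xa i e + cst 3 *: xa j d + xa i (~~ e)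
                  + xa j (~~ d) - cst 3 *: xv (third i j)))%tv in
      let y := (cst (1#16) *: (cst 5 *: xa i e - xa i (~~ e)
                  - cst 2 *: xa j false - cst 2 *: xa j true
                  + cst 3 *: xv (third i j)))%tv in
      vmul_eq prod_table (xa i e) (xa j d) z &&
      vmul_eq prod_table (xa i e) (xv (third i j)) y)
      [:: false; true]) [:: false; true] &
    if vmul prod_table a b is Some p then
      [&& veq (xv (third i j)) (dihedral_v i j p) &
      match vmul prod_table a p, vmul prod_table b p with
      | Some p1, Some p2 =>
        (* The elements a_i, a_j, p = a_i a_j, a_i p and a_j p already span the five-dimensional
           subalgebra. The constants below invert this change of basis, so a_i and a_j generate
           a_{-i}, a_{-j} and v. *)
        let comb c1 c2 c3 c4 c5 :=
          vcomb [:: cst c1; cst c2; cst c3; cst c4; cst c5]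
                [:: a; b; p; p1; p2] in
        [&& veq (xa i true) (comb (1#1) (-48#7) (-512#7) (0#1) (2048#7)),
            veq (xa j true) (comb (-48#7) (1#1) (-512#7) (2048#7) (0#1)) &
            veq (xv (third i j))
              (comb (-20#21) (-20#21) (-1472#21) (2048#21) (2048#21))]
      | _, _ => false
      end]
    else false].

Lemma dihedral_checked (i j : nat) : (i < 3)%N -> (j < 3)%N ->
  dihedral_check (i, j).
Proof.
have : all dihedral_check [seq (i, j) | i <- iota 0 3, j <- iota 0 3].
  by vm_compute.
move/allP => H i3 j3; apply: H; apply/allpairsP; exists (i, j).
by rewrite !mem_iota.
Qed.

Definition axis_family (T : Type) (b : nat -> T) (i : 'I_3) (e : bool) : T :=
  b (i.*2 + e)%N.

Section Model.
Variables (K : realType) (V : formed_algebra K) (t : fa_coef V) (b : nat -> V).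
Hypothesis bV : model_basis t b.
Local Notation "x ∘ y" := (@fa_mul K V x y) (at level 40, left associativity).
Local Notation "c %:e" := (fa_emb V c) (at level 2, format "c %:e").
Local Notation ev := (vev t b).

Let mulP u v w : vmul prod_table u v = Some w -> ev u ∘ ev v = ev w.
Proof. exact: (vmulP (mb_mul bV)). Qed.
Let mul_eqP u v w : vmul_eq prod_table u v w -> ev u ∘ ev v = ev w.
Proof. exact: (vmul_eqP (mb_mul bV)). Qed.

Section Axis.
Variables (i : nat) (e : bool).
Hypothesis i3 : (i < 3)%N.
Let a : V := ev (xa i e).
Let E := eigenbasis i e.

Let EP (P : nat * tvec -> bool) m : all P E -> (m < 12)%N ->
  P (nth (0%N, [::]) E m).
Proof. by move=> /(all_nthP (0%N, [::])) H m12; exact: H. Qed.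

Lemma model_idem : a ∘ a = a.
Proof. by have := eigenbasisP bV e i3 (isT : 0 < 12)%N; rewrite /eigspace /= rmorph1 scale1r. Qed.

Lemma eigensum_code F n v : uniq F -> all (gtn 4) F -> n \in F ->
  eigspace a (code K n) v -> eigensum a [seq code K n | n <- F] v.
Proof.
move=> uF /allP F4 Fn; apply: eigspace_eigensum; last exact: map_f.
rewrite map_inj_in_uniq // => x y /F4 /= x4 /F4 /= y4 /eqP.
by rewrite code_eq // => /eqP.
Qed.

Lemma eigensum_axis_line F c : 0%N \in F -> uniq F -> all (gtn 4) F ->
  eigensum a [seq code K n | n <- F] (c *: a).
Proof.
move=> F0 uF F4; apply: eigensumZ; apply: (@eigensum_code _ 0%N) => //.
by rewrite /eigspace /= rmorph1 scale1r model_idem.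
Qed.

Lemma eigensum_checkP F z : uniq F -> all (gtn 4) F ->
  eigensum_check (xa i e) F z -> eigensum a [seq code K n | n <- F] (ev z).
Proof.
move=> uF F4; rewrite /eigensum_check; case: eqP => [->|_].
  by move=> /(vev_null t b) ->; exact: eigensum0.
have main : (if vform form_table (xa i e) z is Some c then
    let z1 := (z - c *: xa i e)%tv in
    if F == [:: 0; 1]%N then vmul_eq prod_table (xa i e) z1 [::]
    else if F == [:: 0; 1; 2]%N then
      if vmul prod_table (xa i e) z1 is Some y then
        vmul_eq prod_table (xa i e) y (cst (1#4) *: y)%tv
      else false
    else false
  else false) -> eigensum a [seq code K n | n <- F] (ev z).
  case: vform => [c|] //=.
  have zE : ev z = ev (z - c *: xa i e)%tv + pev t c *: a.
    by rewrite vevB vevZ subrK.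
  case: eqP => [FE /mul_eqP z1|_].
    rewrite zE; apply: eigensumD.
      apply: (@eigensum_code _ 1%N) => //; first by rewrite FE.
      by rewrite /eigspace /= rmorph0 scale0r z1.
    by apply: eigensum_axis_line => //; rewrite FE.
  case: eqP => [FE|_] //; case Ey: vmul => [y|] // /mul_eqP y4.
  set z1 := (z - _)%tv in zE Ey.
  have ay : a ∘ ev y = (code K 2)%:e *: ev y.
    by rewrite y4 vevZ pev_cst /qev -(qval_code K (isT : 2 < 4)%N).
  (* With y = a z1, the vector 4 y is the 1/4-component of z1, and z1 - 4 y is its 0-component. *)
  rewrite zE -[ev z1](subrK (4%:R *: ev y)); apply: eigensumD; last first.
    by apply: eigensum_axis_line => //; rewrite FE.
  apply: eigensumD; last first.
    apply: (@eigensum_code _ 2%N) => //; first by rewrite FE.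
    by apply: eigspaceZ; rewrite /eigspace /= ay.
  apply: (@eigensum_code _ 1%N) => //; first by rewrite FE.
  rewrite /eigspace /= rmorph0 scale0r fa_mulBr fa_mulZr ay (mulP Ey) scalerA.
  rewrite -(rmorph_nat (fa_emb V)) -rmorphM /= mulfV ?pnatr_eq0 //.
  by rewrite rmorph1 scale1r subrr.
case: F uF F4 main => [|n [|m F]] // uF F4 _ /mul_eqP az /=.
apply: (@eigensum_code [:: n] n) => //; first by rewrite inE.
by rewrite /eigspace /= az vevZ pev_cst /qev qval_code //; case/andP: F4.
Qed.

Lemma code_fusion_uniq n m : uniq (code_fusion n m) /\
  ((n < 4)%N -> (m < 4)%N -> all (gtn 4) (code_fusion n m)).
Proof.
rewrite /code_fusion; do ! case: ifP => //=; split=> //.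
by move=> n4 _; rewrite n4.
Qed.

Lemma model_axis : monster_axis a.
Proof.
split.
- exact: model_idem.
- rewrite predeqE => u; split=> // _.
  have [c [cP ->]] := eigenbasis_split bV e i3 u.
  apply: eigensum_sum => n _; apply: (@eigspace_eigensum _ _ _ _ (code K n)).
  + exact: monster_uniq.
  + exact: mem_nth.
  + exact: cP.
- exact: (eigensum_directT (monster_uniq K)).
move=> l m u v /monster_code[n n4 ->] /monster_code[n' n'4 ->].
move=> /(eigenbasis_eigspace bV i3 n4)[c ->].
move=> /(eigenbasis_eigspace bV i3 n'4)[c' ->].
rewrite code_fusionE //; have [uF /(_ n4 n'4) F4] := code_fusion_uniq n n'.
rewrite fa_mul_suml; apply: eigensum_sum => p /eqP pn.
rewrite fa_mul_sumr; apply: eigensum_sum => q /eqP qn.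
rewrite fa_mulZl fa_mulZr; do 2 apply: eigensumZ.
have /and4P[_ _ _ H] := axis_checked e i3.
have /EP/(_ (ltn_ord q)) := EP H (ltn_ord p).
case Ez: vmul => [z|] //; rewrite /E pn qn => ch.
by rewrite (mulP Ez); apply: eigensum_checkP.
Qed.

Lemma model_primitive : primitive a.
Proof.
rewrite /primitive predeqE => u; split=> [|[c _ <-]]; last first.
  by rewrite /eigspace /= fa_mulZr model_idem rmorph1 scale1r.
move=> /(eigenbasis_eigspace bV i3 (isT : 0 < 4)%N)[c ->].
(* Position 0, the axis itself, is the only one of code 0 in the eigenbasis. *)
exists (c 0%N) => //; rewrite (bigD1 ord0) //= big1 ?addr0 // => m.
by case/andP; case: m => [] [|[|[|[|[|[|[|[|[|[|[|[|//]]]]]]]]]]]].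
Qed.
End Axis.
End Model.

Lemma axis_index (i : 'I_3) (e : bool) : (i.*2 + e < 12)%N.
Proof. by case: i e => [[|[|[|//]]] ?] []. Qed.

Lemma flip_axis (i j : 'I_3) (e : bool) :
  flip_symbol i (j.*2 + e) = (j.*2 + (if j == i then e else ~~ e))%N.
Proof. by case: i j e => [[|[|[|//]]] ?] [[|[|[|//]]] ?] []. Qed.

Section ModelConditions.
Variables (K : realType) (V : formed_algebra K) (t : fa_coef V) (b : nat -> V).
Hypothesis bV : model_basis t b.
Local Notation ev := (vev t b).
Local Notation a := (axis_family b).

Lemma axis_familyE (i : 'I_3) e : a i e = ev (xa i e).
Proof. by rewrite vev_atom. Qed.

Lemma vev_sum n w : (size w <= n)%N ->
  ev w = \sum_(m < n) pev t (nth [::] w m) *: b m.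
Proof.
have -> : ev w = \sum_(m < size w) pev t (nth [::] w m) *: b m.
  suff H k : vev_from t b k w =
      \sum_(m < size w) pev t (nth [::] w m) *: b (k + m)%N by exact: H.
  elim: w k => [|p w IH] k /=; first by rewrite big_ord0.
  rewrite big_ord_recl addn0 IH; congr (_ + _).
  by apply: eq_bigr => m _; rewrite addSnnS.
move=> wn; rewrite (big_ord_widen _ (fun m => pev t (nth [::] w m) *: b m) wn).
rewrite big_mkcond; apply: eq_bigr => m _.
by case: ltnP => // H; rewrite nth_default // scale0r.
Qed.

(** The involution permutes coordinates by [flip_symbol]; it is linear because freeness makes the
    chosen coordinates unique. The behaviour on each eigenspace follows from that on the
    eigenbasis. *)
Lemma model_property_P : property_P a.
Proof.
move=> i e.
have [co coE] := choice (mb_span bV).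
have co_uniq (c : nat -> fa_coef V) u n : u = \sum_(n < 12) c n *: b n -> (n < 12)%N -> co u n = c n.
  move=> uE n12; apply/eqP; rewrite -subr_eq0; apply/eqP.
  apply: (mb_free bV (c := fun n => co u n - c n)) => //.
  under eq_bigr do rewrite scalerBl.
  by rewrite sumrB -coE -uE subrr.
pose tau u := \sum_(n < 12) co u n *: b (flip_symbol i n).
have tau_lin : linear tau.
  move=> c u v; rewrite /tau scaler_sumr -big_split; apply: eq_bigr => n _ /=.
  rewrite (co_uniq (fun n => c * co u n + co v n)) ?scalerDl ?scalerA //.
  under eq_bigr do rewrite scalerDl -scalerA.
  by rewrite big_split -scaler_sumr /= -!coE.
pose tl : {linear V -> V} := HB.pack tau (GRing.isLinear.Build _ _ _ _ tau tau_lin).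
have tauE (c : nat -> fa_coef V) : tau (\sum_(n < 12) c n *: b n) =
    \sum_(n < 12) c n *: b (flip_symbol i n).
  by apply: eq_bigr => n _; rewrite (co_uniq c).
have tau_b n : (n < 12)%N -> tau (b n) = b (flip_symbol i n).
  move=> n12; pose c m : fa_coef V := (m == n)%:R.
  have -> : b n = \sum_(m < 12) c m *: b m.
    rewrite (bigD1 (Ordinal n12)) //= /c eqxx scale1r big1 ?addr0 // => m.
    by rewrite -val_eqE /= => /negPf ->; rewrite scale0r.
  rewrite tauE (bigD1 (Ordinal n12)) //= /c eqxx scale1r big1 ?addr0 // => m.
  by rewrite -val_eqE /= => /negPf ->; rewrite scale0r.
have tau_eig m : (m < 12)%N -> let p := nth (0%N, [::]) (eigenbasis i e) m in
    tau (ev p.2) = if p.1 == 3 then - ev p.2 else ev p.2.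
  move=> m12 /=; have := flip_checked e (ltn_ord i).
  move=> /(all_nthP (0%N, [::]))/(_ m m12)/andP[].
  set p := nth _ _ m; move=> p12 /(vev_eq t b).
  rewrite vev_comb ?size_map ?size_iota // => pE.
  rewrite {1}(vev_sum p12) (tauE (fun n => pev t (nth [::] p.2 n))).
  transitivity (ev (if p.1 == 3 then - p.2 else p.2)%tv); last first.
    by case: ifP; rewrite ?vevN.
  rewrite -pE; apply: eq_bigr => n _.
  by rewrite (nth_map 0%N) ?size_iota // nth_iota // vev_atom.
have tau_space n u : (n < 4)%N -> eigspace (ev (xa i e)) (code K n) u ->
    tau u = if n == 3 then - u else u.
  move=> n4 /(eigenbasis_eigspace bV (ltn_ord i) n4)[c ->].
  rewrite -[tau _]/(tl _) raddf_sum -sumrN -[RHS]/(if _ then _ else _).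
  case: (boolP (n == 3)) => n3; apply: eq_bigr => m /eqP mn;
    rewrite [LHS]linearZ -[tl _]/(tau _) tau_eig //= mn.
    by rewrite n3 scalerN.
  by rewrite (negPf n3).
exists tl; split; first split.
- move=> v; rewrite axis_familyE => -[f fe ->].
  rewrite -[LHS]/(tl _) raddf_sum big_seq [RHS]big_seq; apply: eq_bigr => l Ll.
  have := fe l Ll; have [n [n4 n3 ->]] : exists n, [/\ (n < 4)%N, n != 3 & l = code K n].
    move: Ll; rewrite !inE => /or3P[] /eqP ->.
    + by exists 0%N.
    + by exists 1%N.
    + by exists 2%N.
  by move=> /(tau_space _ _ n4) /=; rewrite (negPf n3).
- move=> v; rewrite axis_familyE => av.
  exact: (tau_space 3%N).
- by move=> j d; rewrite -[LHS]/(tau _) tau_b ?axis_index // flip_axis.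
Qed.
End ModelConditions.

Section Subalgebras.
Variables (K : realType) (V : formed_algebra K) (S : set V).
Hypothesis SS : subalgebra S.

Lemma subalgebraD u v : S u -> S v -> S (u + v).
Proof. by move=> Su Sv; rewrite -[u]scale1r; have [_ + _] := SS; apply. Qed.
Lemma subalgebraZ c u : S u -> S (c *: u).
Proof. by have [S0 + _] := SS; move=> /(_ c u 0) H Su; rewrite -[_ *: _]addr0; apply: H. Qed.
Lemma subalgebraM u v : S u -> S v -> S (fa_mul u v).
Proof. by have [_ _] := SS; apply. Qed.
Lemma subalgebra_sum (I : Type) (s : seq I) (P : pred I) (F : I -> V) :
  (forall i, P i -> S (F i)) -> S (\sum_(i <- s | P i) F i).
Proof.
by move=> H; apply: big_ind => //; [case: SS | exact: subalgebraD].
Qed.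
End Subalgebras.

Section ModelShape.
Variables (K : realType) (V : formed_algebra K) (t : fa_coef V) (b : nat -> V).
Hypothesis bV : model_basis t b.
Local Notation "x ∘ y" := (@fa_mul K V x y) (at level 40, left associativity).
Local Notation "⟪ x , y ⟫" := (@fa_form K V x y) (at level 0).
Local Notation "c %:e" := (fa_emb V c) (at level 2, format "c %:e").
Local Notation ev := (vev t b).
Local Notation a := (axis_family b).

Let mulP u v w : vmul prod_table u v = Some w -> ev u ∘ ev v = ev w.
Proof. exact: (vmulP (mb_mul bV)). Qed.
Let mul_eqP u v w : vmul_eq prod_table u v w -> ev u ∘ ev v = ev w.
Proof. exact: (vmul_eqP (mb_mul bV)). Qed.
Let form_eqP u v r : vform_eq form_table u v r -> ⟪ev u, ev v⟫ = pev t r.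
Proof. exact: (vform_eqP (mb_form bV)). Qed.

Lemma subalgebra_comb (S : set V) (c : tvec) (F : seq tvec) :
  subalgebra S -> (size c <= size F)%N -> 
  (forall m, (m < size F)%N -> S (ev (nth [::] F m))) ->
  S (ev (vcomb c F)).
Proof.
move=> SS cF H; rewrite vev_comb //; apply: subalgebra_sum => // m _.
by apply: subalgebraZ => //; apply: H.
Qed.

Lemma subalgebra_dihedral (S : set V) (i j : nat) :
    (i < 3)%N -> (j < 3)%N -> i != j -> subalgebra S ->
    S (ev (xa i false)) -> S (ev (xa j false)) ->
  [/\ S (ev (xa i true)), S (ev (xa j true)) & S (ev (xv (third i j)))].
Proof.
move=> i3 j3 /negPf ij SS Si Sj; have := dihedral_checked i3 j3.
rewrite /dihedral_check ij => /and3P[_ _].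
case Ep: vmul => [p|] // /andP[_].
case Ep1: vmul => [p1|] //; case Ep2: vmul => [p2|] // /and3P[].
move=> /(vev_eq t b) -> /(vev_eq t b) -> /(vev_eq t b) ->.
have Sp : S (ev p) by rewrite -(mulP Ep); exact: subalgebraM.
have Sp1 : S (ev p1) by rewrite -(mulP Ep1); exact: subalgebraM.
have Sp2 : S (ev p2) by rewrite -(mulP Ep2); exact: subalgebraM.
by split; apply: subalgebra_comb => // -[|[|[|[|[|]]]]].
Qed.

Lemma model_generated : generated [set u | exists i e, u = a i e] = [set: V].
Proof.
rewrite predeqE => u; split=> // _ S SS AS.
have Sa (i : 'I_3) e : S (ev (xa i e)) by apply: AS; exists i, e; rewrite (axis_familyE t).
have Sv (i : 'I_3) : S (ev (xv i)).
  case: i => [[|[|[|//]]] ?].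
  - by have [] := @subalgebra_dihedral S 1 2 isT isT isT SS (Sa 1 false) (Sa 2 false).
  - by have [] := @subalgebra_dihedral S 0 2 isT isT isT SS (Sa 0 false) (Sa 2 false).
  - by have [] := @subalgebra_dihedral S 0 1 isT isT isT SS (Sa 0 false) (Sa 1 false).
have Su (i : 'I_3) : S (ev (xu i)).
  have -> : ev (xu i) = ev (xa i false) ∘ ev (xv i) - pev t (lint 0 1) *: ev (xa i false).
    apply/esym/eqP; rewrite subr_eq -vevZ -vevD; apply/eqP/mul_eqP.
    by case: i => [[|[|[|//]]] ?]; vm_compute.
  apply: subalgebraD; first exact: SS.
    exact: subalgebraM.
  by rewrite -scaleN1r; apply: (subalgebraZ SS); exact: subalgebraZ.
have [S0 SD _] := SS.
move: u; apply: (model_ind bV) => [//|c u v Su' Sv'|n n12]; first exact: SD.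
have [n6|n6] := ltnP n 6.
  have := Sa (inord n./2) (odd n); rewrite vev_atom inordK ?[in (_ + odd n)%N]addnC ?odd_double_half //.
  by case: n n6 {n12} => [|[|[|[|[|[|]]]]]].
have [n9|n9] := ltnP n 9.
  by have := Sv (inord (n - 6)); rewrite vev_atom inordK ?subnKC // ltn_subLR.
by have := Su (inord (n - 9)); rewrite vev_atom inordK ?subnKC // ltn_subLR.
Qed.

Lemma qev_frac n p :
  qev V (Qmake (Z.of_nat n) p) = (n%:R / (Pos.to_nat p)%:R)%:e.
Proof. by rewrite /qev /qval /zval /= (Z_of_intK n). Qed.

Lemma qev_nat n : qev V (Qmake (Z.of_nat n) 1) = n%:R.
Proof. by rewrite qev_frac divr1 rmorph_nat. Qed.

Lemma qev_inv p : qev V (Qmake 1 p) = ((Pos.to_nat p)%:R^-1)%:e.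
Proof. by rewrite -div1r -(qev_frac 1). Qed.

Lemma model_primitive_frobenius_axial :
  primitive_frobenius_axial [set u | exists i e, u = a i e].
Proof.
split; first exact: model_generated.
  move=> _ [i [e ->]]; rewrite (axis_familyE t).
  split.
    exact: (model_axis bV e (ltn_ord i)).
  exact: (model_primitive bV e (ltn_ord i)).
split.
- exact: (model_frobenius bV).
- exists (ev (xa 0 false)), (ev (xa 0 false)).
  rewrite (@form_eqP _ _ [:: Qmake 1 1]) //= qev1 mulr0 addr0.
  by apply/eqP; exact: (mb_nz bV).
- move=> _ [i [e ->]]; rewrite (axis_familyE t).
  rewrite (@form_eqP _ _ [:: Qmake 1 1]) /= ?qev1 ?mulr0 ?addr0 //.
  by case: i e => [[|[|[|//]]] ?] [].
Qed.

Definition dihedral_elt (i j : 'I_3) : V := ev (xv (third i j)).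

Lemma dihedral_eltC i j : dihedral_elt i j = dihedral_elt j i.
Proof. by rewrite /dihedral_elt /third subnAC. Qed.

Let dihedral_table (i j : 'I_3) e d : i != j ->
  let v := dihedral_elt i j in
  a i e ∘ a j d = (64^-1)%:e *:
    (a i e *+ 3 + a j d *+ 3 + a i (~~ e) + a j (~~ d) - v *+ 3) /\
  a i e ∘ v = (16^-1)%:e *:
    (a i e *+ 5 - a i (~~ e) - a j false *+ 2 - a j true *+ 2 + v *+ 3).
Proof.
move=> /negPf ij v; have := @dihedral_checked i j (ltn_ord i) (ltn_ord j).
rewrite /dihedral_check -[(i : nat) == j]/(i == j) ij => /and3P[_ + _].
have eb (x : bool) : x \in [:: false; true] by case: x.
move=> /allP/(_ e (eb e))/allP/(_ d (eb d))/andP[].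
move=> /mul_eqP aa /mul_eqP av; rewrite !(axis_familyE t) /dihedral_elt aa av.
rewrite !(vevB, vevD, vevZ) !pev_cst (qev_inv 64) (qev_inv 16).
by rewrite (qev_nat 2) (qev_nat 3) (qev_nat 5) !scaler_nat.
Qed.

(** The span of the five elements is closed under products by the first part of [dihedral_check],
    hence contains the generated subalgebra; conversely [subalgebra_dihedral] recovers the five
    elements from a_i and a_j. *)
Let dihedral_span (i j : 'I_3) : i != j ->
  generated [set a i false; a j false] = [set u | exists c1 c2 c3 c4 c5,
    u = c1 *: a i false + c2 *: a i true + c3 *: a j false + c4 *: a j true
      + c5 *: dihedral_elt i j].
Proof.
move=> /negPf ij; have := @dihedral_checked i j (ltn_ord i) (ltn_ord j).
rewrite /dihedral_check -[(i : nat) == j]/(i == j) ij => /and3P[H _ _].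
set I := dihedral_index i j in H.
pose B m := b (nth 0%N I m).
have BE u : (exists c1 c2 c3 c4 c5, u = c1 *: a i false + c2 *: a i true
      + c3 *: a j false + c4 *: a j true + c5 *: dihedral_elt i j) <->
    (exists c : nat -> fa_coef V, u = \sum_(m < 5) c m *: B m).
  rewrite /dihedral_elt vev_atom /B /axis_family !addn0 !addn1.
  split=> [[c1 [c2 [c3 [c4 [c5 ->]]]]]|[c ->]].
    exists (nth 0 [:: c1; c2; c3; c4; c5]).
    by rewrite !big_ord_recr big_ord0 /= add0r.
  exists (c 0%N), (c 1%N), (c 2%N), (c 3%N), (c 4%N).
  by rewrite !big_ord_recr big_ord0 /= add0r.
rewrite predeqE => u; rewrite /= BE; split=> [|[c ->] S SS AS]; last first.
  have Si : S (ev (xa i false)) by apply: AS; left; rewrite (axis_familyE t).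
  have Sj : S (ev (xa j false)) by apply: AS; right; rewrite (axis_familyE t).
  have [] := subalgebra_dihedral (ltn_ord i) (ltn_ord j) _ SS Si Sj.
    by rewrite -[(i : nat) == j]/(i == j) ij.
  move=> Si' Sj' Sv; apply: subalgebra_sum => // -[m m5] _.
  apply: subalgebraZ => //; rewrite /B /=.
  move: Si Sj Si' Sj' Sv; rewrite !vev_atom !addn0 !addn1.
  by case: m m5 => [|[|[|[|[|]]]]].
move=> /(_ [set u | exists c : nat -> fa_coef V,
  u = \sum_(m < 5) c m *: B m]); apply=> [|_ [] ->]; first split.
- by exists (fun=> 0); rewrite big1 // => m _; rewrite scale0r.
- move=> r _ _ [f ->] [g ->]; exists (fun m => r * f m + g m).
  rewrite scaler_sumr -big_split; apply: eq_bigr => m _.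
  by rewrite scalerDl scalerA.
- move=> _ _ [f ->] [g ->].
  have /choice[co coE] : forall pq : nat * nat, exists c : nat -> fa_coef V,
      (pq.1 < 5)%N -> (pq.2 < 5)%N -> B pq.1 ∘ B pq.2 = \sum_(m < 5) c m *: B m.
    case=> p q; have [/= p5|p5] := ltnP p 5; last by exists (fun=> 0).
    have [/= q5|q5] := ltnP q 5; last by exists (fun=> 0).
    have := allP (allP H _ (mem_nth 0%N (p5 : (p < size I)%N))) _
      (mem_nth 0%N (q5 : (q < size I)%N)).
    case Ez: prod_table => [z|] // /(vev_eq t b).
    rewrite -(mb_mul bV Ez) vev_comb ?size_map // => zE.
    exists (fun m => pev t (nth [::] [seq nth [::] z n | n <- I] m)) => _ _.
    rewrite {1}/B {1}/B zE; apply: eq_bigr => m _; congr (_ *: _).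
    by rewrite (nth_map 0%N) ?vev_atom //; case: m; rewrite size_map.
  exists (fun m => \sum_(p < 5) \sum_(q < 5) f p * g q * co (p : nat, q : nat) m).
  rewrite fa_mul_suml.
  under eq_bigr => p _.
    rewrite fa_mul_sumr.
    under eq_bigr => q _.
      rewrite fa_mulZl fa_mulZr scalerA (coE (p : nat, q : nat)) ?ltn_ord //.
      rewrite scaler_sumr; under eq_bigr do rewrite scalerA.
      over.
    rewrite exchange_big /=.
    over.
  rewrite exchange_big /=; apply: eq_bigr => m _.
  rewrite scaler_suml; apply: eq_bigr => p _.
  by rewrite scaler_suml.
- exists (fun m => (m == 0%N)%:R); rewrite !big_ord_recr big_ord0 /= add0r.
  by rewrite !scale0r scale1r !addr0 /B /axis_family addn0.
- exists (fun m => (m == 2%N)%:R); rewrite !big_ord_recr big_ord0 /= add0r.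
  by rewrite !scale0r scale1r !addr0 add0r /B /axis_family addn0.
Qed.

Lemma model_type_4A i j : i != j -> type_4A a i j (dihedral_elt i j).
Proof.
move=> ij; have ji : j != i by rewrite eq_sym.
have vv k : (k < 3)%N -> ev (xv k) ∘ ev (xv k) = ev (xv k).
  by move=> k3; apply: mul_eqP; case: k k3 => [|[|[|]]].
have v3 : (third i j < 3)%N by case: i j ij {ji} => [[|[|[|//]]] ?] [[|[|[|//]]] ?].
have form_v k : (k < 3)%N -> ⟪ev (xv k), ev (xv k)⟫ = 2.
  move=> k3; rewrite (@form_eqP _ _ (cst 2)) ?pev_cst ?(qev_nat 2) //.
  by case: k k3 => [|[|[|]]].
split.
- exact: vv.
- exact: dihedral_span.
- move=> e d; have [-> ->] := dihedral_table e d ij; split=> //.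
  by rewrite dihedral_eltC; have [_ ->] := dihedral_table d e ji.
- split.
    by rewrite !(axis_familyE t) (@mul_eqP _ _ [::]) //; case: i {ij ji v3} => [[|[|[|//]]] ?].
  by rewrite !(axis_familyE t) (@mul_eqP _ _ [::]) //; case: j {ij ji v3} => [[|[|[|//]]] ?].
- split=> [e d|].
    rewrite !(axis_familyE t) /dihedral_elt -(qev_inv 32) -(qev_frac 3 8) -!(pev_cst t).
    by case: i j e d {ji v3} ij => [[|[|[|//]]] ?] [[|[|[|//]]] ?] [] [] //;
      split; apply: form_eqP.
  split; [| |exact: form_v]; rewrite !(axis_familyE t) (@form_eqP _ _ [::]) //.
    by case: i {ij ji v3} => [[|[|[|//]]] ?].
  by case: j {ij ji v3} => [[|[|[|//]]] ?].
Qed.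

Lemma model_shape_4A : shape_4A a.
Proof.
by exists dihedral_elt; split; [exact: dihedral_eltC | exact: model_type_4A].
Qed.
End ModelShape.

(** * The algebra with the structure constants of M(t) *)

Definition commutative_check : bool :=
  all (fun i => all (fun j =>
    match prod_table i j, prod_table j i with
    | Some x, Some y => veq x y
    | _, _ => false
    end) (iota 0 12)) (iota 0 12).

Lemma commutative_checked : commutative_check.
Proof. by vm_compute. Qed.

Section ConcreteModel.
Variables (K : realType) (t : K).
Local Notation W := 'rV[K]_12.

Definition coord_vec (n : nat) : W := delta_mx 0 (inord n).

Let zmul (_ _ : W) : W := 0.
Let zform (_ _ : W) : K := 0.

Fact zero_mulC : commutative zmul. Proof. by []. Qed.
Fact zero_mul_linear u : linear (zmul u).
Proof. by move=> c x y; rewrite /zmul scaler0 addr0. Qed.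
Fact zero_form_linearl v : scalar (zform^~ v).
Proof. by move=> c x y; rewrite /zform mulr0 addr0. Qed.
Fact zero_form_linearr u : scalar (zform u).
Proof. by move=> c x y; rewrite /zform mulr0 addr0. Qed.

(* [vev] and [pev] do not depend on the product and the form, so that they can
   be used with the zero product to define the product of [concrete_model]. *)
Definition zero_algebra : formed_algebra K :=
  @FormedAlgebra K K idfun W zmul zform
    zero_mulC zero_mul_linear zero_form_linearl zero_form_linearr.

Definition coord_prod (i j : nat) : W :=
  vev (t : fa_coef zero_algebra) (coord_vec : nat -> zero_algebra)
    (nth [::] (nth [::] prod_rows i) j).

Definition coord_form (i j : nat) : K :=
  pev (t : fa_coef zero_algebra) (nth [::] (nth [::] form_rows i) j).

Definition model_mul (x y : W) : W :=
  \sum_(i < 12) \sum_(j < 12) (x 0 i * y 0 j) *: coord_prod i j.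

Definition model_form (x y : W) : K :=
  \sum_(i < 12) \sum_(j < 12) x 0 i * y 0 j * coord_form i j.

Fact model_mulC : commutative model_mul.
Proof.
move=> x y; rewrite /model_mul exchange_big; apply: eq_bigr => i _.
apply: eq_bigr => j _; rewrite mulrC; congr (_ *: _).
have := commutative_checked => /allP/(_ i); rewrite mem_iota => /(_ (ltn_ord i)).
move=> /allP/(_ j); rewrite mem_iota => /(_ (ltn_ord j)).
rewrite /prod_table !ltn_ord /= /coord_prod.
by move=> /(vev_eq (t : fa_coef zero_algebra) (coord_vec : nat -> zero_algebra)).
Qed.

Fact model_mul_linear x : linear (model_mul x).
Proof.
move=> c y z; rewrite /model_mul scaler_sumr -big_split; apply: eq_bigr => i _ /=.
rewrite scaler_sumr -big_split; apply: eq_bigr => j _ /=.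
by rewrite !mxE mulrDr scalerDl scalerA mulrCA.
Qed.

Fact model_form_linearl y : scalar (model_form^~ y).
Proof.
move=> c x z; rewrite /model_form mulr_sumr -big_split; apply: eq_bigr => i _ /=.
rewrite mulr_sumr -big_split; apply: eq_bigr => j _ /=.
by rewrite !mxE !mulrDl !mulrA.
Qed.

Fact model_form_linearr x : scalar (model_form x).
Proof.
move=> c y z; rewrite /model_form mulr_sumr -big_split; apply: eq_bigr => i _ /=.
rewrite mulr_sumr -big_split; apply: eq_bigr => j _ /=.
by rewrite !mxE mulrDr mulrDl mulrCA -!mulrA.
Qed.

Definition concrete_model : formed_algebra K :=
  @FormedAlgebra K K idfun W model_mul model_form
    model_mulC model_mul_linear model_form_linearl model_form_linearr.

Lemma coord_vecE (i n : 'I_12) : coord_vec n 0 i = (i == n)%:R.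
Proof. by rewrite /coord_vec inord_val mxE eqxx. Qed.

Lemma sum_coord_vec (i : 'I_12) (U : lmodType K) (F : nat -> U) :
  \sum_(j < 12) coord_vec i 0 j *: F j = F i.
Proof.
rewrite (bigD1 i) //= coord_vecE eqxx scale1r big1 ?addr0 // => j /negPf ji.
by rewrite coord_vecE ji scale0r.
Qed.

Lemma model_mulE (i j : 'I_12) :
  model_mul (coord_vec i) (coord_vec j) = coord_prod i j.
Proof.
rewrite /model_mul -[RHS](sum_coord_vec i (coord_prod^~ j)).
apply: eq_bigr => k _; rewrite -[in RHS](sum_coord_vec j (coord_prod k)).
by rewrite scaler_sumr; apply: eq_bigr => l _; rewrite scalerA.
Qed.

Lemma model_formE (i j : 'I_12) :
  model_form (coord_vec i) (coord_vec j) = coord_form i j.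
Proof.
rewrite /model_form -[RHS](sum_coord_vec i (coord_form^~ j : nat -> K^o)).
apply: eq_bigr => k _; rewrite -[in RHS](sum_coord_vec j (coord_form k : nat -> K^o)).
by rewrite scaler_sumr; apply: eq_bigr => l _; rewrite /GRing.scale /= mulrA.
Qed.

Lemma concrete_modelP :
  model_basis (t : fa_coef concrete_model) (coord_vec : nat -> concrete_model).
Proof.
split.
- exact: oner_neq0.
- move=> i j v; rewrite /prod_table; case: andP => // -[i12 j12] [<-].
  exact: (model_mulE (Ordinal i12) (Ordinal j12)).
- move=> i j v; rewrite /form_table; case: andP => // -[i12 j12] [<-].
  exact: (model_formE (Ordinal i12) (Ordinal j12)).
- move=> u; exists (fun n => (u : W) 0 (inord n)).
  rewrite [LHS](row_sum_delta (u : W)); apply: eq_bigr => n _.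
  by rewrite /coord_vec inord_val.
- move=> c c0 n n12; have := congr1 (fun u : W => u 0 (inord n)) c0.
  rewrite /= summxE mxE (bigD1 (Ordinal n12)) //= mxE big1 ?addr0 => [|m].
    by rewrite /coord_vec mxE !eqxx mulr1.
  rewrite -val_eqE /= => mn; rewrite mxE /coord_vec mxE eqxx /=.
  by rewrite -val_eqE /= !inordK // eq_sym (negPf mn) mulr0.
Qed.
End ConcreteModel.

(** * Evaluating the free objects *)

(** Induction on the degree: a monomial of positive degree is divisible by any indeterminate of its
    support. *)
Lemma cmonom_ind (I : choiceType) (P : {cmonom I} -> Prop) :
    P (@one {cmonom I}) ->
    (forall i m, P m -> P (@mul {cmonom I} (ucm i) m)) ->
  forall m, P m.
Proof.
move=> P1 PM m.
elim: {m}(mdeg m) {-2}m (erefl (mdeg m)) => [|n IH] m mn.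
  by rewrite (mdeg_eq0I mn).
have [m1|/fset0Pn[i mi]] := eqVneq (finsupp m) fset0.
  by move: mn; rewrite mdegE m1 big_seq_fset0.
have mE : m = @mul {cmonom I} (ucm i) (divcm m (ucm i)).
  apply/eqP/cmP => j; rewrite cmM divcmE cmU.
  case: eqVneq => [<-|_]; last by rewrite add0n subn0.
  by rewrite addnC subnK // lt0n cmE_neq0.
rewrite mE; apply: PM; apply: IH; move: mn; rewrite {1}mE mdegM mdegU.
by case.
Qed.

Lemma monalgU_scale (S : nzRingType) (T : choiceType) (c : S) (x : T) :
  << c *g x >> = c *: << x >> :> {malg S[T]}.
Proof. by apply/malgP => y; rewrite mcoeffZ !mcoeffU mulrnAr mulr1. Qed.

Lemma monalgU_mul (S : nzRingType) (T : monomType) (c : S) (x y : T) :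
  << c *g mmul x y >> = << x >> * << c *g y >> :> {malg S[T]}.
Proof.
rewrite (malgMEw (@msuppU_le _ _ x 1) (@msuppU_le _ _ y c)).
by rewrite !big_seq_fset1 !mcoeffUU mul1r.
Qed.

Section HatTheory.
Variable K : realType.
Local Notation hatM := (hatM K).
Local Notation hatR := (hatR K).
Local Notation hat := (hat_algebra K).

Lemma magma_mulU (x y : magma) :
  magma_mul mop (<< x >>%R : hatM) << y >>%R = << mop x y >>%R.
Proof.
rewrite (magma_mulE mop (@msuppU_le _ _ x 1) (@msuppU_le _ _ y 1)).
by rewrite !big_seq_fset1 !mcoeffUU mulr1.
Qed.

Lemma magma_formU (x y : magma) :
  magma_form (lambda K) (<< x >>%R : hatM) << y >>%R = lambda K x y.
Proof.
rewrite (magma_formE (lambda K) (@msuppU_le _ _ x 1) (@msuppU_le _ _ y 1)).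
by rewrite !big_seq_fset1 !mcoeffUU !mul1r.
Qed.

Lemma magma_ind (P : magma -> Prop) : (forall i e, P (gen i e)) ->
  (forall x y, P x -> P y -> P (mop x y)) -> forall x, P x.
Proof.
move=> Pgen Pmop x; rewrite -[x]reprK; elim: (repr x) => [[i e]|u Pu v Pv].
  exact: Pgen.
by rewrite -mop_pi; exact: Pmop.
Qed.

Lemma hatM_ind (P : hatM -> Prop) : P 0 ->
    (forall c u v, P u -> P v -> P (c *: u + v)) ->
    (forall x : magma, P << x >>%R) -> forall u, P u.
Proof.
move=> P0 PD Px u; rewrite [u]monalgE; apply: big_rec => [//|x v _ Pv].
rewrite monalgU_scale; exact: PD.
Qed.

Definition hat_elt (x : magma) : hat := << x >>%R : hatM.

Lemma hat_ind (P : hat -> Prop) : P 0 ->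
    (forall (c : fa_coef hat) (u v : hat), P u -> P v -> P (c *: u + v)) ->
    (forall x, P (hat_elt x)) -> forall u, P u.
Proof. exact: hatM_ind. Qed.

Lemma hat_mul_elt x y : fa_mul (hat_elt x) (hat_elt y) = hat_elt (mop x y).
Proof. exact: magma_mulU. Qed.

Lemma hat_form_elt x y : fa_form (hat_elt x) (hat_elt y) = lambda K x y.
Proof. exact: magma_formU. Qed.

Lemma hatR_ind (P : hatR -> Prop) :
    (forall c : K, P (@malgC {cmonom indet} K c)) ->
    (forall r s, P r -> P s -> P (r + s)) ->
    (forall r s, P r -> P s -> P (r * s)) -> (forall x y, P (lambda K x y)) ->
  forall r, P r.
Proof.
move=> Pc PD PM Pl r; rewrite [r]monalgE; apply: big_rec => [|m s _ Ps].
  by rewrite -[0](raddf0 (@malgC {cmonom indet} K)); exact: Pc.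
apply: (PD _ _ _ Ps) => {s Ps}.
move: m (r@_m) => {r}; apply: cmonom_ind => [c|i m IH c]; first exact: Pc.
rewrite monalgU_mul.
apply: PM => //; rewrite -[i]reprK; case: (repr i) => x y; exact: Pl.
Qed.
End HatTheory.

Section Semilinear.
Variables (K : realType) (V W : formed_algebra K).
Variables (g : fa_coef V -> fa_coef W) (f : V -> W).
Hypotheses (g0 : g 0 = 0) (gD : forall r s, g (r + s) = g r + g s).
Hypothesis gM : forall r s, g (r * s) = g r * g s.
Hypothesis f0 : f 0 = 0.
Hypothesis fP : forall c u v, f (c *: u + v) = g c *: f u + f v.
Variables (X : Type) (e : X -> V).
Hypothesis indP : forall P : V -> Prop, P 0 ->
  (forall c u v, P u -> P v -> P (c *: u + v)) ->
  (forall x, P (e x)) -> forall u, P u.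

Lemma semilinear_mul :
  (forall x y, f (fa_mul (e x) (e y)) = fa_mul (f (e x)) (f (e y))) ->
  forall u v, f (fa_mul u v) = fa_mul (f u) (f v).
Proof.
move=> H; apply: indP => [v|c u u' Hu Hu' v|x].
- by rewrite fa_mul0r f0 fa_mul0r.
- by rewrite fa_mulDl fa_mulZl !fP Hu Hu' [RHS]fa_mulDl fa_mulZl.
apply: indP => [|c u u' Hu Hu'|y //].
- by rewrite fa_mulr0 f0 fa_mulr0.
- by rewrite fa_mulDr fa_mulZr !fP Hu Hu' [RHS]fa_mulDr fa_mulZr.
Qed.

Lemma semilinear_form :
  (forall x y, g (fa_form (e x) (e y)) = fa_form (f (e x)) (f (e y))) ->
  forall u v, g (fa_form u v) = fa_form (f u) (f v).
Proof.
move=> H; apply: indP => [v|c u u' Hu Hu' v|x].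
- by rewrite fa_form0r f0 fa_form0r g0.
- by rewrite fa_formDl fa_formZl !fP gD gM Hu Hu' [RHS]fa_formDl fa_formZl.
apply: indP => [|c u u' Hu Hu'|y //].
- by rewrite fa_formr0 f0 fa_formr0 g0.
- by rewrite fa_formDr fa_formZr !fP gD gM Hu Hu' [RHS]fa_formDr fa_formZr.
Qed.

Hypothesis g_emb : forall c, g (fa_emb V c) = fa_emb W c.

Lemma semilinear_pev t p : g (pev t p) = pev (g t) p.
Proof. by elim: p => [|c p IH] //=; rewrite gD gM IH /qev g_emb. Qed.

Lemma semilinear_vev t b v : f (vev t b v) = vev (g t) (f \o b) v.
Proof.
rewrite /vev; elim: v 0%N => [|p v IH] n //=.
by rewrite fP IH semilinear_pev.
Qed.
End Semilinear.

Section HatEvaluation.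
Variables (K : realType) (t : K).
Local Notation W := (concrete_model t).
Local Notation hat := (hat_algebra K).

Fixpoint eval_tree (x : tree) : W :=
  match x with
  | Leaf g => coord_vec K (g.1.*2 + g.2)
  | Node x y => @fa_mul K W (eval_tree x) (eval_tree y)
  end.

Lemma eval_tree_cong x y : tree_cong x y -> eval_tree x = eval_tree y.
Proof.
elim=> [//|x' y' _ -> //|y' x' z _ -> _ -> //|x1 x2 y1 y2 _ /= -> _ -> //|x1 x2].
exact: fa_mulC.
Qed.

Definition eval_magma (x : magma) : W := eval_tree (repr x).

Lemma eval_magma_pi x : eval_magma (\pi_magma x) = eval_tree x.
Proof.
apply: eval_tree_cong; suff : tree_eq (repr (\pi_magma x)) x by move/asboolP.
by rewrite -(@pi_eq_quot _ _ magma) reprK.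
Qed.

Lemma eval_mop x y :
  eval_magma (mop x y) = @fa_mul K W (eval_magma x) (eval_magma y).
Proof. exact: eval_magma_pi. Qed.

Lemma eval_gen i e : eval_magma (gen i e) = axis_family (coord_vec K) i e.
Proof. exact: eval_magma_pi. Qed.

Definition eval_indet (i : indet) : K :=
  let p := repr i in @fa_form K W (eval_magma p.1) (eval_magma p.2).

(** Evaluation respects the classes of pairs because the generating relation (xy, z) ~ (x, yz)
    becomes the associativity of the form of the model. *)
Lemma eval_indet_pi x y : eval_indet (\pi_indet (x, y)) =
  @fa_form K W (eval_magma x) (eval_magma y).
Proof.
have H p q : clos_refl_sym_trans _ assoc_step p q ->
    @fa_form K W (eval_magma p.1) (eval_magma p.2) =
    @fa_form K W (eval_magma q.1) (eval_magma q.2).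
  elim=> [p' q' [x' y' z]|//|p' q' _ -> //|p' q' r' _ -> _ -> //] /=.
  rewrite !eval_mop; apply/esym.
  exact: (model_frobenius (concrete_modelP t)).
have /eqP := reprK (\pi_indet (x, y)).
by rewrite (@pi_eq_quot _ _ indet) => /asboolP/H.
Qed.

Definition eval_monom (m : {cmonom indet}) : K :=
  \prod_(i <- finsupp m) eval_indet i ^+ m i.

Lemma eval_monomEw (d : {fset indet}) (m : {cmonom indet}) :
  (finsupp m `<=` d)%fset -> eval_monom m = \prod_(i <- d) eval_indet i ^+ m i.
Proof.
move=> md; rewrite /eval_monom (big_fset_incl _ md) // => i _.
by rewrite -cmE_eq0 => /eqP ->.
Qed.

Lemma eval_monom_mmorphism : mmorphism eval_monom.
Proof.
split=> [m n|]; last by rewrite /eval_monom mdom1 big_seq_fset0.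
rewrite [LHS](@eval_monomEw (finsupp m `|` finsupp n)%fset) ?mdomD //.
rewrite (eval_monomEw (fsubsetUl (finsupp m) (finsupp n))).
rewrite (eval_monomEw (fsubsetUr (finsupp m) (finsupp n))) -big_split.
by apply: eq_bigr => i _; rewrite cmM exprD.
Qed.

HB.instance Definition _ :=
  isMultiplicative.Build _ _ eval_monom eval_monom_mmorphism.

Definition eval_hatR : fa_coef hat -> K := mmap idfun eval_monom.

Lemma eval_hatRD r s : eval_hatR (r + s) = eval_hatR r + eval_hatR s.
Proof. exact: mmapD. Qed.
Lemma eval_hatRM r s : eval_hatR (r * s) = eval_hatR r * eval_hatR s.
Proof. exact: (rmorphM (mmap idfun eval_monom)). Qed.
Lemma eval_hatRC (c : K) : eval_hatR (fa_emb hat c) = c.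
Proof. exact: mmapC. Qed.
Lemma eval_hatR0 : eval_hatR 0 = 0.
Proof. exact: mmap0. Qed.
Lemma eval_hatR1 : eval_hatR 1 = 1.
Proof. exact: mmap1. Qed.
Lemma eval_lambda x y : eval_hatR (lambda K x y) =
  @fa_form K W (eval_magma x) (eval_magma y).
Proof.
rewrite /eval_hatR /lambda mmapU mul1r -eval_indet_pi.
by rewrite -[LHS]/(eval_monom _) /eval_monom mdomU big_seq_fset1 cmUU.
Qed.

Definition eval_hatM (u : hat) : W :=
  \sum_(x <- msupp (u : hatM K)) eval_hatR (u : hatM K)@_x *: eval_magma x.

Lemma eval_hatMEw (d : {fset magma}) (u : hat) :
  (msupp (u : hatM K) `<=` d)%fset ->
  eval_hatM u = \sum_(x <- d) eval_hatR (u : hatM K)@_x *: eval_magma x.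
Proof.
move=> ud; rewrite /eval_hatM (big_fset_incl _ ud) // => x _ /mcoeff_outdom ->.
by rewrite eval_hatR0 scale0r.
Qed.

Lemma eval_hatMP c (u v : hat) :
  eval_hatM (c *: u + v) = eval_hatR c *: eval_hatM u + eval_hatM v.
Proof.
set d := (msupp (c *: u + v : hatM K) `|`
  (msupp (u : hatM K) `|` msupp (v : hatM K)))%fset.
have du : (msupp (u : hatM K) `<=` d)%fset.
  exact: fsubset_trans (fsubsetUl _ _) (fsubsetUr _ _).
have dv : (msupp (v : hatM K) `<=` d)%fset.
  exact: fsubset_trans (fsubsetUr _ _) (fsubsetUr _ _).
rewrite (eval_hatMEw (fsubsetUl _ _ : _ `<=` d)%fset).
rewrite (eval_hatMEw du) (eval_hatMEw dv) scaler_sumr -big_split.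
apply: eq_bigr => x _ /=.
by rewrite mcoeffD mcoeffZ eval_hatRD eval_hatRM scalerDl scalerA.
Qed.

Lemma eval_hatMU x : eval_hatM (hat_elt K x) = eval_magma x.
Proof.
rewrite (eval_hatMEw (@msuppU_le _ _ x 1)) big_seq_fset1 mcoeffUU.
by rewrite eval_hatR1 scale1r.
Qed.

Lemma eval_hatM0 : eval_hatM 0 = 0.
Proof. by rewrite /eval_hatM msupp0 big_seq_fset0. Qed.
Lemma eval_hatMD u v : eval_hatM (u + v) = eval_hatM u + eval_hatM v.
Proof. by rewrite -[u]scale1r eval_hatMP eval_hatR1 !scale1r. Qed.
Lemma eval_hatMZ c u : eval_hatM (c *: u) = eval_hatR c *: eval_hatM u.
Proof. by rewrite -[c *: u]addr0 eval_hatMP eval_hatM0 addr0. Qed.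
Lemma eval_hatMB u v : eval_hatM (u - v) = eval_hatM u - eval_hatM v.
Proof.
apply/eqP; rewrite -subr_eq opprK -eval_hatMD subrK; exact/eqP.
Qed.
Lemma eval_hatRB r s : eval_hatR (r - s) = eval_hatR r - eval_hatR s.
Proof. exact: mmapB. Qed.

Lemma eval_hat_mul (u v : hat) :
  eval_hatM (fa_mul u v) = fa_mul (eval_hatM u) (eval_hatM v).
Proof.
apply: (semilinear_mul eval_hatM0 eval_hatMP (@hat_ind K)) => x y.
rewrite hat_mul_elt; apply: etrans (eval_hatMU (mop x y)) _.
by rewrite eval_mop; congr fa_mul; rewrite eval_hatMU.
Qed.

Lemma eval_hat_form (u v : hat) :
  eval_hatR (fa_form u v) = fa_form (eval_hatM u) (eval_hatM v).
Proof.
apply: (@semilinear_form K hat W eval_hatR eval_hatM eval_hatR0 eval_hatRD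
  eval_hatRM eval_hatM0 eval_hatMP _ _ (@hat_ind K)) => x y.
rewrite hat_form_elt; apply: etrans (eval_lambda x y) _.
by rewrite (eval_hatMU x) (eval_hatMU y).
Qed.
End HatEvaluation.

(** * Quotients by ideal pairs *)

Section QuotientTheory.
Variables (K : realType) (V : formed_algebra K) (P : ideal_pair V).

Definition qM (u : V) : quotient P := piM P u.
Definition qR (r : fa_coef V) : fa_coef (quotient P) := piR P r.

Lemma qM_eq u v : qM u = qM v <-> u - v \in idealM P.
Proof.
split=> [uv|]; last exact: piM_eq.
by rewrite Quotient.idealrBE; apply/eqP.
Qed.

Lemma qR_eq r s : qR r = qR s <-> r - s \in idealR P.
Proof.
split=> [uv|]; last exact: piR_eq.
by rewrite Quotient.idealrBE; apply/eqP.
Qed.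

Lemma qMD u v : qM (u + v) = qM u + qM v. Proof. exact: piMD. Qed.
Lemma qRD r s : qR (r + s) = qR r + qR s. Proof. exact: piRD. Qed.
Lemma qM0 : qM 0 = 0. Proof. exact: (raddf0 \pi_(quotM P)). Qed.
Lemma qR0 : qR 0 = 0. Proof. exact: (raddf0 \pi_(quotR P)). Qed.
Lemma qR1 : qR 1 = 1. Proof. by []. Qed.
Lemma qRM r s : qR (r * s) = qR r * qR s.
Proof. by apply/esym; exact: quotR_mulE. Qed.
Lemma qMZ r u : qM (r *: u) = qR r *: qM u.
Proof. by apply/esym; exact: quotM_scaleE. Qed.
Lemma qMP r u v : qM (r *: u + v) = qR r *: qM u + qM v.
Proof. by rewrite qMD qMZ. Qed.
Lemma qM_mul u v : qM (fa_mul u v) = fa_mul (qM u) (qM v).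
Proof. by apply/esym; exact: quotM_mulE. Qed.
Lemma qM_form u v : qR (fa_form u v) = fa_form (qM u) (qM v).
Proof. by apply/esym; exact: quotM_formE. Qed.
Lemma qR_emb c : qR (fa_emb V c) = fa_emb (quotient P) c. Proof. by []. Qed.
Lemma qMW (Q : quotient P -> Prop) : (forall u, Q (qM u)) -> forall x, Q x.
Proof. exact: piMP. Qed.
Lemma qRW (Q : fa_coef (quotient P) -> Prop) :
  (forall u, Q (qR u)) -> forall x, Q x.
Proof. exact: piRP. Qed.

Lemma qM_sum (I : Type) (s : seq I) (Q : pred I) (F : I -> V) :
  qM (\sum_(i <- s | Q i) F i) = \sum_(i <- s | Q i) qM (F i).
Proof. exact: (big_morph qM qMD qM0). Qed.

Lemma qM_eq0 u : qM u = 0 <-> u \in idealM P.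
Proof. by rewrite -qM0 qM_eq subr0. Qed.
Lemma qR_pev t p : qR (pev t p) = pev (qR t) p.
Proof. exact: (semilinear_pev qR0 qRD qRM qR_emb). Qed.
Lemma qM_vev t b v : qM (vev t b v) = vev (qR t) (qM \o b) v.
Proof. exact: (semilinear_vev qR0 qRD qRM qM0 qMP qR_emb). Qed.
End QuotientTheory.

(** * The kernel of a homomorphism of algebras with form *)

Section KernelPair.
Variables (K : realType) (V W : formed_algebra K).
Variables (g : fa_coef V -> fa_coef W) (f : V -> W).
Hypotheses (g0 : g 0 = 0) (gD : forall r s, g (r + s) = g r + g s).
Hypothesis gM : forall r s, g (r * s) = g r * g s.
Hypothesis f0 : f 0 = 0.
Hypothesis fP : forall c u v, f (c *: u + v) = g c *: f u + f v.
Hypothesis f_mul : forall u v, f (fa_mul u v) = fa_mul (f u) (f v).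
Hypothesis f_form : forall u v, g (fa_form u v) = fa_form (f u) (f v).
Hypothesis g_emb : forall c, g (fa_emb V c) = fa_emb W c.

Let kerM : {pred V} := fun u => f u == 0.
Let kerR : {pred fa_coef V} := fun r => g r == 0.

Let kerMP u : reflect (f u = 0) (u \in kerM). Proof. exact: eqP. Qed.
Let kerRP u : reflect (g u = 0) (u \in kerR). Proof. exact: eqP. Qed.

Let kerM_submod : submod_closed kerM.
Proof.
split=> [|c u v /kerMP u0 /kerMP v0]; apply/kerMP => //.
by rewrite fP u0 v0 scaler0 addr0.
Qed.
Let kerM_mul u w : u \in kerM -> fa_mul u w \in kerM.
Proof. by move=> /kerMP u0; apply/kerMP; rewrite f_mul u0 fa_mul0r. Qed.
Let kerR_submod : submod_closed (kerR : {pred (fa_coef V)^o}).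
Proof.
split=> [|c u v /kerRP u0 /kerRP v0]; apply/kerRP => //.
by rewrite gD gM u0 v0 mulr0 addr0.
Qed.
Let ker_scale r (u : V) : r \in kerR -> r *: u \in kerM.
Proof.
by move=> /kerRP r0; apply/kerMP; rewrite -[r *: u]addr0 fP r0 scale0r add0r.
Qed.
Let ker_forml u w : u \in kerM -> fa_form u w \in kerR.
Proof. by move=> /kerMP u0; apply/kerRP; rewrite f_form u0 fa_form0r. Qed.
Let ker_formr u w : u \in kerM -> fa_form w u \in kerR.
Proof. by move=> /kerMP u0; apply/kerRP; rewrite f_form u0 fa_formr0. Qed.

Definition kernel_pair : ideal_pair V :=
  IdealPair kerM_submod kerM_mul kerR_submod ker_scale ker_forml ker_formr.

Let fB u v : f (u - v) = f u - f v.
Proof.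
have gN1 : g (-1) = -1.
  apply/eqP; rewrite -subr_eq0 opprK -(rmorph1 (fa_emb W)) -g_emb -gD.
  by rewrite rmorph1 addNr g0.
by rewrite addrC -scaleN1r fP gN1 scaleN1r addrC.
Qed.
Let gB r s : g (r - s) = g r - g s.
Proof. by apply/eqP; rewrite -subr_eq opprK -gD subrK. Qed.

Lemma kernel_pairM u v : qM kernel_pair u = qM kernel_pair v <-> f u = f v.
Proof.
rewrite qM_eq; split=> [/kerMP/eqP|uv]; first by rewrite fB subr_eq0 => /eqP.
by apply/kerMP; rewrite fB uv subrr.
Qed.

Lemma kernel_pairR r s : qR kernel_pair r = qR kernel_pair s <-> g r = g s.
Proof.
rewrite qR_eq; split=> [/kerRP/eqP|rs]; first by rewrite gB subr_eq0 => /eqP.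
by apply/kerRP; rewrite gB rs subrr.
Qed.

Lemma kernel_pair_proper : 1 != 0 :> fa_coef W -> 1 \notin idealR kernel_pair.
Proof.
move=> W1; apply/kerRP; rewrite -(rmorph1 (fa_emb V)) g_emb rmorph1.
exact/eqP.
Qed.

Let fZ c u : f (c *: u) = g c *: f u.
Proof. by rewrite -[c *: u]addr0 fP f0 addr0. Qed.

Let fS (F : 'I_12 -> V) : f (\sum_(i < 12) F i) = \sum_(i < 12) f (F i).
Proof.
apply: (big_morph f _ f0) => x y.
by rewrite -[x]scale1r fP -(rmorph1 (fa_emb V)) g_emb !rmorph1 !scale1r.
Qed.

(** Two classes modulo the kernel agree exactly when their images in W agree, so each condition can
    be tested in W. Surjectivity of g is used for the span, to lift the coefficients. *)
Lemma kernel_model (t : fa_coef V) (s : nat -> V) :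
  (forall c, exists r, g r = c) ->
  model_basis (g t) (f \o s) ->
  model_basis (qR kernel_pair t) (qM kernel_pair \o s).
Proof.
move=> gsurj bW; split.
- by rewrite -qR1 -(qR0 kernel_pair); apply/eqP => /kernel_pairR;
    rewrite -(rmorph1 (fa_emb V)) g_emb rmorph1 g0 => /eqP; apply/negP;
    exact: mb_nz bW.
- move=> i j v ijv; rewrite -[LHS]/(fa_mul (qM _ (s i)) (qM _ (s j))) -qM_mul -qM_vev; apply/kernel_pairM.
  rewrite f_mul (semilinear_vev g0 gD gM f0 fP g_emb).
  exact: (mb_mul bW).
- move=> i j p ijp; rewrite -[LHS]/(fa_form (qM _ (s i)) (qM _ (s j))) -qM_form -qR_pev; apply/kernel_pairR.
  rewrite f_form (semilinear_pev g0 gD gM g_emb).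
  exact: (mb_form bW).
- apply: qMW => u; have [c uE] := mb_span bW (f u).
  have [r rE] := choice gsurj.
  exists (fun n => qR kernel_pair (r (c n))).
  under eq_bigr do rewrite -qMZ.
  rewrite -qM_sum; apply/kernel_pairM; rewrite uE.
  by rewrite fS; apply: eq_bigr => n _; rewrite fZ rE.
- move=> c c0 n n12.
  have cR m : exists r, c m = qR kernel_pair r.
    by move: (c m); apply: qRW => r; exists r.
  have [r rE] := choice cR.
  rewrite rE -(qR0 kernel_pair); apply/kernel_pairR; rewrite g0.
  apply: (mb_free bW (c := g \o r)) => //.
  move: c0; under eq_bigr do rewrite rE -qMZ.
  rewrite -qM_sum -(qM0 kernel_pair) => /kernel_pairM; rewrite f0 => H.
  by rewrite -[RHS]H fS; apply: eq_bigr => m _; rewrite fZ.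
Qed.
End KernelPair.

Section EvaluationPair.
Variables (K : realType) (t : K).
Local Notation W := (concrete_model t).
Local Notation hat := (hat_algebra K).
Let g : fa_coef hat -> fa_coef W := @eval_hatR K t.
Let f : hat -> W := @eval_hatM K t.

Let g0 : g 0 = 0. Proof. exact: eval_hatR0. Qed.
Let gD r s : g (r + s) = g r + g s. Proof. exact: eval_hatRD. Qed.
Let gM r s : g (r * s) = g r * g s. Proof. exact: eval_hatRM. Qed.
Let f0 : f 0 = 0. Proof. exact: eval_hatM0. Qed.
Let fP c u v : f (c *: u + v) = g c *: f u + f v.
Proof. exact: eval_hatMP. Qed.
Let f_mul u v : f (fa_mul u v) = fa_mul (f u) (f v).
Proof. exact: eval_hat_mul. Qed.
Let f_form u v : g (fa_form u v) = fa_form (f u) (f v).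
Proof. exact: eval_hat_form. Qed.
Let g_emb c : g (fa_emb hat c) = fa_emb W c.
Proof. exact: eval_hatRC. Qed.

Definition eval_pair : ideal_pair hat :=
  kernel_pair g0 gD gM f0 fP f_mul f_form.

Lemma eval_hat_gen i e :
  eval_hatM t (hat_gen K i e) = axis_family (coord_vec K) i e.
Proof. by rewrite -eval_gen; exact: eval_hatMU. Qed.

(** The image is a subalgebra, since the scalars of K lift to constants, and it contains the axes,
    which generate the model. *)
Lemma eval_hatM_surj (u : W) : exists x, eval_hatM t x = u.
Proof.
have := model_generated (concrete_modelP t); rewrite predeqE => /(_ u)[_ /(_ I)].
move=> /(_ [set u | exists x, eval_hatM t x = u]); apply.
  split.
  - by exists 0; rewrite eval_hatM0.
  - move=> c _ _ [x <-] [y <-]; exists (fa_emb hat c *: x + y).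
    by rewrite eval_hatMP eval_hatRC.
  - by move=> _ _ [x <-] [y <-]; exists (fa_mul x y); rewrite eval_hat_mul.
by move=> _ [i [e ->]]; exists (hat_gen K i e); rewrite eval_hat_gen.
Qed.

Lemma eval_pair_C4A : C_4A eval_pair.
Proof.
have [h hE] := choice eval_hatM_surj.
(* The first six lifts are the free generators themselves, so that the axes of the quotient are
   literally the marked generators; the other six are arbitrary preimages. *)
pose s n : hat := if (n < 6)%N then hat_gen K (inord n./2) (odd n)
                  else h (coord_vec K n).
have sa (i : 'I_3) (e : bool) : s (i.*2 + e)%N = hat_gen K i e.
  by case: i e => [[|[|[|//]]] i3] []; rewrite /s /=; congr hat_gen;
    apply/val_inj; rewrite /= inordK.
have fs n : f (s n) = coord_vec K n.
  rewrite /s; case: ltnP => n6; last exact: hE.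
  rewrite [LHS]eval_hat_gen /axis_family.
  by case: n n6 => [|[|[|[|[|[|//]]]]]] _; rewrite /= inordK.
have bW : model_basis (g (fa_emb hat t)) (f \o s).
  have -> : f \o s = (coord_vec K : nat -> W) by apply/funext => n; exact: fs.
  by rewrite g_emb; exact: concrete_modelP.
have bQ := kernel_model g0 gD gM f0 fP f_mul f_form g_emb
  (fun c => ex_intro _ _ (g_emb c)) bW.
have aE : axis_family (qM eval_pair \o s) = marked eval_pair.
  by apply/funext => i; apply/funext => e; rewrite /axis_family /= sa.
split; first exact: kernel_pair_proper g_emb (mb_nz bW).
- by have := model_primitive_frobenius_axial bQ; rewrite -/eval_pair aE.
- by have := model_property_P bQ; rewrite -/eval_pair aE.
- by have := model_shape_4A bQ; rewrite -/eval_pair aE.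
Qed.

(** The kernel of the evaluation is one of the pairs being intersected. Hence evaluation factors
    through M_4A for every real t, which is the source of all independence statements. *)
Lemma eval_pair_4A u : u \in idealM (pair_4A K) -> eval_hatM t u = 0.
Proof. by move=> /asboolW/(_ _ eval_pair_C4A)/eqP. Qed.

End EvaluationPair.

(** * Equational consequences of the axioms *)

(* Unlike the definition of an axis, these conditions pass from all the members
   of [C_4A] to their meet. *)
Record fusion_family (K : realType) (V : formed_algebra K)
    (a : 'I_3 -> bool -> V) : Prop := FusionFamily {
  ff_assoc : forall u v w : V,
    fa_form u (fa_mul v w) = fa_form (fa_mul u v) w;
  ff_idem : forall i e, fa_mul (a i e) (a i e) = a i e;
  ff_norm : forall i e, fa_form (a i e) (a i e) = 1;
  ff_fusion00 : forall i e u v, fa_mul (a i e) u = 0 -> fa_mul (a i e) v = 0 ->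
    fa_mul (a i e) (fa_mul u v) = 0;
  ff_fusion04 : forall i e u v, fa_mul (a i e) u = 0 ->
    fa_mul (a i e) v = fa_emb V 4^-1 *: v ->
    fa_mul (a i e) (fa_mul u v) = fa_emb V 4^-1 *: fa_mul u v;
  ff_fusion44 : forall i e u v, fa_mul (a i e) u = fa_emb V 4^-1 *: u ->
    fa_mul (a i e) v = fa_emb V 4^-1 *: v ->
    fa_mul (a i e) (fa_mul u v) = fa_form (a i e) (fa_mul u v) *: a i e;
  ff_aa : forall i j e d, i != j -> fa_mul (a i e) (a j d) = fa_emb V 64^-1 *:
    (a i e *+ 3 + a j d *+ 3 + a i (~~ e) + a j (~~ d) - v_4A a i j *+ 3);
  ff_av : forall i j e, i != j -> fa_mul (a i e) (v_4A a i j) =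
    fa_emb V 16^-1 *: (a i e *+ 5 - a i (~~ e) - a j false *+ 2 - a j true *+ 2
                       + v_4A a i j *+ 3);
  ff_vv : forall i j, i != j -> fa_mul (v_4A a i j) (v_4A a i j) = v_4A a i j;
  ff_aN : forall i, fa_mul (a i false) (a i true) = 0;
  ff_form_aa : forall i j e d, i != j ->
    fa_form (a i e) (a j d) = fa_emb V 32^-1;
  ff_form_av : forall i j e, i != j ->
    fa_form (a i e) (v_4A a i j) = fa_emb V (3 / 8);
  ff_form_vv : forall i j, i != j -> fa_form (v_4A a i j) (v_4A a i j) = 2;
  ff_form_aN : forall i, fa_form (a i false) (a i true) = 0
}.

Section MemberFusion.
Variables (K : realType) (V : formed_algebra K) (a : 'I_3 -> bool -> V).
Hypothesis axial : primitive_frobenius_axial [set u | exists i e, u = a i e].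
Hypothesis shape : shape_4A a.

Let ax i e : monster_axis (a i e) /\ primitive (a i e).
Proof. by have [_ H _] := axial; apply: H; exists i, e. Qed.

Let code_in n : (n < 4)%N -> code K n \in monster K.
Proof. by move=> n4; exact: mem_nth. Qed.

Let fusion i e n m u v : (n < 4)%N -> (m < 4)%N ->
  fa_mul (a i e) u = fa_emb V (code K n) *: u ->
  fa_mul (a i e) v = fa_emb V (code K m) *: v ->
  eigensum (a i e) [seq code K l | l <- code_fusion n m] (fa_mul u v).
Proof.
move=> n4 m4 au av; have [[_ _ _ H] _] := ax i e.
by rewrite -code_fusionE //; apply: H; rewrite ?code_in.
Qed.

Let eigensum1 u l v : eigensum u [:: l] v -> fa_mul u v = fa_emb V l *: v.
Proof.
by case=> f fe ->; rewrite big_seq1; apply: fe; rewrite inE.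
Qed.

Lemma member_fusion_family : fusion_family a.
Proof.
have [_ _ [assoc _ norm]] := axial.
have idem i e : fa_mul (a i e) (a i e) = a i e by have [[]] := ax i e.
have [v [vC vP]] := shape.
have vE i j : i != j -> v i j = v_4A a i j by move=> /vP/type_4A_v.
split=> //.
- by move=> i e; apply: norm; exists i, e.
- move=> i e u w au aw.
  have := @fusion i e 1 1 u w isT isT; rewrite /code /= rmorph0 !scale0r.
  by move=> /(_ au aw)/eigensum1; rewrite rmorph0 scale0r.
- move=> i e u w au aw.
  have := @fusion i e 1 2 u w isT isT; rewrite /code /= rmorph0 !scale0r.
  by move=> /(_ au aw)/eigensum1.
- move=> i e u w au aw.
  have := @fusion i e 2 2 u w isT isT au aw; rewrite /code /=.
  case=> f fe ->; rewrite big_cons big_seq1.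
  have f1 : fa_mul (a i e) (f 1) = f 1.
    by rewrite (fe 1) ?inE ?eqxx // rmorph1 scale1r.
  have f0 : fa_mul (a i e) (f 0) = 0.
    by rewrite (fe 0) ?inE ?eqxx ?orbT // rmorph0 scale0r.
  (* By primitivity the 1-component is c a with c = <a, f 1>. The 0-component is orthogonal to a, by
     associativity of the form, so c is also the form of a with the whole product, an expression
     that no longer mentions the decomposition. *)
  have [_ prim] := ax i e.
  have [c _ cE] : [set c *: a i e | c in [set: fa_coef V]] (f 1).
    by rewrite -prim; apply: fe; rewrite inE eqxx.
  rewrite fa_mulDr f1 f0 addr0 fa_formDr.
  have -> : fa_form (a i e) (f 0) = 0.
    by rewrite -{1}idem -assoc f0 fa_formr0.
  by rewrite addr0 -cE fa_formZr norm ?mulr1 //; exists i, e.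
- by move=> i j e d ij; have [_ _ /(_ e d)[-> _ _] _ _] := vP i j ij; rewrite vE.
- by move=> i j e ij; have [_ _ /(_ e false)[_ + _] _ _] := vP i j ij; rewrite vE.
- by move=> i j ij; have [+ _ _ _ _] := vP i j ij; rewrite vE.
- move=> i; pose j : 'I_3 := if i == 0 then 1 else 0.
  have ij : i != j by rewrite /j; case: (eqVneq i 0) => [->|].
  by have [_ _ _ [-> _] _] := vP i j ij.
- by move=> i j e d ij; have [_ _ _ _ [/(_ e d)[-> _ _] _]] := vP i j ij.
- by move=> i j e ij; have [_ _ _ _ [/(_ e false)[_ + _] _]] := vP i j ij; rewrite vE.
- by move=> i j ij; have [_ _ _ _ [_ [_ _ +]]] := vP i j ij; rewrite vE.
- move=> i; pose j : 'I_3 := if i == 0 then 1 else 0.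
  have ij : i != j by rewrite /j; case: (eqVneq i 0) => [->|].
  by have [_ _ _ _ [_ [-> _ _]]] := vP i j ij.
Qed.
End MemberFusion.

Section MeetFusion.
Variables (K : realType) (V : formed_algebra K) (C : set (ideal_pair V)).
Variable a : 'I_3 -> bool -> V.

Lemma qM_meet u v :
  qM (meet_pair C) u = qM (meet_pair C) v <-> forall P, C P -> qM P u = qM P v.
Proof.
rewrite qM_eq; split=> [uv P CP|uv]; first by apply/qM_eq; exact: (asboolW uv).
by apply/asboolP => P CP; apply/qM_eq; exact: uv.
Qed.

Lemma qR_meet r s :
  qR (meet_pair C) r = qR (meet_pair C) s <-> forall P, C P -> qR P r = qR P s.
Proof.
rewrite qR_eq; split=> [rs P CP|rs]; first by apply/qR_eq; exact: (asboolW rs).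
by apply/asboolP => P CP; apply/qR_eq; exact: rs.
Qed.

Lemma qMN (P : ideal_pair V) u : qM P (- u) = - qM P u.
Proof. by apply/eqP; rewrite -addr_eq0 -qMD addNr qM0. Qed.
Lemma qMB (P : ideal_pair V) u v : qM P (u - v) = qM P u - qM P v.
Proof. by rewrite qMD qMN. Qed.
Lemma qMn (P : ideal_pair V) u n : qM P (u *+ n) = qM P u *+ n.
Proof. by elim: n => [|n IH]; rewrite ?qM0 // !mulrS qMD IH. Qed.
Lemma qM_v4A (P : ideal_pair V) i j :
  qM P (v_4A a i j) = v_4A (fun i e => qM P (a i e)) i j.
Proof. by rewrite /v_4A qMB !qMD !qMZ qM_mul qMD. Qed.

(** Equality in the quotient by the meet means equality in the quotients by all pairs of [C].
    Therefore equations, and implications between equations, that hold in every one of them hold in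
    the quotient by the meet. *)
Lemma meet_fusion_family :
  (forall P, C P -> fusion_family (fun i e => qM P (a i e))) ->
  fusion_family (fun i e => qM (meet_pair C) (a i e)).
Proof.
pose E := (qMN, qMB, qMn, qMD, qMZ, qM_mul, qR_emb, qM_v4A).
move=> H; split.
- apply: qMW => u; apply: qMW => v; apply: qMW => w.
  rewrite -!qM_mul -!qM_form; apply/qR_meet => P CP.
  by rewrite !qM_form !qM_mul (ff_assoc (H P CP)).
- by move=> i e; rewrite -qM_mul; apply/qM_meet => P CP;
    rewrite qM_mul (ff_idem (H P CP)).
- by move=> i e; rewrite -qM_form -qR1; apply/qR_meet => P CP;
    rewrite qM_form (ff_norm (H P CP)).
- move=> i e; apply: qMW => u; apply: qMW => v.
  rewrite -!qM_mul -qM0 => /qM_meet au /qM_meet av; apply/qM_meet => P CP.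
  move: (au P CP) (av P CP); rewrite !qM_mul qM0 => au' av'.
  exact: (ff_fusion00 (H P CP)).
- move=> i e; apply: qMW => u; apply: qMW => v.
  rewrite -!qR_emb -!qM_mul -!qMZ -qM0 => /qM_meet au /qM_meet av.
  apply/qM_meet => P CP.
  move: (au P CP) (av P CP); rewrite !qMZ !qM_mul qM0 !qR_emb => au' av'.
  exact: (ff_fusion04 (H P CP)).
- move=> i e; apply: qMW => u; apply: qMW => v.
  rewrite -!qR_emb -!qM_mul -qM_form -!qMZ => /qM_meet au /qM_meet av.
  apply/qM_meet => P CP.
  move: (au P CP) (av P CP).
  rewrite !qMZ !qM_form !qM_mul !qR_emb => au' av'.
  exact: (ff_fusion44 (H P CP)).
- move=> i j e d ij; rewrite -qM_v4A -qM_mul -!qMn -!qMD -qMB -qR_emb -qMZ.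
  by apply/qM_meet => P CP; rewrite !E (ff_aa (H P CP)).
- move=> i j e ij; rewrite -qM_v4A -qM_mul -!qMn -!qMB -!qMD -qR_emb -qMZ.
  by apply/qM_meet => P CP; rewrite !E (ff_av (H P CP)).
- move=> i j ij; rewrite -qM_v4A -qM_mul.
  by apply/qM_meet => P CP; rewrite !E (ff_vv (H P CP)).
- move=> i; rewrite -qM_mul -qM0.
  by apply/qM_meet => P CP; rewrite qM_mul qM0 (ff_aN (H P CP)).
- move=> i j e d ij; rewrite -qM_form -qR_emb.
  by apply/qR_meet => P CP; rewrite qM_form qR_emb (ff_form_aa (H P CP)).
- move=> i j e ij; rewrite -qM_v4A -qM_form -qR_emb.
  by apply/qR_meet => P CP; rewrite qM_form qR_emb qM_v4A (ff_form_av (H P CP)).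
- move=> i j ij; rewrite -qM_v4A -qM_form.
  rewrite -[2]/(1 + 1) -qR1 -qRD.
  apply/qR_meet => P CP; rewrite qM_form qRD qR1 qM_v4A (ff_form_vv (H P CP)) //.
- move=> i; rewrite -qM_form -qR0.
  by apply/qR_meet => P CP; rewrite qM_form qR0 (ff_form_aN (H P CP)).
Qed.
End MeetFusion.

Lemma M_4A_fusion_family (K : realType) :
  fusion_family (marked (pair_4A K)).
Proof.
apply: (@meet_fusion_family K (hat_algebra K) (@C_4A K)
  (fun i e => hat_gen K i e)) => P [_ axial _ shape].
exact: member_fusion_family.
Qed.

(** * The multiplication table is forced *)

Section Forced.
Variables (K : realType) (V : formed_algebra K) (a : 'I_3 -> bool -> V).
Hypothesis aV : fusion_family a.
Local Notation "x ∘ y" := (@fa_mul K V x y) (at level 40, left associativity).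
Local Notation "⟪ x , y ⟫" := (@fa_form K V x y) (at level 0).
Local Notation "c %:e" := (fa_emb V c) (at level 2, format "c %:e").
Local Notation v := (v_4A a).
Implicit Types i j k : 'I_3.

Lemma v_4AC i j : v i j = v j i.
Proof.
by rewrite /v_4A fa_mulC [a i false + _]addrC [a i true + _]addrC.
Qed.

(** The form on [hat_algebra] is not symmetric on pairs of generators, so symmetry is derived where
    it is used: first for axes, then for sums, multiples and products. *)
Definition form_sym (x : V) : Prop := forall w, ⟪x, w⟫ = ⟪w, x⟫.

Lemma form_symM x y : form_sym x -> form_sym y -> form_sym (x ∘ y).
Proof.
move=> sx sy w; rewrite -(ff_assoc aV) sx -(ff_assoc aV) sy (ff_assoc aV) //.
Qed.
Lemma form_symD x y : form_sym x -> form_sym y -> form_sym (x + y).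
Proof. by move=> sx sy w; rewrite fa_formDl fa_formDr sx sy. Qed.
Lemma form_symZ c x : form_sym x -> form_sym (c *: x).
Proof. by move=> sx w; rewrite fa_formZl fa_formZr sx. Qed.
Lemma form_symB x y : form_sym x -> form_sym y -> form_sym (x - y).
Proof. by move=> sx sy w; rewrite fa_formBl fa_formBr sx sy. Qed.

(** Idempotence lets a be moved across twice: <a, x> = <a a, x> = <a, x a> = <a x, a> = <x, a a> =
    <x, a>. *)
Lemma form_sym_axis i e : form_sym (a i e).
Proof.
move=> x; rewrite -{1}(ff_idem aV i e) -(ff_assoc aV) [a i e ∘ x]fa_mulC.
by rewrite (ff_assoc aV) [a i e ∘ x]fa_mulC -(ff_assoc aV) (ff_idem aV).
Qed.

Lemma form_sym_v i j : form_sym (v i j).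
Proof.
have sa := form_sym_axis.
by rewrite /v_4A; apply: form_symB; [|apply: form_symZ; exact: form_symM];
  repeat first [exact: form_sym_axis | apply: form_symD | apply: form_symZ].
Qed.

Lemma axis_orth i e : a i e ∘ a i (~~ e) = 0.
Proof. by case: e; rewrite ?[a i true ∘ _]fa_mulC (ff_aN aV). Qed.

Lemma form_axis_orth i e : ⟪a i e, a i (~~ e)⟫ = 0.
Proof.
by case: e; rewrite ?[⟪a i true, _⟫]form_sym_axis (ff_form_aN aV).
Qed.

Lemma emb_inj0 (c : K) (r : fa_coef V) : c != 0 -> c%:e * r = 0 -> r = 0.
Proof.
by move=> c0 /(congr1 (fun x => c^-1%:e * x)); rewrite mulrA embK // mul1r mulr0.
Qed.

Section Local.
Variables (i j k : 'I_3) (e : bool).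
Hypotheses (ij : i != j) (ik : i != k) (jk : j != k).

(** Relabelling reduces every argument to one axis, placed in first position; the sign e is absorbed
    at that position only. *)
Definition loc_index (p : nat) : 'I_3 := nth i [:: i; j; k] p.
Definition loc_sign (p : nat) : bool := (p == 0%N) && e.
Definition loc_a (p : nat) (d : bool) : V := a (loc_index p) (d (+) loc_sign p).
Definition loc_v (p : nat) : V := nth 0 [:: v j k; v i k; v i j] p.

(* The basis, renumbered so that (i, e) becomes (1, +), j becomes 2 and k
   becomes 3, with arbitrary elements after the a's and the v's. *)
Definition loc (x : nat -> V) (n : nat) : V :=
  match symbol n with
  | SA p d => loc_a p d
  | SV p => loc_v p
  | SU m => x m
  end.

Variables (t : fa_coef V) (x : nat -> V).
Local Notation ev := (vev t (loc x)).

Lemma loc_index_neq p q : (p < 3)%N -> (q < 3)%N -> p != q ->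
  loc_index p != loc_index q.
Proof.
move: ij ik jk; rewrite (eq_sym i j) (eq_sym i k) (eq_sym j k) => ji ki kj.
by case: p q => [|[|[|//]]] [|[|[|//]]] _ _ //= _; rewrite ?ij // eq_sym.
Qed.

Lemma loc_vE p q : (p < 3)%N -> (q < 3)%N -> p != q ->
  v (loc_index p) (loc_index q) = loc_v (third p q).
Proof.
by case: p q => [|[|[|//]]] [|[|[|//]]] _ _ //= _; rewrite /loc_v /= // v_4AC.
Qed.

Lemma ev_xa p d : (p < 3)%N -> ev (xa p d) = loc_a p d.
Proof. by rewrite vev_atom; case: p d => [|[|[|//]]] []. Qed.
Lemma ev_xv p : (p < 3)%N -> ev (xv p) = loc_v p.
Proof. by rewrite vev_atom; case: p => [|[|[|//]]]. Qed.
Lemma ev_xu p : ev (xu p) = x p.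
Proof. by rewrite vev_atom /loc /symbol /= addKn. Qed.
Lemma loc_as p : loc_a p false + loc_a p true =
  a (loc_index p) false + a (loc_index p) true.
Proof. by rewrite /loc_a; case: loc_sign => //; rewrite addrC. Qed.
Lemma ev_xs p : (p < 3)%N ->
  ev (xs p) = a (loc_index p) false + a (loc_index p) true.
Proof.
by move=> p3; rewrite vevD !ev_xa // loc_as.
Qed.

Lemma third_lt3 p q : (p < 3)%N -> (q < 3)%N -> p != q -> (third p q < 3)%N.
Proof. by case: p q => [|[|[|//]]] [|[|[|//]]]. Qed.

Lemma loc_aa p d q d' : (p < 3)%N -> (q < 3)%N ->
  loc_a p d ∘ loc_a q d' = ev (prod_aa p d q d').
Proof.
move=> p3 q3; rewrite /prod_aa; case: (eqVneq p q) => [<-|pq].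
  case: eqP => [<-|/eqP dd']; first by rewrite ev_xa // (ff_idem aV).
  have -> : d' = ~~ d by case: d d' dd' => [] [].
  by rewrite /loc_a addNb axis_orth.
rewrite /loc_a (ff_aa aV) ?loc_index_neq // -!addNb loc_vE //.
rewrite !(vevB, vevD, vevZ) !ev_xa ?ev_xv ?third_lt3 //.
rewrite !pev_cst (qev_inv V 64) (qev_nat V 3) !scaler_nat.
by rewrite mulrnDl.
Qed.

Lemma loc_av p d q : (p < 3)%N -> (q < 3)%N -> p != q ->
  loc_a p d ∘ loc_v q = ev (prod_av p d q).
Proof.
move=> p3 q3 pq; rewrite /prod_av (negPf pq).
have r3 := third_lt3 p3 q3 pq.
have pr : p != third p q by case: p q p3 q3 pq {r3} => [|[|[|//]]] [|[|[|//]]].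
have rE : third p (third p q) = q.
  by case: p q p3 q3 pq {r3 pr} => [|[|[|//]]] [|[|[|//]]].
rewrite -{1}rE -loc_vE // /loc_a (ff_av aV) ?loc_index_neq // loc_vE // rE.
rewrite -addNb !(vevB, vevD, vevZ) !ev_xa ?ev_xv //.
rewrite loc_as !pev_cst (qev_inv V 16).
rewrite (qev_nat V 2) (qev_nat V 3) (qev_nat V 5) !scaler_nat.
by congr (_ *: (_ + _)); rewrite mulrnDl -[LHS]addrA -opprD.
Qed.

Lemma loc_vv p : (p < 3)%N -> loc_v p ∘ loc_v p = loc_v p.
Proof. by case: p => [|[|[|//]]] _; exact: (ff_vv aV). Qed.

(** The products visible inside a single 4A subalgebra. Entries such as a_i v_i, or v_i v_j for
    distinct i and j, are left undefined and supplied by the later tables as they become known. *)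
Definition shape_table (n m : nat) : option tvec :=
  match symbol n, symbol m with
  | SA p d, SA q d' => Some (prod_aa p d q d')
  | SA p d, SV q | SV q, SA p d => if p == q then None else Some (prod_av p d q)
  | SV p, SV q => if p == q then Some (xv p) else None
  | _, _ => None
  end.

Lemma symbolP n : match symbol n return Prop with
  | SA p d => (p < 3)%N | SV p => (p < 3)%N | SU m => n = (9 + m)%N end.
Proof.
rewrite /symbol; case: ltnP => n6.
  by case: n n6 => [|[|[|[|[|[|//]]]]]].
by case: ltnP => n9; [rewrite ltn_subLR | rewrite subnKC].
Qed.

Lemma shape_tableP n m w : shape_table n m = Some w ->
  loc x n ∘ loc x m = ev w.
Proof.
rewrite /shape_table /loc; have := symbolP n; have := symbolP m.
case: (symbol n) => [p d|p|//]; case: (symbol m) => [q d'|q|//] p3 q3.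
- by case=> <-; exact: loc_aa.
- by case: eqVneq => // pq [<-]; exact: loc_av.
- by rewrite fa_mulC; case: eqVneq => // pq [<-]; apply: loc_av.
- by case: eqVneq => // -> [<-]; rewrite loc_vv // ev_xv.
Qed.

Definition shape_form_table (n m : nat) : option tpoly :=
  match symbol n, symbol m with
  | SA p d, SA q d' => Some (symbol_form (SA p d) (SA q d'))
  | SA p d, SV q | SV q, SA p d => if p == q then None else Some (cst (3#8))
  | SV p, SV q => if p == q then Some (cst 2) else None
  | _, _ => None
  end.

Lemma loc_form_aa p d q d' : (p < 3)%N -> (q < 3)%N ->
  ⟪loc_a p d, loc_a q d'⟫ = pev t (symbol_form (SA p d) (SA q d')).
Proof.
move=> p3 q3; rewrite /symbol_form; case: (eqVneq p q) => [<-|pq].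
  case: eqP => [<-|/eqP dd'].
    by rewrite pev_cst qev1 /loc_a (ff_norm aV).
  have -> : d' = ~~ d by case: d d' dd' => [] [].
  by rewrite /loc_a addNb form_axis_orth.
by rewrite pev_cst (qev_inv V 32) /loc_a (ff_form_aa aV) ?loc_index_neq.
Qed.

Lemma loc_form_av p d q : (p < 3)%N -> (q < 3)%N -> p != q ->
  ⟪loc_a p d, loc_v q⟫ = (3 / 8)%:e.
Proof.
move=> p3 q3 pq; have r3 := third_lt3 p3 q3 pq.
have pr : p != third p q by case: p q p3 q3 pq {r3} => [|[|[|//]]] [|[|[|//]]].
have rE : third p (third p q) = q.
  by case: p q p3 q3 pq {r3 pr} => [|[|[|//]]] [|[|[|//]]].
by rewrite -{1}rE -loc_vE // /loc_a (ff_form_av aV) ?loc_index_neq.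
Qed.

Lemma shape_form_tableP n m r : shape_form_table n m = Some r ->
  ⟪loc x n, loc x m⟫ = pev t r.
Proof.
rewrite /shape_form_table /loc; have := symbolP n; have := symbolP m.
case: (symbol n) => [p d|p|//]; case: (symbol m) => [q d'|q|//] q3 p3.
- by case=> <-; exact: loc_form_aa.
- case: eqVneq => // pq [<-]; rewrite pev_cst (qev_frac V 3 8).
  exact: loc_form_av.
- case: eqVneq => // qp [<-]; rewrite pev_cst (qev_frac V 3 8).
  by rewrite -form_sym_axis; exact: loc_form_av.
- case: eqVneq => // -> [<-]; rewrite pev_cst (qev_nat V 2).
  by case: q q3 => [|[|[|//]]] _; exact: (ff_form_vv aV).
Qed.
End Local.

(* a_i - a_{-i} is a 1/32-eigenvector of a_j, while a_j·v_(j,k) has only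
   v_(j,k) as a component which is not orthogonal to it. *)
Lemma form_av_sign i j k e : i != j -> i != k -> j != k ->
  ⟪a i e, v j k⟫ = ⟪a i false, v j k⟫.
Proof.
move=> ij ik jk.
suff H : ⟪a i true - a i false, v j k⟫ = 0.
  by case: e => //; apply/eqP; rewrite -subr_eq0 -fa_formBl H.
(* Neither t nor the additional elements occur in the two shape tables, so zero can stand for all of
   them. *)
pose ev := vev (0 : fa_coef V) (loc i j k false (fun=> 0)).
have TP := shape_tableP false ij ik jk (0 : fa_coef V) (fun=> 0).
have GP := shape_form_tableP false ij ik jk (0 : fa_coef V) (fun=> 0).
pose z := (xa 0 true - xa 0 false)%tv.
have zE : ev z = a i true - a i false.
  by rewrite /ev vevB !ev_xa.
have vE : ev (xv 0) = v j k by rewrite /ev ev_xv.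
rewrite -zE -vE.
have az : ev z ∘ ev (xa 1 false) = ev (cst (1#32) *: z)%tv.
  exact: (vmul_eqP TP).
have := ff_assoc aV (ev z) (ev (xa 1 false)) (ev (xv 0)); rewrite az.
pose w := (cst (1#16) *: (cst 5 *: xa 1 false - xa 1 true - cst 2 *: xs 2))%tv.
have -> : ev (xa 1 false) ∘ ev (xv 0) = ev (cst (3#16) *: xv 0)%tv + ev w.
  by rewrite /ev -vevD; apply: (vmul_eqP TP).
have zw : ⟪ev z, ev w⟫ = 0 by apply: (vform_eqP GP (r := [::])).
rewrite fa_formDr zw addr0.
rewrite [ev (cst _ *: z)%tv]vevZ [ev (cst _ *: _)%tv]vevZ.
rewrite fa_formZr fa_formZl => /eqP; rewrite -subr_eq0 -mulrBl !pev_cst.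
have -> : qev V (Qmake 3 16) = (3 / 16)%:e by exact: (qev_frac V 3 16).
have -> : qev V (Qmake 1 32) = 32^-1%:e by exact: (qev_inv V 32).
rewrite -rmorphB => /eqP/emb_inj0; apply.
by apply/eqP; lra.
Qed.

(** Up to multiples of axes, v_(j,k) and v_(i,j) are -64/3 a_j a_k and -64/3 a_i a_j, and <a_i, a_j
    a_k> = <a_i a_j, a_k>. *)
Lemma form_av_cycle i j k : i != j -> i != k -> j != k ->
  ⟪a i false, v j k⟫ = ⟪a k false, v i j⟫.
Proof.
move=> ij ik jk; rewrite /v_4A !fa_formBr !fa_formDr !fa_formZr !fa_formDr.
rewrite !(ff_form_aa aV) // ?(eq_sym k) // (ff_assoc aV).
by rewrite (form_sym_axis _ _ (_ ∘ _)).
Qed.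
End Forced.

Section ForcedProducts.
Variables (K : realType) (V : formed_algebra K) (a : 'I_3 -> bool -> V).
Hypothesis aV : fusion_family a.
Local Notation "x ∘ y" := (@fa_mul K V x y) (at level 40, left associativity).
Local Notation "⟪ x , y ⟫" := (@fa_form K V x y) (at level 0).
Local Notation "c %:e" := (fa_emb V c) (at level 2, format "c %:e").
Local Notation v := (v_4A a).
Implicit Types i j k : 'I_3.

Definition parameter : fa_coef V := ⟪a 0 false, v 1 2⟫.
Local Notation t := parameter.

Lemma ord3P i : [\/ i = 0, i = 1 | i = 2].
Proof.
by case: i => [[|[|[|//]]] i3]; [constructor 1|constructor 2|constructor 3];
  exact/val_inj.
Qed.

(** One parameter is enough: [form_av_sign] removes the sign, [form_av_cycle] rotates the three
    indices, and v is symmetric in its two indices. *)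
Lemma form_av_parameter i j k e : i != j -> i != k -> j != k ->
  ⟪a i e, v j k⟫ = t.
Proof.
move=> ij ik jk; rewrite (form_av_sign aV) //.
have t1 : ⟪a 2 false, v 0 1⟫ = t by rewrite -(form_av_cycle aV).
have t2 : ⟪a 1 false, v 2 0⟫ = t by rewrite -t1 [RHS](form_av_cycle aV).
move: ij ik jk; case: (ord3P i) => ->; case: (ord3P j) => ->;
  by case: (ord3P k) => -> // _ _ _; rewrite // v_4AC.
Qed.

Section Local.
Variables (i j k : 'I_3) (e : bool).
Hypotheses (ij : i != j) (ik : i != k) (jk : j != k).
Local Notation l_a := (loc_a a i j k e).
Local Notation l_v := (loc_v a i j k).

Lemma loc_form_av_parameter p d : (p < 3)%N -> ⟪l_a p d, l_v p⟫ = t.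
Proof.
case: p => [|[|[|//]]] _; apply: form_av_parameter => //; by rewrite eq_sym.
Qed.

Definition av_form_table (n m : nat) : option tpoly :=
  match symbol n, symbol m with
  | SA p _, SV q | SV q, SA p _ =>
    if p == q then Some (lint 0 1) else shape_form_table n m
  | _, _ => shape_form_table n m
  end.

Lemma pev_t : pev t (lint 0 1) = t.
Proof. by rewrite /= qev0 qev1 mulr0 addr0 add0r mulr1. Qed.

Lemma av_form_tableP x n m r : av_form_table n m = Some r ->
  ⟪loc a i j k e x n, loc a i j k e x m⟫ = pev t r.
Proof.
rewrite /av_form_table => H.
have := @shape_form_tableP _ _ _ aV _ _ _ e ij ik jk t x n m r.
move: H; rewrite /loc; have := symbolP n; have := symbolP m.
case: (symbol n) => [p d|p|?]; case: (symbol m) => [q d'|q|?] q3 p3; try by move=> H0 /(_ H0).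
- case: eqVneq => [-> [<-] _|_ H0 /(_ H0)//].
  by rewrite pev_t loc_form_av_parameter.
- case: eqVneq => [<- [<-] _|_ H0 /(_ H0)//].
  by rewrite pev_t -(form_sym_axis aV) loc_form_av_parameter.
Qed.
End Local.

(** Expressing v_(i,k) by a_{±i}, a_{±k} and a_i a_k leaves <v_(i,j), a_i a_k> = <v_(i,j) a_i, a_k>,
    in which the product is known from the shape. *)
Lemma form_vv i j k : i != j -> i != k -> j != k ->
  ⟪v i j, v i k⟫ = pev t (lint (1#2) (-8#3)).
Proof.
move=> ij ik jk.
pose ev := vev t (loc a i j k false (fun=> 0)).
have TP := shape_tableP aV false ij ik jk t (fun=> 0).
have GP := av_form_tableP false ij ik jk (fun=> 0).
have v1 : ev (xv 1) = v i k by rewrite /ev ev_xv.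
have v2 : ev (xv 2) = v i j by rewrite /ev ev_xv.
pose w := prod_aa 0 false 2 false.
have aw : ev (xa 0 false) ∘ ev (xa 2 false) = ev w by exact: (vmul_eqP TP).
pose y := (xa 0 false + xa 2 false + cst (1#3) *: (xa 0 true + xa 2 true))%tv.
have -> : v i k = ev y - qev V (64#3) *: (ev (xa 0 false) ∘ ev (xa 2 false)).
  rewrite -v1 aw -(pev_cst t (64#3)) -vevZ -vevB; apply: vev_eq.
  by vm_compute.
rewrite -v2 fa_formBr fa_formZr (ff_assoc aV).
have -> : ev (xv 2) ∘ ev (xa 0 false) = ev (prod_av 0 false 2).
  exact: (vmul_eqP TP).
have -> : ⟪ev (xv 2), ev y⟫ = pev t (lint (1#2) (4#3)).
  by apply: (vform_eqP GP); vm_compute.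
have -> : ⟪ev (prod_av 0 false 2), ev (xa 2 false)⟫ = pev t (lint 0 (3#16)).
  by apply: (vform_eqP GP); vm_compute.
rewrite -(pev_cst t) -pevM -mulN1r -(qevN1 V) -(pev_cst t) -pevM -pevD.
by apply: pev_eq; vm_compute.
Qed.

Section FirstRelation.
Variables (i j k : 'I_3) (e : bool).
Hypotheses (ij : i != j) (ik : i != k) (jk : j != k).
Local Notation l_a := (loc_a a i j k e).
Local Notation l_v := (loc_v a i j k).

(** The unknown products that occur in the next computation, entered as new coordinates: a_i v_(j,k)
    for the axis of sign e, a_{±j} v_(i,k), a_{±k} v_(i,j) and v_(i,k) v_(i,j). *)
Let x (n : nat) : V := nth 0 [:: l_a 0 false ∘ l_v 0;
  l_a 1 false ∘ l_v 1; l_a 1 true ∘ l_v 1;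
  l_a 2 false ∘ l_v 2; l_a 2 true ∘ l_v 2; l_v 1 ∘ l_v 2] n.

Let table (n m : nat) : option tvec :=
  match symbol n, symbol m with
  | SA 0 false, SV 0 | SV 0, SA 0 false => Some (xu 0)
  | SA 1 d, SV 1 | SV 1, SA 1 d => Some (xu (1 + d))
  | SA 2 d, SV 2 | SV 2, SA 2 d => Some (xu (3 + d))
  | SV 1, SV 2 | SV 2, SV 1 => Some (xu 5)
  | _, _ => shape_table n m
  end.

Let tableP n m w : table n m = Some w ->
  loc a i j k e x n ∘ loc a i j k e x m = vev t (loc a i j k e x) w.
Proof.
move=> H; have := @shape_tableP _ _ _ aV _ _ _ e ij ik jk t x n m w.
move: H; rewrite /table /loc.
have ex p : vev t (loc a i j k e x) (xu p) = x p by exact: ev_xu.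
case: (symbol n) => [[|[|[|p]]] [] |[|[|[|p]]]|?];
  case: (symbol m) => [[|[|[|q]]] [] |[|[|[|q]]]|?]; try by move=> H0 /(_ H0).
all: by case=> <- _; rewrite [RHS]ex // fa_mulC.
Qed.

Local Notation ev := (vev t (loc a i j k e x)).

Let mulE u w z : vmul_eq table u w z -> ev u ∘ ev w = ev z.
Proof. exact: (vmul_eqP tableP). Qed.

Let table_form n m r : (if (n == 7%N) && (m == 8%N) || (n == 8%N) && (m == 7%N)
    then Some (lint (1#2) (-8#3)) else av_form_table n m) = Some r ->
  ⟪loc a i j k e x n, loc a i j k e x m⟫ = pev t r.
Proof.
case: ifP => [|_]; last exact: av_form_tableP.
have H : ⟪v i k, v i j⟫ = pev t (lint (1#2) (-8#3)).
  by rewrite form_vv // eq_sym.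
by case/orP=> /andP[/eqP -> /eqP ->] [<-] //; rewrite (form_sym_v aV).
Qed.

(* The resurrection principle applied to the products of the 0- and
   1/4-eigenvectors of a_i in <<a_i, a_j>> and <<a_i, a_k>>. *)
Lemma axis_v_sign :
  a i e ∘ v j k = t *: a i e + (3 / 8)%:e *: (v i k ∘ v i j)
    - (3 / 32)%:e *: (v i k + v i j - v j k)
    + (4^-1)%:e *: (v i k ∘ (a j false + a j true)
                    + v i j ∘ (a k false + a k true)).
Proof.
pose a0 := xa 0 false.
pose A1 := eig0 0 false 1; pose A2 := eig0 0 false 2.
pose B1 := eig4 0 1; pose B2 := eig4 0 2.
have a0E : ev a0 = a i e by rewrite ev_xa.
have q4 : qev V (Qmake 1 4) = (4^-1)%:e by exact: (qev_inv V 4).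
have aA1 : a i e ∘ ev A1 = 0 by rewrite -a0E (mulE (z := [::])).
have aA2 : a i e ∘ ev A2 = 0 by rewrite -a0E (mulE (z := [::])).
have aB1 : a i e ∘ ev B1 = (4^-1)%:e *: ev B1.
  by rewrite -a0E -q4 -(pev_cst t) -vevZ; apply: mulE.
have aB2 : a i e ∘ ev B2 = (4^-1)%:e *: ev B2.
  by rewrite -a0E -q4 -(pev_cst t) -vevZ; apply: mulE.
have H00 := ff_fusion00 aV aA1 aA2.
have H04 := ff_fusion04 aV aA1 aB2.
have H40 := ff_fusion04 aV aA2 aB1.
have H44 := ff_fusion44 aV aB1 aB2.
pose G n m := if (n == 7%N) && (m == 8%N) || (n == 8%N) && (m == 7%N)
  then Some (lint (1#2) (-8#3)) else av_form_table n m.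
(* Expanding with the fusion rules, a ((A1 - B1)(A2 - B2)) = -1/4 (A1 B2 + A2 B1) + 1/4 <B1, B2> a.
   The left side can be computed because A1 - B1 and A2 - B2 are combinations of axes. *)
have rel p q z w c : ⟪ev B1, ev B2⟫ = pev t c ->
    ev A1 ∘ ev B2 = ev p -> ev A2 ∘ ev B1 = ev q ->
    (ev A1 - ev B1) ∘ (ev A2 - ev B2) = ev z -> ev a0 ∘ ev z = ev w ->
  ev (w + cst (1#4) *: (p + q) - pmul (cst (1#4)) c *: a0)%tv = 0.
  move=> cE pE qE zE wE.
  rewrite vevB vevD !vevZ pevM pev_cst q4 vevD -wE -zE -pE -qE -cE a0E.
  rewrite fa_mulBl !fa_mulBr H00 H04 H44 (ff_assoc aV) aB1 fa_formZl.
  rewrite [ev B1 ∘ ev A2]fa_mulC H40 sub0r scalerDr opprB.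
  by rewrite [X in X - _]addrACA addNr subrK add0r subrr.
(* The results stay unexpanded terms. The default of [odflt] never occurs: the checks below fail on
   an undefined product or form value. *)
pose c := odflt [::] (vform G B1 B2).
pose p := odflt [::] (vmul table A1 B2); pose q := odflt [::] (vmul table A2 B1).
pose z := odflt [::] (vmul table (A1 - B1)%tv (A2 - B2)%tv).
pose w := odflt [::] (vmul table a0 z).
have D1 : ev A1 - ev B1 = ev (A1 - B1)%tv by rewrite [RHS]vevB.
have D2 : ev A2 - ev B2 = ev (A2 - B2)%tv by rewrite [RHS]vevB.
have zE : (ev A1 - ev B1) ∘ (ev A2 - ev B2) = ev z.
  by rewrite D1 D2; apply: mulE; vm_compute.
have cE : ⟪ev B1, ev B2⟫ = pev t c.
  by apply: (vform_eqP table_form); vm_compute.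
have pE : ev A1 ∘ ev B2 = ev p by apply: mulE; vm_compute.
have qE : ev A2 ∘ ev B1 = ev q by apply: mulE; vm_compute.
have wE : ev a0 ∘ ev z = ev w by apply: mulE; vm_compute.
have r0 := rel _ _ _ _ _ cE pE qE zE wE.
have -> : a i e ∘ v j k = ev (xu 0) by rewrite ev_xu.
transitivity (ev (lint 0 1 *: a0 + cst (3#8) *: xu 5
    - cst (3#32) *: (xv 1 + xv 2 - xv 0)
    + cst (1#4) *: (xu 1 + xu 2 + (xu 3 + xu 4)))%tv).
  (* The relation [r0] contains a_i v_(j,k) with coefficient -4/3, so -3/4 times it solves for this
     product. *)
  rewrite -[RHS]addr0 -(scaler0 _ (pev t (cst (-3#4)))) -[X in _ + _ *: X]r0 -vevZ -vevD.
  by apply: vev_eq; vm_compute.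
have xuE n : ev (xu n) = x n by exact: ev_xu.
have xvE n : (n < 3)%N -> ev (xv n) = l_v n by move=> n3; exact: ev_xv.
rewrite vevD vevB vevD !vevZ vevB 2!vevD (vevD _ _ (xu 1)) (vevD _ _ (xu 3)).
rewrite (xuE 1%N) (xuE 2%N) (xuE 3%N) (xuE 4%N) (xuE 5%N).
rewrite (xvE 0%N isT) (xvE 1%N isT) (xvE 2%N isT).
rewrite a0E pev_t !pev_cst q4 (qev_frac V 3 8) (qev_frac V 3 32) /x /=.
rewrite (fa_mulDr (v i k) (a j false)) (fa_mulDr (v i j) (a k false)).
rewrite (fa_mulC (v i k) (a j false)) (fa_mulC (v i k) (a j true)).
by rewrite (fa_mulC (v i j) (a k false)) (fa_mulC (v i j) (a k true)).
Qed.
End FirstRelation.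
End ForcedProducts.

(** * The elements u_i and the products of the v_i *)

Section ForcedAxisProducts.
Variables (K : realType) (V : formed_algebra K) (a : 'I_3 -> bool -> V).
Hypothesis aV : fusion_family a.
Local Notation "x ∘ y" := (@fa_mul K V x y) (at level 40, left associativity).
Local Notation "c %:e" := (fa_emb V c) (at level 2, format "c %:e").
Local Notation v := (v_4A a).
Local Notation t := (parameter a).
Implicit Types i j k : 'I_3.

Definition u_4A i j k : V := a i false ∘ v j k - t *: a i false.

Lemma u_4AC i j k : u_4A i j k = u_4A i k j.
Proof. by rewrite /u_4A (v_4AC a j k). Qed.

(** In [axis_v_sign] all terms except t a_{±i} are independent of the sign of the axis, so a_i and
    a_{-i} lead to the same u_i. *)
Lemma axis_v i j k e : i != j -> i != k -> j != k ->
  a i e ∘ v j k = t *: a i e + u_4A i j k.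
Proof.
move=> ij ik jk; rewrite /u_4A !(axis_v_sign aV _ ij ik jk).
set x := t *: a i e; set y := t *: a i false.
by rewrite -!(addrA x) -!(addrA y) [y + _]addrC subrK.
Qed.

Section Local.
Variables (i j k : 'I_3) (e : bool).
Hypotheses (ij : i != j) (ik : i != k) (jk : j != k).
Local Notation l_a := (loc_a a i j k e).
Local Notation l_v := (loc_v a i j k).

Definition loc_u (p : nat) : V :=
  nth 0 [:: u_4A i j k; u_4A j i k; u_4A k i j] p.

Lemma loc_axis_v p d : (p < 3)%N -> l_a p d ∘ l_v p = t *: l_a p d + loc_u p.
Proof.
by case: p => [|[|[|//]]] _; apply: axis_v => //; rewrite eq_sym.
Qed.

Let y (n : nat) : V :=
  nth 0 [:: loc_u 0; loc_u 1; loc_u 2; l_v 1 ∘ l_v 2] n.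

(** The formula of [axis_v_sign] read in the other direction: v_(i,k) v_(i,j) occurs in it with
    coefficient 3/8, and once a_{±j} v_(i,k) and a_{±k} v_(i,j) are expressed by u_j and u_k it can
    be solved for that product. *)
Lemma loc_v_prod12 : l_v 1 ∘ l_v 2 = vev t (loc a i j k e y) (prod_vv 1 2).
Proof.
pose ev := vev t (loc a i j k e y).
have xuE n : ev (xu n) = y n by exact: ev_xu.
pose w := (cst (3#8) *: xu 3 - cst (3#32) *: (xv 1 + xv 2 - xv 0)
  + cst (1#4) *: (lint 0 1 *: xs 1 + cst 2 *: xu 1
                  + (lint 0 1 *: xs 2 + cst 2 *: xu 2)))%tv.
have w0 : ev (w - xu 0)%tv = 0.
  have u0 : ev (xu 0) = (3 / 8)%:e *: (v i k ∘ v i j)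
      - (3 / 32)%:e *: (v i k + v i j - v j k)
      + (4^-1)%:e *: (v i k ∘ (a j false + a j true)
                      + v i j ∘ (a k false + a k true)).
    rewrite xuE /y /= /loc_u /= /u_4A (axis_v_sign aV _ ij ik jk).
    set z := t *: a i false; by rewrite -!(addrA z) [z + _]addrC subrK.
  have us p : (p < 3)%N -> l_v p ∘ (l_a p false + l_a p true) =
      t *: (l_a p false + l_a p true) + loc_u p *+ 2.
    move=> p3; rewrite fa_mulDr ![l_v p ∘ _]fa_mulC !loc_axis_v //.
    by rewrite addrACA -scalerDr mulr2n.
  have us1 := us 1%N isT; have us2 := us 2%N isT.
  have -> : ev (w - xu 0)%tv = ev w - ev (xu 0) by exact: vevB.
  rewrite u0; apply/eqP; rewrite subr_eq0; apply/eqP.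
  have -> : v i k ∘ (a j false + a j true) = ev (lint 0 1 *: xs 1 + cst 2 *: xu 1)%tv.
    rewrite [LHS]us1 /ev vevD !vevZ pev_t pev_cst (qev_nat V 2) scaler_nat.
    by rewrite vevD !ev_xa // -/ev xuE.
  have -> : v i j ∘ (a k false + a k true) = ev (lint 0 1 *: xs 2 + cst 2 *: xu 2)%tv.
    rewrite [LHS]us2 /ev vevD !vevZ pev_t pev_cst (qev_nat V 2) scaler_nat.
    by rewrite vevD !ev_xa // -/ev xuE.
  have -> : v i k ∘ v i j = ev (xu 3) by rewrite xuE.
  have -> : v i k + v i j - v j k = ev (xv 1 + xv 2 - xv 0)%tv.
    by rewrite /ev vevB vevD !ev_xv.
  rewrite -(qev_inv V 4) -(qev_frac V 3 8) -(qev_frac V 3 32) -!(pev_cst t).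
  rewrite -vevD -[X in _ = X - _ + _]vevZ -[X in _ = _ - X + _]vevZ.
  by rewrite -[X in _ = _ + X]vevZ -vevB -vevD.
have -> : l_v 1 ∘ l_v 2 = ev (xu 3) by rewrite xuE.
rewrite -[RHS]addr0 -(scaler0 _ (pev t (cst (8#3)))) -[X in _ + _ *: X]w0.
by rewrite -vevZ -vevD; apply: vev_eq; vm_compute.
Qed.

Lemma ev_prod_vv x p q : (p < 3)%N -> (q < 3)%N -> p != q ->
  let r := third p q in
  let s m := a (loc_index i j k m) false + a (loc_index i j k m) true in
  vev t (loc a i j k e x) (prod_vv p q) =
  (4^-1)%:e *: (l_v p + l_v q - l_v r) - ((2 / 3)%:e * t) *: (s p + s q)
  + (4 / 3)%:e *: (x r *+ 2 - x p - x q).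
Proof.
move=> p3 q3 pq r s; have r3 := third_lt3 p3 q3 pq.
have xuE n : vev t (loc a i j k e x) (xu n) = x n by exact: ev_xu.
have xvE n : (n < 3)%N -> vev t (loc a i j k e x) (xv n) = l_v n.
  by move=> n3; exact: ev_xv.
rewrite /prod_vv (negPf pq) -/r vevD vevB !vevZ vevB vevD.
rewrite (vevD _ _ (xs p)) !ev_xs // vevB vevB vevZ !xuE !xvE //.
rewrite !pev_cst (qev_inv V 4) (qev_frac V 4 3) (qev_nat V 2) scaler_nat.
congr (_ - _ *: _ + _).
by rewrite /= qev0 add0r mulr0 addr0 mulrC (qev_frac V 2 3).
Qed.
End Local.

Lemma v_prod i j k : i != j -> i != k -> j != k ->
  v i k ∘ v i j = (4^-1)%:e *: (v i k + v i j - v j k)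
  - ((2 / 3)%:e * t) *: (a j false + a j true + (a k false + a k true))
  + (4 / 3)%:e *: (u_4A i j k *+ 2 - u_4A j i k - u_4A k i j).
Proof.
move=> ij ik jk; rewrite -[LHS]/(loc_v a i j k 1 ∘ loc_v a i j k 2).
by rewrite (loc_v_prod12 false) // ev_prod_vv.
Qed.

Section LocalTable.
Variables (i j k : 'I_3) (e : bool).
Hypotheses (ij : i != j) (ik : i != k) (jk : j != k).
Local Notation l_a := (loc_a a i j k e).
Local Notation l_v := (loc_v a i j k).
Variable x : nat -> V.
Hypothesis xE : forall p, (p < 3)%N -> x p = loc_u i j k p.
Local Notation ev := (vev t (loc a i j k e x)).

Lemma loc_vv_prod p q : (p < 3)%N -> (q < 3)%N ->
  l_v p ∘ l_v q = ev (prod_vv p q).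
Proof.
have ji : j != i by rewrite eq_sym.
have ki : k != i by rewrite eq_sym.
have kj : k != j by rewrite eq_sym.
have prodC p' q' : (p' < 3)%N -> (q' < 3)%N ->
    ev (prod_vv p' q') = ev (prod_vv q' p').
  by move=> p3 q3; apply: vev_eq; case: p' q' p3 q3 => [|[|[|//]]] [|[|[|//]]];
    vm_compute.
suff lt : forall p' q', (p' < q')%N -> (q' < 3)%N ->
    l_v p' ∘ l_v q' = ev (prod_vv p' q').
  move=> p3 q3; case: (ltngtP p q) => [pq|qp|->]; first exact: lt.
    by rewrite fa_mulC prodC // lt.
  rewrite loc_vv // /prod_vv eqxx.
  by rewrite ev_xv.
move=> {p q} [|[|[|p]]] [|[|[|q]]] // _ _; rewrite ev_prod_vv // !xE // /third /=.
- rewrite /loc_v /loc_u /= (v_4AC _ j k) (v_4AC _ i k) v_prod //.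
  by rewrite (u_4AC i k j) (u_4AC j k i).
- by rewrite /loc_v /loc_u /= (v_4AC _ i j) (@v_prod j i k) // (u_4AC k j i).
- by rewrite /loc_v /loc_u /= (@v_prod i j k).
Qed.

(** The products of the first axis with the u's are still unknown; the additional coordinates 3, 4,
    5 name them. They are entered with the axis on the left only, and the computations multiply in
    that order. *)
Definition axis_table (n m : nat) : option tvec :=
  match symbol n, symbol m with
  | SA p d, SA q d' => Some (prod_aa p d q d')
  | SA p d, SV q | SV q, SA p d => Some (prod_av p d q)
  | SV p, SV q => Some (prod_vv p q)
  | SA p d, SU q =>
    if [&& p == 0%N, ~~ d & (q < 3)%N] then Some (xu (3 + q)) else None
  | _, _ => None
  end.

Hypothesis axE : forall q, (q < 3)%N -> x (3 + q)%N = l_a 0 false ∘ loc_u i j k q.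

Lemma axis_tableP n m w : axis_table n m = Some w ->
  loc a i j k e x n ∘ loc a i j k e x m = ev w.
Proof.
have av p d q : (p < 3)%N -> (q < 3)%N -> l_a p d ∘ l_v q = ev (prod_av p d q).
  move=> p3 q3; case: (eqVneq p q) => [<-|pq]; last exact: loc_av.
  rewrite loc_axis_v // /prod_av eqxx vevD vevZ pev_t ev_xa //.
  by rewrite [ev (xu p)]ev_xu xE.
rewrite /axis_table /loc; have := symbolP n; have := symbolP m.
case: (symbol n) => [p d|p|p]; case: (symbol m) => [q d'|q|q] q3 p3 //.
- by case=> <-; exact: loc_aa.
- by case=> <-; exact: av.
- case: ifP => // /and3P[/eqP -> /negPf -> q3'] [<-].
  by rewrite [ev _]ev_xu axE // xE.
- by rewrite fa_mulC => -[<-]; exact: av.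
- by case=> <-; exact: loc_vv_prod.
Qed.
End LocalTable.
End ForcedAxisProducts.

(** * Products of an axis with the u_i *)

Section ForcedAxisU.
Variables (K : realType) (V : formed_algebra K) (a : 'I_3 -> bool -> V).
Hypothesis aV : fusion_family a.
Local Notation "x ∘ y" := (@fa_mul K V x y) (at level 40, left associativity).
Local Notation "⟪ x , y ⟫" := (@fa_form K V x y) (at level 0).
Local Notation "c %:e" := (fa_emb V c) (at level 2, format "c %:e").
Local Notation t := (parameter a).
Implicit Types i j k : 'I_3.

Section Local.
Variables (i j k : 'I_3) (e : bool).
Hypotheses (ij : i != j) (ik : i != k) (jk : j != k).
Local Notation l_a := (loc_a a i j k e).
Local Notation l_u := (loc_u a i j k).

Definition loc_full (n : nat) : V := nth 0 [:: l_u 0; l_u 1; l_u 2;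
  l_a 0 false ∘ l_u 0; l_a 0 false ∘ l_u 1; l_a 0 false ∘ l_u 2] n.

Local Notation ev := (vev t (loc a i j k e loc_full)).

Let mulE u w z : vmul_eq axis_table u w z -> ev u ∘ ev w = ev z.
Proof.
apply: vmul_eqP => n m r; apply: axis_tableP => // [[|[|[|p]]]|[|[|[|p]]]] //.
Qed.

Definition v_form_table (n m : nat) : option tpoly :=
  match symbol n, symbol m with
  | SV p, SV q => Some (symbol_form (SV p) (SV q))
  | _, _ => av_form_table n m
  end.

Lemma v_form_tableP x n m r : v_form_table n m = Some r ->
  ⟪loc a i j k e x n, loc a i j k e x m⟫ = pev t r.
Proof.
move=> H; have := @av_form_tableP _ _ _ aV _ _ _ e ij ik jk x n m r.
move: H; rewrite /v_form_table /loc; have := symbolP n; have := symbolP m.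
case: (symbol n) => [p d|p|?]; case: (symbol m) => [q d'|q|?] q3 p3;
  try by move=> H0 /(_ H0).
case=> <- _; rewrite /symbol_form.
have ji : j != i by rewrite eq_sym.
have ki : k != i by rewrite eq_sym.
have kj : k != j by rewrite eq_sym.
case: eqVneq => [->|pq].
  rewrite pev_cst (qev_nat V 2).
  by case: q q3 => [|[|[|//]]] _; exact: (ff_form_vv aV).
case: p q p3 q3 pq => [|[|[|//]]] [|[|[|//]]] // _ _ _; rewrite /loc_v /=.
- by rewrite !(v_4AC _ _ k) form_vv.
- by rewrite (v_4AC _ i j) form_vv.
- by rewrite !(v_4AC _ _ k) form_vv.
- by rewrite form_vv.
- by rewrite (v_4AC _ i j) form_vv.
- by rewrite form_vv.
Qed.

(* Three products of the 0- and 1/4-eigenvectors of a_i in the two subalgebras of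
   type 4A; their images under a_i involve the a_i u_m linearly. *)
Lemma loc_axis_u q : (q < 3)%N -> l_a 0 false ∘ l_u q = ev (prod_au 0 false q).
Proof.
pose a0 := xa 0 false.
pose A1 := eig0 0 false 1; pose A2 := eig0 0 false 2.
pose B1 := eig4 0 1; pose B2 := eig4 0 2.
have a0E : ev a0 = a i e by rewrite ev_xa.
have q4 : qev V (Qmake 1 4) = (4^-1)%:e by exact: (qev_inv V 4).
have aA1 : a i e ∘ ev A1 = 0 by rewrite -a0E (mulE (z := [::])).
have aA2 : a i e ∘ ev A2 = 0 by rewrite -a0E (mulE (z := [::])).
have aB1 : a i e ∘ ev B1 = (4^-1)%:e *: ev B1.
  by rewrite -a0E -q4 -(pev_cst t) -vevZ; apply: mulE.
have aB2 : a i e ∘ ev B2 = (4^-1)%:e *: ev B2.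
  by rewrite -a0E -q4 -(pev_cst t) -vevZ; apply: mulE.
have H00 := ff_fusion00 aV aA1 aA2.
have H04 := ff_fusion04 aV aA1 aB2.
have H44 := ff_fusion44 aV aB1 aB2.
pose c := odflt [::] (vform v_form_table B1 B2).
have cE : ⟪ev B1, ev B2⟫ = pev t c.
  by apply: (vform_eqP (@v_form_tableP _)); vm_compute.
pose p00 := odflt [::] (vmul axis_table A1 A2).
pose p04 := odflt [::] (vmul axis_table A1 B2).
pose p44 := odflt [::] (vmul axis_table B1 B2).
have E00 : ev A1 ∘ ev A2 = ev p00 by apply: mulE; vm_compute.
have E04 : ev A1 ∘ ev B2 = ev p04 by apply: mulE; vm_compute.
have E44 : ev B1 ∘ ev B2 = ev p44 by apply: mulE; vm_compute.
pose w00 := odflt [::] (vmul axis_table a0 p00).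
pose w04 := odflt [::] (vmul axis_table a0 p04).
pose w44 := odflt [::] (vmul axis_table a0 p44).
have F00 : ev a0 ∘ ev p00 = ev w00 by apply: mulE; vm_compute.
have F04 : ev a0 ∘ ev p04 = ev w04 by apply: mulE; vm_compute.
have F44 : ev a0 ∘ ev p44 = ev w44 by apply: mulE; vm_compute.
rewrite {}E00 -a0E {}F00 in H00.
rewrite {}E04 -a0E {}F04 in H04.
rewrite (ff_assoc aV) aB1 fa_formZl {}cE {}E44 -a0E {}F44 in H44.
have R04 : ev (w04 - cst (1#4) *: p04)%tv = 0.
  by move: (w04) (p04) H04 => w p H; rewrite vevB vevZ pev_cst q4 H subrr.
have R44 : ev (w44 - pmul (cst (1#4)) c *: a0)%tv = 0.
  move: (w44) (c) H44 => w c' H.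
  by rewrite vevB vevZ pevM pev_cst q4 H subrr.
(* The three relations are linear in the three unknown products. The multipliers supplied below are
   the rows of the inverse of their coefficient matrix. *)
have comb (x y z : tvec) : ev x = 0 -> ev y = 0 -> ev z = 0 ->
    forall c1 c2 c3 (u w : tvec),
    veq u (w + (cst c1 *: x + cst c2 *: y + cst c3 *: z))%tv -> ev u = ev w.
  move=> x0 y0 z0 c1 c2 c3 u w /(vev_eq t (loc a i j k e loc_full)) ->.
  by rewrite vevD vevD vevD !vevZ x0 y0 z0 !scaler0 !addr0.
have {comb} H := comb _ _ _ H00 R04 R44.
have xuE n : ev (xu n) = loc_full n by exact: ev_xu.
case: q => [|[|[|//]]] _.
- transitivity (ev (xu 3)); first by rewrite xuE.
  by apply: (H (Qmake 3 16) (Qmake 0 1) (Qmake 3 16)); vm_compute.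
- transitivity (ev (xu 4)); first by rewrite xuE.
  by apply: (H (Qmake 0 1) (Qmake 3 16) (Qmake (-3) 16)); vm_compute.
- transitivity (ev (xu 5)); first by rewrite xuE.
  by apply: (H (Qmake 3 16) (Qmake (-3) 16) (Qmake 0 1)); vm_compute.
Qed.
End Local.
End ForcedAxisU.

(** * Values of the form on the u_i *)

Section ForcedForm.
Variables (K : realType) (V : formed_algebra K) (a : 'I_3 -> bool -> V).
Hypothesis aV : fusion_family a.
Local Notation "x ∘ y" := (@fa_mul K V x y) (at level 40, left associativity).
Local Notation "⟪ x , y ⟫" := (@fa_form K V x y) (at level 0).
Local Notation v := (v_4A a).
Local Notation t := (parameter a).
Local Notation u := (u_4A a).
Implicit Types i j k : 'I_3.

Lemma form_sym_u i j k : form_sym (u i j k).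
Proof.
apply: (form_symB (form_symM aV _ _) (form_symZ _ (form_sym_axis aV _ _))).
  exact: form_sym_axis.
exact: form_sym_v.
Qed.

Section Local.
Variables (i j k : 'I_3).
Hypotheses (ij : i != j) (ik : i != k) (jk : j != k).
Local Notation ev := (vev t (loc a i j k false (loc_full a i j k false))).

(** Moves the factor a_i of u_i to the other side, so that values on u_i reduce to values on v_(j,k)
    and a_i as soon as a_i x is known. *)
Lemma form_u x : ⟪u i j k, x⟫ = ⟪v j k, a i false ∘ x⟫ - t * ⟪a i false, x⟫.
Proof.
by rewrite /u_4A fa_formBl fa_formZl fa_mulC (ff_assoc aV).
Qed.

Definition full_table (n m : nat) : option tvec :=
  match symbol n, symbol m with
  | SA 0 false, SU q => if (q < 3)%N then Some (prod_au 0 false q) else None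
  | _, SU _ => None
  | _, _ => axis_table n m
  end.

Lemma full_tableP n m w : full_table n m = Some w ->
  loc a i j k false (loc_full a i j k false) n ∘
  loc a i j k false (loc_full a i j k false) m = ev w.
Proof.
move=> H.
have := @axis_tableP _ _ _ aV _ _ _ false ij ik jk (loc_full a i j k false).
have x1 p : (p < 3)%N -> loc_full a i j k false p = loc_u a i j k p.
  by case: p => [|[|[|p]]].
have x2 q : (q < 3)%N -> loc_full a i j k false (3 + q) =
    loc_a a i j k false 0 false ∘ loc_u a i j k q by case: q => [|[|[|p]]].
move=> /(_ x1 x2 n m w); move: H; rewrite /full_table.
case E: (symbol m) => [q d|q|q]; try by case: (symbol n) => [[|p] []|p|p] H /(_ H).
case E': (symbol n) => [[|p] []|p|p] //; case: ifP => // q3 [<-] _.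
rewrite {1 2}/loc E E' x1 //; exact: loc_axis_u.
Qed.

Lemma ev_u (q : nat) : (q < 3)%N -> ev (xu q) = loc_u a i j k q.
Proof. by move=> q3; rewrite [LHS]ev_xu; case: q q3 => [|[|[|]]]. Qed.

Definition form_u_check (G : nat -> nat -> option tpoly) (x : tvec) (p : tpoly) :=
  if vmul full_table (xa 0 false) x is Some y then
    match vform G (xv 0) y, vform G (xa 0 false) x with
    | Some r, Some s => peq (padd r (pmul (lint 0 (-1)) s)) p
    | _, _ => false
    end
  else false.

Lemma form_u_checkP G x p :
    (forall n m r, G n m = Some r ->
      ⟪loc a i j k false (loc_full a i j k false) n,
       loc a i j k false (loc_full a i j k false) m⟫ = pev t r) ->
  form_u_check G x p -> ⟪u i j k, ev x⟫ = pev t p.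
Proof.
move=> GP; rewrite /form_u_check; case Ey: vmul => [y|] //.
case Er: vform => [r|] //; case Es: vform => [s|] // /(pev_eq t) <-.
rewrite form_u pevD pevM -(vformP GP Er) -(vformP GP Es).
rewrite -(vmulP full_tableP Ey) ev_xa // ev_xv //; congr (_ + _).
by rewrite -mulNr /= qev0 qevN1 mulr0 addr0 add0r mulrN1.
Qed.

Let vP := @v_form_tableP _ _ _ aV _ _ _ false ij ik jk
  (loc_full a i j k false).

Lemma form_uai d : ⟪u i j k, a i d⟫ = 0.
Proof.
have -> : a i d = ev (xa 0 d) by rewrite ev_xa // /loc_a addbF.
by rewrite (form_u_checkP (p := [::]) vP) //; case: d; vm_compute.
Qed.

Lemma form_uaj d : ⟪u i j k, a j d⟫ = pev t (lint 0 (5#32)).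
Proof.
have -> : a j d = ev (xa 1 d) by rewrite ev_xa // /loc_a addbF.
by apply: (form_u_checkP vP); case: d; vm_compute.
Qed.

Lemma form_uvij : ⟪u i j k, v i j⟫ = pev t (lint 0 (-5#8)).
Proof.
have -> : v i j = ev (xv 2) by rewrite ev_xv.
by apply: (form_u_checkP vP); vm_compute.
Qed.

(** Idempotence of v gives <a v, v> = <a, v> = t, from which t <a, v> = t^2 is subtracted. *)
Lemma form_uvjk : ⟪u i j k, v j k⟫ = pev t (quadt 0 1 (-1)).
Proof.
rewrite /u_4A fa_formBl fa_formZl -(ff_assoc aV) (ff_vv aV) //.
rewrite form_av_parameter // /= !qev0 qev1 qevN1 mulr0 addr0 add0r.
by rewrite mulrDr mulr1 mulrN1 mulrN.
Qed.
End Local.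

Section LocalU.
Variables (i j k : 'I_3).
Hypotheses (ij : i != j) (ik : i != k) (jk : j != k).
Local Notation ev := (vev t (loc a i j k false (loc_full a i j k false))).

(** Only the rows of a_i (0) and v_(j,k) (6) are extended by values on the u's, since [form_u_check]
    pairs with these two vectors alone. *)
Definition uv_form_table (n m : nat) : option tpoly :=
  match n, m with
  | 6, 9 => Some (quadt 0 1 (-1))
  | 6, 10 => Some (lint 0 (-5#8))
  | 6, 11 => Some (lint 0 (-5#8))
  | 0, 9 => Some [::]
  | 0, 10 => Some (lint 0 (5#32))
  | 0, 11 => Some (lint 0 (5#32))
  | _, _ => v_form_table n m
  end%N.

Lemma uv_form_tableP n m r : uv_form_table n m = Some r ->
  ⟪loc a i j k false (loc_full a i j k false) n,
   loc a i j k false (loc_full a i j k false) m⟫ = pev t r.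
Proof.
have ji : j != i by rewrite eq_sym.
have ki : k != i by rewrite eq_sym.
have kj : k != j by rewrite eq_sym.
have [n0|n0] := eqVneq n 0%N.
  rewrite n0; case: m => [|[|[|[|[|[|[|[|[|[|[|[|m]]]]]]]]]]]];
    try exact: v_form_tableP.
  - case=> <-; rewrite [LHS](form_sym_axis aV) [LHS]form_uai //.
  - by case=> <-; rewrite [LHS](form_sym_axis aV) [LHS]form_uaj.
  - by case=> <-; rewrite [LHS](form_sym_axis aV) [LHS]form_uaj.
have [n6|n6] := eqVneq n 6%N.
  rewrite n6; case: m => [|[|[|[|[|[|[|[|[|[|[|[|m]]]]]]]]]]]];
    try exact: v_form_tableP.
  - by case=> <-; rewrite [LHS](form_sym_v aV) [LHS]form_uvjk.
  - case=> <-; rewrite [LHS](form_sym_v aV) -[LHS]/(⟪u j i k, v j k⟫).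
    by rewrite u_4AC form_uvij.
  - case=> <-; rewrite [LHS](form_sym_v aV) -[LHS]/(⟪u k i j, v j k⟫).
    by rewrite u_4AC v_4AC form_uvij.
suff -> : uv_form_table n m = v_form_table n m by exact: v_form_tableP.
by case: n n0 n6 => [|[|[|[|[|[|[|[|n]]]]]]]].
Qed.

Lemma form_uu : ⟪u i j k, u i j k⟫ = pev t (quadt 0 (1#4) (-1#4)).
Proof.
have {2}-> : u i j k = ev (xu 0) by rewrite ev_u.
by apply: (form_u_checkP _ _ _ uv_form_tableP) => //; vm_compute.
Qed.

Lemma form_uiuj : ⟪u i j k, u j i k⟫ = pev t (quadt 0 (1#16) (-7#32)).
Proof.
have -> : u j i k = ev (xu 1) by rewrite ev_u.
by apply: (form_u_checkP _ _ _ uv_form_tableP) => //; vm_compute.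
Qed.
End LocalU.
End ForcedForm.

(** * The span of the twelve elements is a subalgebra *)

Section ForcedClosure.
Variables (K : realType) (V : formed_algebra K) (a : 'I_3 -> bool -> V).
Local Notation v := (v_4A a).
Local Notation t := (parameter a).
Local Notation u := (u_4A a).
Implicit Types i j k : 'I_3.

(** The coefficient ring of M_4A is not known beforehand. This predicate and [in_span] depend on
    each other: closing the span under products requires the coefficients produced by the form to be
    polynomials in t, and these are computed on elements of the span. *)
Inductive in_Kt : fa_coef V -> Prop :=
  | Kt_emb c : in_Kt (fa_emb V c)
  | Kt_t : in_Kt t
  | Kt_add r s : in_Kt r -> in_Kt s -> in_Kt (r + s)
  | Kt_mul r s : in_Kt r -> in_Kt s -> in_Kt (r * s).

Definition basis_4A : nat -> V := loc a 0 1 2 false (loc_u a 0 1 2).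

Inductive in_span : V -> Prop :=
  | span_zero : in_span 0
  | span_lin c x y : in_Kt c -> in_span x -> in_span y -> in_span (c *: x + y)
  | span_basis n : (n < 12)%N -> in_span (basis_4A n).

Lemma Kt_zero : in_Kt 0. Proof. by rewrite -(rmorph0 (fa_emb V)); exact: Kt_emb. Qed.
Lemma Kt_one : in_Kt 1. Proof. by rewrite -(rmorph1 (fa_emb V)); exact: Kt_emb. Qed.
Lemma Kt_pev p : in_Kt (pev t p).
Proof.
elim: p => [|c p IH] /=; first exact: Kt_zero.
by apply: Kt_add; [exact: Kt_emb | apply: Kt_mul => //; exact: Kt_t].
Qed.

Lemma span_add x y : in_span x -> in_span y -> in_span (x + y).
Proof. by move=> Sx Sy; rewrite -[x]scale1r; apply: span_lin => //; exact: Kt_one. Qed.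
Lemma span_scale c x : in_Kt c -> in_span x -> in_span (c *: x).
Proof. by move=> Kc Sx; rewrite -[_ *: _]addr0; apply: span_lin => //; exact: span_zero. Qed.
Lemma span_opp x : in_span x -> in_span (- x).
Proof.
rewrite -scaleN1r -(rmorphN1 (fa_emb V)); apply: span_scale; exact: Kt_emb.
Qed.
Lemma span_sub x y : in_span x -> in_span y -> in_span (x - y).
Proof. by move=> Sx Sy; apply: span_add => //; exact: span_opp. Qed.

Lemma span_vev (b : nat -> V) w : (forall n, (n < size w)%N -> in_span (b n)) ->
  in_span (vev t b w).
Proof.
suff H m : (forall n, (n < m + size w)%N -> in_span (b n)) ->
    in_span (vev_from t b m w) by exact: (H 0%N).
elim: w m => [|p w IH] m /= H; first exact: span_zero.
apply: span_lin; first exact: Kt_pev.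
  by apply: H; rewrite addnS ltnS leq_addr.
by apply: IH => n nm; apply: H; rewrite addnS -addSn.
Qed.

Lemma span_a i e : in_span (a i e).
Proof.
have := @span_basis (i.*2 + e) (axis_index i e); rewrite /basis_4A.
rewrite -(vev_atom t) -[atom _]/(xa i e) ev_xa //.
suff -> : loc_a a 0 1 2 false i e = a i e by [].
by rewrite /loc_a /loc_sign andbF addbF /loc_index; case: (ord3P i) => ->.
Qed.

Lemma span_v i j : i != j -> in_span (v i j).
Proof.
have S n : (n < 3)%N -> in_span (loc_v a 0 1 2 n).
  move=> n3; have := @span_basis (6 + n); rewrite /basis_4A.
  rewrite -(vev_atom t) -[atom _]/(xv n) ev_xv //; apply.
  by case: n n3 => [|[|[|]]].
have := S 0%N isT; have := S 1%N isT; have := S 2%N isT; rewrite /loc_v /=.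
by case: (ord3P i) => ->; case: (ord3P j) => -> // ? ? ? _; rewrite // v_4AC.
Qed.

Lemma span_u i j k : i != j -> i != k -> j != k -> in_span (u i j k).
Proof.
have S n : (n < 3)%N -> in_span (loc_u a 0 1 2 n).
  move=> n3; have := @span_basis (9 + n); rewrite /basis_4A.
  rewrite -(vev_atom t) -[atom _]/(xu n) ev_xu; apply.
  by case: n n3 => [|[|[|]]].
have := S 0%N isT; have := S 1%N isT; have := S 2%N isT; rewrite /loc_u /=.
case: (ord3P i) => ->; case: (ord3P j) => ->; case: (ord3P k) => -> //;
  by move=> ? ? ? _ _ _; rewrite // u_4AC.
Qed.

Lemma other2 i : exists j k, [/\ i != j, i != k & j != k].
Proof.
by case: (ord3P i) => ->; [exists 1, 2|exists 0, 2|exists 0, 1].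
Qed.

Lemma ord3_cover i j k l : i != j -> i != k -> j != k ->
  [\/ l = i, l = j | l = k].
Proof.
case: (ord3P i) => ->; case: (ord3P j) => ->; case: (ord3P k) => -> // _ _ _;
  case: (ord3P l) => ->;
  by [constructor 1|constructor 2|constructor 3].
Qed.

Lemma loc_v_cover i j k l m : i != j -> i != k -> j != k -> l != m ->
  exists2 q, (q < 3)%N & v l m = loc_v a i j k q.
Proof.
move=> ij ik jk lm.
case: (ord3_cover l ij ik jk) => lE; case: (ord3_cover m ij ik jk) => mE;
  rewrite lE mE ?eqxx // in lm *.
- by exists 2.
- by exists 1.
- by exists 2 => //; rewrite v_4AC.
- by exists 0.
- by exists 1 => //; rewrite v_4AC.
- by exists 0 => //; rewrite v_4AC.
Qed.

Lemma loc_u_cover i j k l m n : i != j -> i != k -> j != k ->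
  l != m -> l != n -> m != n -> exists2 q, (q < 3)%N & u l m n = loc_u a i j k q.
Proof.
move=> ij ik jk lm ln mn.
case: (ord3_cover l ij ik jk) => lE; case: (ord3_cover m ij ik jk) => mE;
  case: (ord3_cover n ij ik jk) => nE; rewrite lE mE nE ?eqxx // in lm ln mn *.
- by exists 0.
- by exists 0 => //; rewrite u_4AC.
- by exists 1.
- by exists 1 => //; rewrite u_4AC.
- by exists 2.
- by exists 2 => //; rewrite u_4AC.
Qed.

(** Relabelling permutes the twelve elements, signs included, because v and u are symmetric in their
    last two indices and u_i does not depend on a sign. Any axis may thus be taken as the first
    one. *)
Lemma basis_loc i j k e n : i != j -> i != k -> j != k -> (n < 12)%N ->
  exists2 m, (m < 12)%N & basis_4A n = loc a i j k e (loc_u a i j k) m.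
Proof.
move=> ij ik jk n12; rewrite /basis_4A.
have Ha l d : exists2 m, (m < 12)%N & a l d = loc a i j k e (loc_u a i j k) m.
  have Hp p : (p < 3)%N -> loc_index i j k p = l ->
      exists2 m, (m < 12)%N & a l d = loc a i j k e (loc_u a i j k) m.
    move=> p3 pl; exists (p.*2 + (d (+) loc_sign e p))%N.
      by case: p p3 {pl} => [|[|[|//]]] _; case: addb.
    rewrite -(vev_atom t) -[atom _]/(xa p (d (+) loc_sign e p)) ev_xa //.
    by rewrite /loc_a pl addbK.
  case: (ord3_cover l ij ik jk) => lE.
  - exact: (Hp 0%N).
  - exact: (Hp 1%N).
  - exact: (Hp 2%N).
have Hv p : (p < 3)%N -> exists2 m, (m < 12)%N &
    loc_v a 0 1 2 p = loc a i j k e (loc_u a i j k) m.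
  have Hq l m : l != m -> exists2 m', (m' < 12)%N &
      v l m = loc a i j k e (loc_u a i j k) m'.
    move=> /(loc_v_cover ij ik jk)[q q3 ->]; exists (6 + q)%N.
      by case: q q3 => [|[|[|]]].
    by rewrite -[LHS](@ev_xv K V a i j k e t (loc_u a i j k)) // [LHS]vev_atom.
  by case: p => [|[|[|//]]] _; apply: Hq.
have Hu p : (p < 3)%N -> exists2 m, (m < 12)%N &
    loc_u a 0 1 2 p = loc a i j k e (loc_u a i j k) m.
  have Hq l m n' : l != m -> l != n' -> m != n' -> exists2 m', (m' < 12)%N &
      u l m n' = loc a i j k e (loc_u a i j k) m'.
    move=> lm ln mn; have [q q3 ->] := loc_u_cover ij ik jk lm ln mn.
    exists (9 + q)%N; first by case: q q3 => [|[|[|]]].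
    by rewrite -[LHS](@ev_xu K V a i j k e t (loc_u a i j k)) [LHS]vev_atom.
  by case: p => [|[|[|//]]] _; apply: Hq.
rewrite {1}/loc; have := symbolP n; case E: (symbol n) => [p d|p|m].
- by move=> _; exact: Ha.
- exact: Hv.
- by move=> nE; apply: Hu; rewrite -(ltn_add2l 9) -nE.
Qed.
End ForcedClosure.

(** * The Gram matrix of the twelve elements *)

Section ForcedGram.
Variables (K : realType) (V : formed_algebra K) (a : 'I_3 -> bool -> V).
Hypothesis aV : fusion_family a.
Local Notation "⟪ x , y ⟫" := (@fa_form K V x y) (at level 0).
Local Notation t := (parameter a).
Variables (i j k : 'I_3).
Hypotheses (ij : i != j) (ik : i != k) (jk : j != k).
Local Notation l_a := (loc_a a i j k false).
Local Notation l_v := (loc_v a i j k).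
Local Notation l_u := (loc_u a i j k).

Let ji : j != i. Proof. by rewrite eq_sym. Qed.
Let ki : k != i. Proof. by rewrite eq_sym. Qed.
Let kj : k != j. Proof. by rewrite eq_sym. Qed.

Lemma form_sym_loc_u p : (p < 3)%N -> form_sym (l_u p).
Proof. by case: p => [|[|[|//]]] _; exact: form_sym_u. Qed.

Lemma loc_form_ua p q d : (p < 3)%N -> (q < 3)%N ->
  ⟪l_u p, l_a q d⟫ = pev t (symbol_form (SU p) (SA q d)).
Proof.
have aE s : l_a s d = a (loc_index i j k s) d by rewrite /loc_a /loc_sign andbF addbF.
rewrite aE /loc_u /loc_index {aE}.
case: p q => [|[|[|//]]] [|[|[|//]]] _ _; rewrite [pev]lock /= -lock;
  first [exact: form_uai | exact: form_uaj | by rewrite u_4AC form_uaj].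
Qed.

Lemma loc_form_uv p q : (p < 3)%N -> (q < 3)%N ->
  ⟪l_u p, l_v q⟫ = pev t (symbol_form (SU p) (SV q)).
Proof.
rewrite /loc_u /loc_v.
case: p q => [|[|[|//]]] [|[|[|//]]] _ _ /=;
  first [exact: form_uvjk | exact: form_uvij | by rewrite u_4AC form_uvij
    | by rewrite v_4AC form_uvij | by rewrite u_4AC v_4AC form_uvij].
Qed.

Lemma loc_form_uu p q : (p < 3)%N -> (q < 3)%N ->
  ⟪l_u p, l_u q⟫ = pev t (symbol_form (SU p) (SU q)).
Proof.
rewrite /loc_u.
case: p q => [|[|[|//]]] [|[|[|//]]] _ _ /=;
  first [exact: form_uu | exact: form_uiuj
    | by rewrite (u_4AC a i j k) form_uiuj
    | by rewrite (u_4AC a j i k) form_uiuj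
    | by rewrite (u_4AC a k i j) form_uiuj
    | by rewrite (u_4AC a j i k) (u_4AC a k i j) form_uiuj
    | by rewrite (u_4AC a i j k) (u_4AC a k i j) form_uiuj].
Qed.

Lemma loc_form n m : (n < 12)%N -> (m < 12)%N ->
  ⟪loc a i j k false l_u n, loc a i j k false l_u m⟫ =
  pev t (symbol_form (symbol n) (symbol m)).
Proof.
move=> n12 m12.
have := @v_form_tableP _ _ _ aV _ _ _ false ij ik jk l_u n m.
rewrite /v_form_table /av_form_table /shape_form_table.
rewrite /loc; have := symbolP n; have := symbolP m.
case: (symbol n) => [p d|p|p] m3 n3; case: (symbol m) m3 => [q d'|q|q] m3.
- by apply.
- by move=> H; apply: H; rewrite /=; case: eqVneq.
- by move=> _; rewrite (form_sym_axis aV) loc_form_ua //; move: m12; rewrite m3 ltn_add2l.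
- by move=> H; apply: H; rewrite /= eq_sym; case: eqVneq.
- by apply.
- move=> _; rewrite -(form_sym_loc_u _) ?loc_form_uv //;
    by move: m12; rewrite m3 ltn_add2l.
- by move=> _; rewrite loc_form_ua //; move: n12; rewrite n3 ltn_add2l.
- by move=> _; rewrite loc_form_uv //; move: n12; rewrite n3 ltn_add2l.
- by move=> _; rewrite loc_form_uu //; [move: n12; rewrite n3 ltn_add2l
    |move: m12; rewrite m3 ltn_add2l].
Qed.
End ForcedGram.

Lemma form_tableE n m : (n < 12)%N -> (m < 12)%N ->
  form_table n m = Some (symbol_form (symbol n) (symbol m)).
Proof.
move=> n12 m12; rewrite /form_table n12 m12 /=; congr Some.
have -> : form_rows = [seq [seq symbol_form (symbol i) (symbol j) |
    j <- iota 0 12] | i <- iota 0 12] by vm_compute.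
by rewrite (nth_map 0%N) ?size_iota // (nth_map 0%N) ?size_iota // !nth_iota.
Qed.

Section BasisForm.
Variables (K : realType) (V : formed_algebra K) (a : 'I_3 -> bool -> V).
Hypothesis aV : fusion_family a.

Lemma basis_4A_form n m p : form_table n m = Some p ->
  fa_form (basis_4A a n) (basis_4A a m) = pev (parameter a) p.
Proof.
move=> nm; have [n12 m12] : (n < 12)%N /\ (m < 12)%N.
  by move: nm; rewrite /form_table; case: andP.
by move: nm; rewrite form_tableE // => -[<-]; exact: loc_form.
Qed.

Lemma in_Kt_form x y : in_span a x -> in_span a y -> in_Kt a (fa_form x y).
Proof.
move=> Sx Sy; elim: Sx => {x} [|c x x' Kc _ IH _ IH'|n n12].
- by rewrite fa_form0r; exact: Kt_zero.
- by rewrite fa_formDl fa_formZl; apply: Kt_add => //; exact: Kt_mul.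
elim: Sy => {y} [|c y y' Kc _ IH _ IH'|m m12].
- by rewrite fa_formr0; exact: Kt_zero.
- by rewrite fa_formDr fa_formZr; apply: Kt_add => //; exact: Kt_mul.
by rewrite (basis_4A_form (form_tableE n12 m12)); exact: Kt_pev.
Qed.
End BasisForm.

Section ForcedProductSpan.
Variables (K : realType) (V : formed_algebra K) (a : 'I_3 -> bool -> V).
Hypothesis aV : fusion_family a.
Local Notation "x ∘ y" := (@fa_mul K V x y) (at level 40, left associativity).
Local Notation "⟪ x , y ⟫" := (@fa_form K V x y) (at level 0).
Local Notation "c %:e" := (fa_emb V c) (at level 2, format "c %:e").
Local Notation v := (v_4A a).
Local Notation t := (parameter a).
Local Notation u := (u_4A a).
Local Notation S := (in_span a).
Implicit Types i j k : 'I_3.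

Lemma span_mul_ind x : (forall n, (n < 12)%N -> S (x ∘ basis_4A a n)) ->
  forall y, S y -> S (x ∘ y).
Proof.
move=> H y; elim=> {y} [|c y y' Kc _ IH _ IH'|n n12]; last exact: H.
  by rewrite fa_mulr0; exact: span_zero.
by rewrite fa_mulDr fa_mulZr; exact: span_lin.
Qed.

Section Local.
Variables (i j k : 'I_3) (e : bool).
Hypotheses (ij : i != j) (ik : i != k) (jk : j != k).

Let ji : j != i. Proof. by rewrite eq_sym. Qed.
Let ki : k != i. Proof. by rewrite eq_sym. Qed.
Let kj : k != j. Proof. by rewrite eq_sym. Qed.

Lemma span_loc_v p : (p < 3)%N -> S (loc_v a i j k p).
Proof. by case: p => [|[|[|//]]] _; exact: span_v. Qed.

Lemma span_loc_u p : (p < 3)%N -> S (loc_u a i j k p).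
Proof. by case: p => [|[|[|//]]] _; exact: span_u. Qed.

Lemma span_loc x n : (forall p, (p < 3)%N -> x p = loc_u a i j k p) ->
  (n < 12)%N -> S (loc a i j k e x n).
Proof.
move=> xE n12; rewrite /loc; have := symbolP n.
case: (symbol n) => [p d|p|p] p3; first exact: span_a.
  exact: span_loc_v.
have {}p3 : (p < 3)%N by move: n12; rewrite p3 ltn_add2l.
by rewrite xE //; exact: span_loc_u.
Qed.

Lemma span_ev x w : (forall p, (p < 3)%N -> x p = loc_u a i j k p) ->
  (size w <= 12)%N -> S (vev t (loc a i j k e x) w).
Proof.
by move=> xE w12; apply: span_vev => n nw; apply: span_loc => //; exact: leq_trans w12.
Qed.

Lemma loc_fullE p : (p < 3)%N -> loc_full a i j k e p = loc_u a i j k p.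
Proof. by case: p => [|[|[|]]]. Qed.

Lemma span_axis_basis n : (n < 12)%N -> S (a i e ∘ basis_4A a n).
Proof.
move=> n12; have [m m12 ->] := basis_loc a e ij ik jk n12; rewrite /loc.
have := symbolP m; case: (symbol m) => [q d|q|q] q3.
- rewrite -[a i e]/(loc_a a i j k e 0 false).
  rewrite (loc_aa aV e ij ik jk t (loc_u a i j k)) //.
  by apply: span_ev => //; case: q q3 d => [|[|[|]]] // _ [].
- have [->|q0] := eqVneq q 0%N.
    rewrite -[a i e]/(loc_a a i j k e 0 false).
    rewrite loc_axis_v //; apply: span_add.
      by apply: span_scale; [exact: Kt_t | exact: span_a].
    exact: span_loc_u.
  rewrite -[a i e]/(loc_a a i j k e 0 false).
  rewrite (loc_av aV e ij ik jk t (loc_u a i j k)) //; last by rewrite eq_sym.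
  by apply: span_ev => //; case: q q3 q0 => [|[|[|]]].
have {}q3 : (q < 3)%N by move: m12; rewrite q3 ltn_add2l.
rewrite -[a i e]/(loc_a a i j k e 0 false) loc_axis_u //.
by apply: span_ev => //; [exact: loc_fullE | case: q q3 => [|[|[|]]]].
Qed.
End Local.

Lemma span_axis_mul i e x : S x -> S (a i e ∘ x).
Proof.
have [j [k [ij ik jk]]] := other2 i.
by apply: span_mul_ind => n; exact: span_axis_basis jk n.
Qed.

(* The resurrection principle: [A] and [B] lie in the 0- and 1/4-eigenspaces of
   the axis and multiplication by [A - B] preserves the span. *)
Lemma span_resurrection i e A B c z0 z4 :
    a i e ∘ A = 0 -> a i e ∘ B = (4^-1)%:e *: B -> S B ->
    (forall x, S x -> S (x ∘ (A - B))) ->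
    a i e ∘ z0 = 0 -> a i e ∘ z4 = (4^-1)%:e *: z4 -> S z0 -> S z4 ->
  S ((c *: a i e + z0 + z4) ∘ A).
Proof.
move=> aA aB SB SD az0 az4 Sz0 Sz4.
rewrite !fa_mulDl fa_mulZl aA scaler0 add0r.
have K4 : in_Kt a (4%:R)%:e by exact: Kt_emb.
have e4 (x : V) : (4%:R)%:e *: ((4^-1)%:e *: x) = x.
  by rewrite scalerA mulrC embK ?scale1r // pnatr_eq0.
apply: span_add.
  (* As a (z0 A) = 0 and a (z0 B) = z0 B/4, one gets z0 B = -4 a (z0 (A - B)). *)
  have S0B : S (z0 ∘ B).
    rewrite -[z0 ∘ B]e4 -(ff_fusion04 aV az0 aB) -[_ ∘ _]opprK.
    have -> : - (a i e ∘ (z0 ∘ B)) = a i e ∘ (z0 ∘ (A - B)).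
      by rewrite fa_mulBr fa_mulBr (ff_fusion00 aV az0 aA) sub0r.
    apply: span_scale => //; apply: span_opp; apply: span_axis_mul; exact: SD.
  have -> : z0 ∘ A = z0 ∘ (A - B) + z0 ∘ B by rewrite fa_mulBr subrK.
  by apply: span_add => //; exact: SD.
(* Similarly z4 A = 4 a (z4 A), and a (z4 A) = a (z4 (A - B)) + <a, z4 B> a. *)
have az4A : a i e ∘ (z4 ∘ A) = (4^-1)%:e *: (z4 ∘ A).
  by rewrite fa_mulC [z4 ∘ A]fa_mulC fa_mulC (ff_fusion04 aV aA az4).
rewrite -[z4 ∘ A]e4 -az4A; apply: span_scale => //.
have -> : a i e ∘ (z4 ∘ A) = a i e ∘ (z4 ∘ (A - B))
    + ⟪a i e, z4 ∘ B⟫ *: a i e.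
  by rewrite [z4 ∘ (A - B)]fa_mulBr [in RHS]fa_mulBr (ff_fusion44 aV az4 aB) subrK.
apply: span_add; first by apply: span_axis_mul; exact: SD.
apply: span_scale; last exact: span_a.
rewrite (ff_assoc aV) az4 fa_formZl; apply: Kt_mul; first exact: Kt_emb.
exact: in_Kt_form.
Qed.

Section LocalProducts.
Variables (i j k : 'I_3).
Hypotheses (ij : i != j) (ik : i != k) (jk : j != k).
Local Notation ev := (vev t (loc a i j k false (loc_full a i j k false))).
Local Notation l_a := (loc_a a i j k false).
Local Notation l_u := (loc_u a i j k).

Let mulE x y z : vmul_eq full_table x y z -> ev x ∘ ev y = ev z.
Proof. exact: (vmul_eqP (full_tableP aV ij ik jk)). Qed.

Let a0E : ev (xa 0 false) = a i false. Proof. by rewrite ev_xa. Qed.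

Let q4 : qev V (Qmake 1 4) = (4^-1)%:e. Proof. exact: (qev_inv V 4). Qed.

Let Sev w : (size w <= 12)%N -> S (ev w).
Proof. by apply: span_ev => // p; exact: loc_fullE. Qed.

(** No 1/32-component occurs: after subtraction of <a_i, u_q> a_i, applying 4 a_i isolates the
    1/4-component [y], and what remains is annihilated by a_i. *)
Lemma loc_u_eigen q : (q < 3)%N -> exists c z0 z4,
  [/\ l_u q = c *: a i false + z0 + z4, a i false ∘ z0 = 0,
      a i false ∘ z4 = (4^-1)%:e *: z4, S z0 & S z4].
Proof.
move=> q3; pose s := symbol_form (SA 0 false) (SU q).
pose p := (xu q - s *: xa 0 false)%tv.
pose y := (cst 4 *: odflt [::] (vmul full_table (xa 0 false) p))%tv.
have ay : ev (xa 0 false) ∘ ev y = ev (cst (1#4) *: y)%tv.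
  by apply: mulE; rewrite /y /p /s; clear y p s; case: q q3 => [|[|[|//]]] _; vm_compute.
have ap : ev (xa 0 false) ∘ ev (p - y)%tv = ev [::].
  by apply: mulE; rewrite /y /p /s; clear ay y p s; case: q q3 => [|[|[|//]]] _; vm_compute.
have sz : (size y <= 12)%N && (size (p - y)%tv <= 12)%N.
  by rewrite /y /p /s; clear ap ay y p s; case: q q3 => [|[|[|//]]] _; vm_compute.
have uE : l_u q = ev (s *: xa 0 false + (p - y) + y)%tv.
  rewrite -(ev_u _ _ _ _ q3); apply: vev_eq.
  by rewrite /y /p /s; clear sz ap ay y p s; case: q q3 => [|[|[|//]]] _; vm_compute.
clearbody y; move: (p - y)%tv uE ap sz => z0 uE a0 /andP[sz4 sz0].
exists (pev t s), (ev z0), (ev y); split; try exact: Sev.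
- by rewrite uE vevD vevD vevZ a0E.
- by rewrite -a0E a0.
- by rewrite -a0E ay vevZ pev_cst q4.
Qed.

(** The two eigenvectors of a_i in the subalgebra of a_i and a_j contain v_(i,j) with the same
    coefficient. Their difference is a combination of axes, which preserves the span, so
    resurrection applies. *)
Lemma span_vu q : (q < 3)%N -> S (l_u q ∘ v i j).
Proof.
move=> q3; have [c [z0 [z4 [uE az0 az4 Sz0 Sz4]]]] := loc_u_eigen q3.
pose A := eig0 0 false 1; pose B := eig4 0 1.
have SA : S (l_u q ∘ ev A).
  rewrite uE; apply: (@span_resurrection _ _ _ (ev B)) => //.
  - by rewrite -a0E (mulE (z := [::])).
  - by rewrite -a0E -q4 -(pev_cst t) -vevZ; apply: mulE.
  - exact: Sev.
  - move=> x Sx.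
    have -> : ev A - ev B = ev (cst (8#3) *: xs 1
       + cst (-1#6) *: xa 0 false + cst (1#3) *: xa 0 true)%tv.
      by rewrite -vevB; apply: vev_eq; vm_compute.
    rewrite !vevD !vevZ vevD !ev_xa // !(fa_mulDr x, fa_mulZr x).
    by do ?[apply: span_add | apply: span_scale | exact: Kt_pev];
       rewrite fa_mulC; exact: span_axis_mul.
have -> : v i j = ev A - (pev t (cst 2) *: (l_a 1 false + l_a 1 true)
    - pev t (cst (1#2)) *: l_a 0 false).
  rewrite /A /eig0 vevB vevD !vevZ vevD !ev_xa // ev_xv //.
  by rewrite -[X in _ = X - _]addrA addrK.
rewrite fa_mulBr; apply: span_sub => //.
rewrite !(fa_mulBr, fa_mulZr) (fa_mulDr _ (l_a 1 false)).
by do ?[apply: span_sub | apply: span_add | apply: span_scale | exact: Kt_pev];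
  rewrite fa_mulC; apply: span_axis_mul; exact: span_loc_u.
Qed.
End LocalProducts.

Lemma span_vv i j k l : i != j -> k != l -> S (v i j ∘ v k l).
Proof.
move=> ij kl; have [m im jm] : exists2 m, i != m & j != m.
  by move: ij; case: (ord3P i) => ->; case: (ord3P j) => -> // _;
    [exists 2|exists 1|exists 2|exists 0|exists 1|exists 0].
have [q q3 ->] := loc_v_cover a ij im jm kl.
rewrite -[v i j]/(loc_v a i j m 2) (@loc_vv_prod _ _ _ aV _ _ _ false ij im jm (loc_u a i j m)) //.
by apply: span_ev => //; case: q q3 => [|[|[|]]].
Qed.

Lemma span_v_mul i j x : i != j -> S x -> S (v i j ∘ x).
Proof.
move=> ij; apply: span_mul_ind => n n12.
have [m im jm] : exists2 m, i != m & j != m.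
  by move: ij; case: (ord3P i) => ->; case: (ord3P j) => -> // _;
    [exists 2|exists 1|exists 2|exists 0|exists 1|exists 0].
have [p p12 ->] := basis_loc a false ij im jm n12; rewrite /loc fa_mulC.
have := symbolP p; case: (symbol p) => [q d|q|q] q3.
- by apply: span_axis_mul; exact: span_v.
- by case: q q3 => [|[|[|//]]] _; apply: span_vv => //; rewrite eq_sym.
- by apply: span_vu => //; move: p12; rewrite q3 ltn_add2l.
Qed.

(** Resurrection with the 0-eigenvector v_(j,k) - t a_i - 4 u_i and the 1/4-eigenvector -4 u_i.
    Their difference v_(j,k) - t a_i preserves the span only because products with v have already
    been treated. *)
Lemma span_uu i j k q : i != j -> i != k -> j != k -> (q < 3)%N ->
  S (loc_u a i j k q ∘ u i j k).
Proof.
move=> ij ik jk q3; have [c [z0 [z4 [uE az0 az4 Sz0 Sz4]]]] := loc_u_eigen ij ik jk q3.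
have Su : S (u i j k) by exact: span_u.
have au : a i false ∘ u i j k = (4^-1)%:e *: u i j k.
  have := loc_axis_u aV false ij ik jk (isT : (0 < 3)%N).
  rewrite -[prod_au _ _ _]/(cst (1#4) *: xu 0)%tv vevZ ev_u //.
  by rewrite pev_cst (qev_inv V 4).
have K4 : in_Kt a (4%:R)%:e by exact: Kt_emb.
pose A := v j k - t *: a i false - (4%:R)%:e *: u i j k.
pose B := - ((4%:R)%:e *: u i j k).
have e4 (x : V) : (4%:R)%:e *: ((4^-1)%:e *: x) = x.
  by rewrite scalerA mulrC embK ?scale1r // pnatr_eq0.
have aA : a i false ∘ A = 0.
  rewrite /A (fa_mulBr (a i false) (v j k - _)) (fa_mulBr (a i false) (v j k)).
  rewrite !(fa_mulZr (a i false)) au e4 axis_v //.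
  by rewrite (ff_idem aV) -[LHS]addrA -opprD subrr.
have AD : A - B = v j k - t *: a i false by rewrite /A /B opprK subrK.
have SD x : S x -> S (x ∘ (v j k - t *: a i false)).
  move=> Sx; rewrite fa_mulC fa_mulBl fa_mulZl; apply: span_sub.
    exact: span_v_mul.
  by apply: span_scale; [exact: Kt_t | exact: span_axis_mul].
have SA : S (loc_u a i j k q ∘ A).
  rewrite uE; apply: (@span_resurrection _ _ A B) => //.
  - by rewrite /B fa_mulNr fa_mulZr au scalerN !scalerA mulrC.
  - by apply: span_opp; exact: span_scale.
  - by rewrite AD.
have -> : u i j k = (4^-1)%:e *: ((v j k - t *: a i false) - A).
  rewrite /A opprB [_ - _ + _]addrC subrK scalerA embK ?scale1r //.
  by rewrite pnatr_eq0.
rewrite fa_mulZr; apply: span_scale; first exact: Kt_emb.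
rewrite fa_mulBr; apply: span_sub => //; apply: SD.
exact: span_loc_u.
Qed.

Lemma span_u_mul i j k x : i != j -> i != k -> j != k -> S x ->
  S (u i j k ∘ x).
Proof.
move=> ij ik jk; apply: span_mul_ind => n n12.
have [p p12 ->] := basis_loc a false ij ik jk n12; rewrite /loc fa_mulC.
have Su : S (u i j k) by exact: span_u.
have := symbolP p; case: (symbol p) => [q d|q|q] q3.
- exact: span_axis_mul.
- by case: q q3 => [|[|[|//]]] _; exact: span_v_mul.
- by apply: span_uu => //; move: p12; rewrite q3 ltn_add2l.
Qed.

Lemma span_mul x y : S x -> S y -> S (x ∘ y).
Proof.
move=> Sx; apply: span_mul_ind => n n12; rewrite fa_mulC.
rewrite /basis_4A /loc; have := symbolP n.
case: (symbol n) => [p d|p|p] p3; first exact: span_axis_mul.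
  by case: p p3 => [|[|[|//]]] _; exact: span_v_mul.
have {}p3 : (p < 3)%N by move: n12; rewrite p3 ltn_add2l.
by case: p p3 => [|[|[|//]]] _; exact: span_u_mul.
Qed.
End ForcedProductSpan.

(** * The algebra M(t) *)

Section ModelBasis4A.
Variables (K : realType) (V : formed_algebra K) (t : fa_coef V) (b : nat -> V).
Hypothesis bV : model_basis t b.
Local Notation a := (axis_family b).

Lemma model_v_4A (i j : 'I_3) : i != j -> v_4A a i j = b (6 + third i j).
Proof.
by move=> /(model_type_4A bV)/type_4A_v <-; rewrite [LHS]vev_atom.
Qed.

Lemma model_parameter : parameter a = t.
Proof.
rewrite /parameter model_v_4A // /axis_family.
rewrite (mb_form bV (p := lint 0 1)) // /=.
by rewrite qev0 qev1 mulr0 addr0 add0r mulr1.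
Qed.

Lemma model_u_4A (i j k : 'I_3) : i != j -> i != k -> j != k ->
  u_4A a i j k = b (9 + i).
Proof.
move=> ij ik jk; rewrite /u_4A model_v_4A // model_parameter /axis_family.
have -> : third j k = i.
  by case: (ord3P i) ij ik => ->; case: (ord3P j) jk => ->; case: (ord3P k) => ->.
rewrite addn0 (mb_mul bV (v := prod_av i false i)); last first.
  by case: (ord3P i) => ->.
rewrite /prod_av eqxx vevD vevZ /= !vev_atom addn0 /= qev0 qev1.
by rewrite mulr0 addr0 add0r mulr1 addrC addKr.
Qed.

(** In the model, the elements built from the axes by the formulas for v and u are the basis
    vectors, so evaluation carries the spanning family of M_4A onto a free one. *)
Lemma model_basis_4A n : (n < 12)%N -> basis_4A a n = b n.
Proof.
do 12?[case: n => [_|n]]; rewrite // /basis_4A /loc /loc_a /loc_v /loc_u /=;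
  rewrite ?model_v_4A ?model_u_4A //.
Qed.
End ModelBasis4A.

Section SemilinearBasis.
Variables (K : realType) (V W : formed_algebra K).
Variables (g : fa_coef V -> fa_coef W) (f : V -> W).
Hypothesis f0 : f 0 = 0.
Hypothesis fP : forall c u v, f (c *: u + v) = g c *: f u + f v.
Hypothesis f_mul : forall u v, f (fa_mul u v) = fa_mul (f u) (f v).
Hypothesis f_form : forall u v, g (fa_form u v) = fa_form (f u) (f v).
Hypothesis g_emb : forall c, g (fa_emb V c) = fa_emb W c.
Variable a : 'I_3 -> bool -> V.
Local Notation fa := (fun i e => f (a i e)).

Let fD u v : f (u + v) = f u + f v.
Proof. by rewrite -[u]scale1r fP -(rmorph1 (fa_emb V)) g_emb !rmorph1 !scale1r. Qed.
Let fZ c u : f (c *: u) = g c *: f u.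
Proof. by rewrite -[c *: u]addr0 fP f0 addr0. Qed.
Let fB u v : f (u - v) = f u - f v.
Proof.
by rewrite -scaleN1r fD fZ -(rmorphN1 (fa_emb V)) g_emb rmorphN1 scaleN1r.
Qed.

Lemma semilinear_v_4A i j : f (v_4A a i j) = v_4A fa i j.
Proof. by rewrite /v_4A fB !fD !fZ f_mul fD !g_emb. Qed.

Lemma semilinear_parameter : g (parameter a) = parameter fa.
Proof. by rewrite /parameter f_form semilinear_v_4A. Qed.

Lemma semilinear_u_4A i j k : f (u_4A a i j k) = u_4A fa i j k.
Proof.
by rewrite /u_4A fB fZ f_mul semilinear_v_4A semilinear_parameter.
Qed.

Lemma semilinear_basis_4A n : f (basis_4A a n) = basis_4A fa n.
Proof.
rewrite /basis_4A /loc; case: (symbol n) => [p d|p|p] //.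
  by case: p => [|[|[|p]]]; rewrite /loc_v /= ?nth_nil ?semilinear_v_4A.
by case: p => [|[|[|p]]]; rewrite /loc_u /= ?nth_nil ?semilinear_u_4A.
Qed.
End SemilinearBasis.

Lemma emb_comb (K : realType) (V : formed_algebra K) (b : nat -> V) k
    (c d : nat -> K) :
  fa_emb V k *: (\sum_(n < 12) fa_emb V (c n) *: b n) +
    \sum_(n < 12) fa_emb V (d n) *: b n =
  \sum_(n < 12) fa_emb V (k * c n + d n) *: b n.
Proof.
rewrite scaler_sumr -big_split; apply: eq_bigr => n _.
by rewrite rmorphD rmorphM scalerDl scalerA.
Qed.

Lemma emb_comb_atom (K : realType) (V : formed_algebra K) (b : nat -> V) m :
  (m < 12)%N -> \sum_(n < 12) fa_emb V (n == m :> nat)%:R *: b n = b m.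
Proof.
move=> m12; rewrite (bigD1 (Ordinal m12)) //= eqxx.
rewrite rmorph1 scale1r big1 ?addr0 // => n.
by rewrite -val_eqE /= => /negPf ->; rewrite rmorph0 scale0r.
Qed.

Section Specialisation.
Variables (K : realType) (t : K).
Local Notation hat := (hat_algebra K).
Local Notation P := (pair_4A K).
Local Notation a := (marked P).
Local Notation Q := (scalar_pair (t_4A K - fa_emb (M_4A K) t)).
Local Notation hat_basis := (basis_4A (fun i e => hat_gen K i e : hat)).

Let aV : fusion_family a. Proof. exact: M_4A_fusion_family. Qed.

Lemma span_magma x : in_span a (qM P (hat_elt K x)).
Proof.
elim/magma_ind: x => [i e|x y Sx Sy]; first exact: span_a.
by rewrite -hat_mul_elt qM_mul; exact: span_mul.
Qed.

(** The coefficient ring is generated over K by the images of the indeterminates. These are values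
    of the form on images of magma elements, which lie in the span. *)
Lemma in_Kt_coef (r : fa_coef (M_4A K)) : in_Kt a r.
Proof.
move: r; apply: (@qRW _ _ P) => r.
elim/hatR_ind: r => [c|r s|r s|x y].
- exact: Kt_emb.
- by move=> Kr Ks; rewrite qRD; exact: Kt_add.
- by move=> Kr Ks; rewrite qRM; exact: Kt_mul.
- rewrite -hat_form_elt qM_form.
  apply: in_Kt_form => //; exact: span_magma.
Qed.

Lemma in_span_all (u : M_4A K) : in_span a u.
Proof.
move: u; apply: (@qMW _ _ P) => u; elim/hat_ind: u => [|c u v Su Sv|x].
- by rewrite qM0; exact: span_zero.
- by rewrite qMP; apply: span_lin => //; exact: in_Kt_coef.
- exact: span_magma.
Qed.

Definition M_basis n : M t := qM Q (basis_4A a n).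

Lemma M_parameter : qR Q (parameter a) = fa_emb (M t) t.
Proof.
have t_in : t_4A K - fa_emb (M_4A K) t \in idealR Q.
  by apply/asboolP; exists 1; rewrite mulr1.
exact: (proj2 (@qR_eq _ _ Q (t_4A K) (fa_emb (M_4A K) t)) t_in).
Qed.

(** The coefficients are polynomials in the parameter, and the parameter has become the real number
    t. *)
Lemma M_coef (r : fa_coef (M t)) : exists c, r = fa_emb (M t) c.
Proof.
move: r; apply: (@qRW _ _ Q) => r.
elim: (in_Kt_coef r) => {r} [c||r s _ [c rE] _ [d sE]|r s _ [c rE] _ [d sE]].
- by exists c.
- by exists t; exact: M_parameter.
- by exists (c + d); rewrite qRD rE sE rmorphD.
- by exists (c * d); rewrite qRM rE sE rmorphM.
Qed.

Lemma M_span (u : M t) : exists c : nat -> K,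
  u = \sum_(n < 12) fa_emb (M t) (c n) *: M_basis n.
Proof.
move: u; apply: (@qMW _ _ Q) => u.
elim: (in_span_all u) => {u} [|r x y _ _ [c xE] _ [d yE]|m m12].
- exists (fun=> 0); rewrite qM0 big1 // => n _.
  by rewrite rmorph0 scale0r.
- have [k kE] := M_coef (qR Q r).
  exists (fun n => k * c n + d n); apply: etrans (@qMP _ _ Q r x y) _.
  by rewrite kE xE yE; exact: emb_comb.
- by exists (fun n => (n == m)%:R); apply/esym; exact: (emb_comb_atom M_basis).
Qed.

Lemma M_basis_form n m p : form_table n m = Some p ->
  fa_form (M_basis n) (M_basis m) = pev (fa_emb (M t) t) p.
Proof.
move=> nm; rewrite -qM_form (basis_4A_form aV nm) qR_pev.
by rewrite M_parameter.
Qed.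

Let hat_t : fa_coef hat := parameter (fun i e => hat_gen K i e : hat).

Let qM_basis n : qM P (hat_basis n) = basis_4A a n.
Proof.
exact: (@semilinear_basis_4A _ _ _ (@qR _ _ P) (@qM _ _ P) (@qM0 _ _ P)
  (@qMP _ _ P) (@qM_mul _ _ P) (@qM_form _ _ P) (@qR_emb _ _ P)).
Qed.

Let qR_t : qR P hat_t = parameter a.
Proof.
exact: (@semilinear_parameter _ _ _ (@qR _ _ P) (@qM _ _ P) (@qM0 _ _ P)
  (@qMP _ _ P) (@qM_mul _ _ P) (@qM_form _ _ P) (@qR_emb _ _ P)).
Qed.

Let eval_gens : (fun i e => eval_hatM t (hat_gen K i e)) =
  axis_family (coord_vec K : nat -> concrete_model t).
Proof. by apply/funext => i; apply/funext => e; exact: eval_hat_gen. Qed.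

Let eval_t : eval_hatR t hat_t = t.
Proof.
rewrite (@semilinear_parameter _ hat (concrete_model t) (@eval_hatR K t)
  (@eval_hatM K t) (@eval_hatM0 _ t) (@eval_hatMP _ t) (@eval_hat_mul _ t)
  (@eval_hat_form _ t) (@eval_hatRC _ t)).
by rewrite eval_gens (model_parameter (concrete_modelP t)).
Qed.

Let eval_basis n : (n < 12)%N ->
  eval_hatM t (hat_basis n) = (coord_vec K n : concrete_model t).
Proof.
move=> n12.
rewrite (@semilinear_basis_4A _ hat (concrete_model t) (@eval_hatR K t)
  (@eval_hatM K t) (@eval_hatM0 _ t) (@eval_hatMP _ t) (@eval_hat_mul _ t)
  (@eval_hat_form _ t) (@eval_hatRC _ t)).
by rewrite eval_gens (model_basis_4A (concrete_modelP t)).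
Qed.

Let t_4AE : t_4A K - fa_emb (M_4A K) t = qR P (hat_t - fa_emb hat t).
Proof.
have qRB r s : qR P (r - s) = qR P r - qR P s.
  exact: (raddfB \pi_(quotR P)).
by rewrite qRB qR_t.
Qed.

(** Lifted to the free algebra, the relation says that x - ([hat_t] - t) y lies in the ideal of M_4A
    for some y. Evaluation at t annihilates this ideal and also [hat_t] - t, so x evaluates to 0,
    which is a relation between the basis vectors of the model. *)
Lemma M_free (c : nat -> K) :
    \sum_(n < 12) fa_emb (M t) (c n) *: M_basis n = 0 ->
  forall n, (n < 12)%N -> c n = 0.
Proof.
move=> c0; pose x : hat := \sum_(n < 12) fa_emb hat (c n) *: hat_basis n.
have xE : qM P x = \sum_(n < 12) fa_emb (M_4A K) (c n) *: basis_4A a n.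
  rewrite /x qM_sum; apply: eq_bigr => n _.
  by rewrite qMZ; congr (_ *: _); exact: qM_basis.
have : qM Q (qM P x) = 0.
  rewrite -c0 xE; apply: etrans (@qM_sum _ _ Q _ _ _ _) _.
  by apply: eq_bigr => n _; exact: (@qMZ _ _ Q).
move=> /(proj1 (@qM_eq0 _ _ Q _))/asboolW[y].
rewrite t_4AE; move: y; apply: (@qMW _ _ P) => y xy.
have /eval_pair_4A : x - (hat_t - fa_emb hat t) *: y \in idealM P.
  by apply/(@qM_eq _ _ P); rewrite [qM P x]xy; apply/esym; exact: (@qMZ _ _ P).
move=> /(_ t); rewrite eval_hatMB eval_hatMZ eval_hatRB eval_t eval_hatRC.
rewrite subrr scale0r subr0 /x => x0.
apply: (mb_free (concrete_modelP t)).
rewrite -[RHS]x0 [RHS](big_morph _ (@eval_hatMD _ t) (@eval_hatM0 _ t)).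
by apply: eq_bigr => n _; rewrite eval_hatMZ eval_hatRC eval_basis.
Qed.
End Specialisation.

(** * The form of M(t) as a real quadratic form *)

Section Gram.
Variables (K : realType) (t : K).

Definition gram (n m : nat) : K :=
  foldr (fun c x => qval K c + t * x) 0 (symbol_form (symbol n) (symbol m)).

Lemma pev_emb (V : formed_algebra K) p :
  pev (fa_emb V t) p = fa_emb V (foldr (fun c x => qval K c + t * x) 0 p).
Proof.
elim: p => [|c p IH] /=; first by rewrite rmorph0.
by rewrite IH rmorphD rmorphM.
Qed.

Definition quad_form (c : nat -> K) : K :=
  \sum_(n < 12) \sum_(m < 12) c n * (c m * gram n m).

Lemma M_form (c : nat -> K) :
  let u := \sum_(n < 12) fa_emb (M t) (c n) *: M_basis t n in
  fa_form u u = fa_emb (M t) (quad_form c).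
Proof.
move=> u; rewrite /u fa_form_suml /quad_form rmorph_sum.
apply: eq_bigr => n _; rewrite fa_form_sumr rmorph_sum.
apply: eq_bigr => m _; rewrite fa_formZl fa_formZr.
rewrite (M_basis_form t (form_tableE (ltn_ord n) (ltn_ord m))) pev_emb.
by rewrite !rmorphM.
Qed.
End Gram.

(** * Decomposition under the symmetries *)

Section Decomposition.
Variable K : realType.

Definition form3 (A B C D E F x y z : K) : K :=
  A * x ^+ 2 + D * y ^+ 2 + F * z ^+ 2 + 2 * B * x * y + 2 * C * x * z + 2 * E * y * z.

(** The variables are the coefficients of a_i + a_{-i}, v_i and u_i. If two of these families have
    form value alpha for equal and beta for distinct indices, the entry is alpha + 2 beta here and
    alpha - beta in [std_form]; for instance 2 + 2/8 = 9/4 and 2 - 1/8 = 15/8. *)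
Definition triv_form (t : K) : K -> K -> K -> K :=
  form3 (9 / 4) (3 / 2 + 2 * t) (5 / 8 * t) (3 - 16 / 3 * t)
    (- (t / 4) - t ^+ 2) (3 / 8 * t - 11 / 16 * t ^+ 2).

Definition std_form (t : K) : K -> K -> K -> K :=
  form3 (15 / 8) (- (3 / 4) + 2 * t) (- (5 / 16) * t) (3 / 2 + 8 / 3 * t)
    (13 / 8 * t - t ^+ 2) (3 / 16 * t - t ^+ 2 / 32).

Lemma qvalE (n : int) (d : positive) : qval K (Qmake (Z_of_int n) d) =
  n%:~R / (Pos.to_nat d)%:R.
Proof.
rewrite /qval /zval /= Z_of_intK; congr (_ / _).
Qed.

Lemma sum12 (F : nat -> K) : \sum_(n < 12) F n =
  F 0%N + F 1%N + F 2%N + F 3%N + F 4%N + F 5%N + F 6%N + F 7%N + F 8%N + F 9%N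
  + F 10%N + F 11%N.
Proof. by rewrite !big_ord_recr big_ord0 /= add0r. Qed.

(* For an S_3-invariant form, the vectors x in K^3 contribute through their sum
   (trivial representation) and their differences (standard representation). *)
Lemma quad_formE (t : K) (c : nat -> K) :
  let s i := (c i.*2 + c i.*2.+1) / 2 in
  let d i := c i.*2 - c i.*2.+1 in
  let y i := c (6 + i)%N in let z i := c (9 + i)%N in
  quad_form t c = (d 0 ^+ 2 + d 1%N ^+ 2 + d 2%N ^+ 2) / 2
   + triv_form t (s 0 + s 1%N + s 2%N) (y 0 + y 1%N + y 2%N) (z 0 + z 1%N + z 2%N) / 3
   + std_form t (s 0 - s 1%N) (y 0 - y 1%N) (z 0 - z 1%N) / 3
   + std_form t (s 0 - s 2%N) (y 0 - y 2%N) (z 0 - z 2%N) / 3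
   + std_form t (s 1%N - s 2%N) (y 1%N - y 2%N) (z 1%N - z 2%N) / 3.
Proof.
have qE n d : qval K (Qmake (Z_of_int n) d) = n%:~R / (Pos.to_nat d)%:R.
  exact: qvalE.
have q0 : qval K 0 = 0 by exact: qval0.
have q1 : qval K 1 = 1 by exact: qval1.
have q2 : qval K (Qmake 2 1) = 2 by rewrite (qE 2) divr1.
have q12 : qval K (Qmake 1 2) = 1 / 2 := qE 1 2%positive.
have q14 : qval K (Qmake 1 4) = 1 / 4 := qE 1 4%positive.
have q16 : qval K (Qmake 1 16) = 1 / 16 := qE 1 16%positive.
have q32 : qval K (Qmake 1 32) = 1 / 32 := qE 1 32%positive.
have q38 : qval K (Qmake 3 8) = 3 / 8 := qE 3 8%positive.
have q532 : qval K (Qmake 5 32) = 5 / 32 := qE 5 32%positive.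
have qN1 : qval K (Qmake (-1) 1) = -1 by exact: qvalN1.
have qN14 : qval K (Qmake (-1) 4) = - 1 / 4 := qE (-1) 4%positive.
have qN58 : qval K (Qmake (-5) 8) = - 5%:R / 8 := qE (-5) 8%positive.
have qN83 : qval K (Qmake (-8) 3) = - 8%:R / 3 := qE (-8) 3%positive.
have qN732 : qval K (Qmake (-7) 32) = - 7%:R / 32 := qE (-7) 32%positive.
clear qE.
have rowE n : \sum_(m < 12) c n * (c m * gram t n m) = _ :=
  sum12 (fun m => c n * (c m * gram t n m)).
move=> s d y z; rewrite /quad_form.
rewrite (sum12 (fun n => \sum_(m < 12) c n * (c m * gram t n m))) !rowE.
rewrite /s /d /y /z /=.
clear s d y z.
rewrite /gram /symbol /symbol_form /=.
rewrite !(q0, q1, q2, q12, q14, q16, q32, q38, q532, qN1, qN14, qN58, qN83, qN732).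
rewrite /triv_form /std_form /form3.
move: (c 0%N) (c 1%N) (c 2%N) (c 3%N) (c 4%N) (c 5%N) (c 6%N) (c 7%N) (c 8%N)
  (c 9%N) (c 10%N) (c 11%N) => c0 c1 c2 c3 c4 c5 c6 c7 c8 c9 c10 c11.
clear.
lra.
Qed.
End Decomposition.

(** * Positivity of the two ternary forms *)

Section Forms3.
Variable K : realType.
Implicit Types A B C D E F x y z t : K.

Let minor A B D := A * D - B ^+ 2.
(** By Sylvester's identity this is A times the determinant of the symmetric matrix with rows (A, B,
    C), (B, D, E), (C, E, F). *)
Let schur A B C D E F :=
  minor A B D * minor A C F - (A * E - B * C) ^+ 2.

(* Completing the square twice. *)
Let form3_squares A B C D E F x y z :
  A * minor A B D * form3 A B C D E F x y z =
  minor A B D * (A * x + B * y + C * z) ^+ 2 +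
  (minor A B D * y + (A * E - B * C) * z) ^+ 2 + schur A B C D E F * z ^+ 2.
Proof. by rewrite /schur /minor /form3; lra. Qed.

Let form3_ge0 A B C D E F x y z :
    0 < A -> 0 < minor A B D -> 0 <= schur A B C D E F ->
  0 <= form3 A B C D E F x y z.
Proof.
move=> A0 d0 s0; rewrite -(pmulr_rge0 _ (mulr_gt0 A0 d0)) form3_squares.
by rewrite !addr_ge0 ?sqr_ge0 // mulr_ge0 ?sqr_ge0 // ltW.
Qed.

Let form3_eq0 A B C D E F x y z :
    0 < A -> 0 < minor A B D -> 0 < schur A B C D E F ->
  form3 A B C D E F x y z = 0 -> [/\ x = 0, y = 0 & z = 0].
Proof.
move=> A0 d0 s0 q0; have := form3_squares A B C D E F x y z.
rewrite q0 mulr0 => /esym/eqP.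
set X := _ ^+ 2; set Y := _ ^+ 2.
have X0 : 0 <= minor A B D * X by rewrite mulr_ge0 ?sqr_ge0 // ltW.
have Y0 : 0 <= Y by exact: sqr_ge0.
have Z0 : 0 <= schur A B C D E F * z ^+ 2 by rewrite mulr_ge0 ?sqr_ge0 // ltW.
rewrite (paddr_eq0 (addr_ge0 X0 Y0) Z0) (paddr_eq0 X0 Y0) {X0 Y0 Z0}/X {}/Y.
rewrite !(mulrI_eq0 _ (mulfI (lt0r_neq0 d0))) !(mulrI_eq0 _ (mulfI (lt0r_neq0 s0))).
rewrite !sqrf_eq0 => /andP[/andP[X Y] /eqP z0]; move: X Y; rewrite z0 !mulr0 !addr0.
rewrite mulf_eq0 (gt_eqF d0) /= => X /eqP y0; move: X.
by rewrite y0 mulr0 addr0 mulf_eq0 (gt_eqF A0) /= => /eqP.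
Qed.

Let std_schur t : schur (15 / 8) (- (3 / 4) + 2 * t) (- (5 / 16) * t)
  (3 / 2 + 8 / 3 * t) (13 / 8 * t - t ^+ 2) (3 / 16 * t - t ^+ 2 / 32) =
  15 / 16 * (t * (6^-1 - t)) * (9 / 4 - t) ^+ 2.
Proof. by rewrite /schur /minor; lra. Qed.

Let triv_schur t : schur (9 / 4) (3 / 2 + 2 * t) (5 / 8 * t)
  (3 - 16 / 3 * t) (- (t / 4) - t ^+ 2) (3 / 8 * t - 11 / 16 * t ^+ 2) =
  9 / 2 * (t * (6^-1 - t)) * (9 / 4 - t) ^+ 2.
Proof. by rewrite /schur /minor; lra. Qed.

(** The minor equals 4 (9/4 - t) (t + 1/4). *)
Let std_minor t : 0 <= t <= 6^-1 ->
  0 < minor (15 / 8) (- (3 / 4) + 2 * t) (3 / 2 + 8 / 3 * t).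
Proof. by case/andP=> t0 t6; rewrite /minor; nra. Qed.

(** The minor equals 9/2 - 18 t - 4 t^2, which decreases for t >= 0 and is 25/18 at t = 1/6. *)
Let triv_minor t : 0 <= t <= 6^-1 ->
  0 < minor (9 / 4) (3 / 2 + 2 * t) (3 - 16 / 3 * t).
Proof. by case/andP=> t0 t6; rewrite /minor; nra. Qed.

Let A_std : 0 < 15 / 8 :> K. Proof. lra. Qed.
Let A_triv : 0 < 9 / 4 :> K. Proof. lra. Qed.

Lemma std_form_ge0 t x y z : 0 <= t <= 6^-1 -> 0 <= std_form t x y z.
Proof.
move=> t06; apply: form3_ge0 A_std (std_minor t06) _.
case/andP: t06 => t0 t6; rewrite std_schur mulr_ge0 ?sqr_ge0 //.
by rewrite mulr_ge0 ?mulr_ge0 ?subr_ge0 //; lra.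
Qed.

Lemma triv_form_ge0 t x y z : 0 <= t <= 6^-1 -> 0 <= triv_form t x y z.
Proof.
move=> t06; apply: form3_ge0 A_triv (triv_minor t06) _.
case/andP: t06 => t0 t6; rewrite triv_schur mulr_ge0 ?sqr_ge0 //.
by rewrite mulr_ge0 ?mulr_ge0 ?subr_ge0 //; lra.
Qed.

Lemma std_form_eq0 t x y z : 0 < t < 6^-1 -> std_form t x y z = 0 ->
  [/\ x = 0, y = 0 & z = 0].
Proof.
move=> /andP[t0 t6]; apply: form3_eq0 A_std _ _.
  by apply: std_minor; rewrite !ltW.
rewrite std_schur !mulr_gt0 ?exprn_gt0 ?subr_gt0 //; lra.
Qed.

Lemma triv_form_eq0 t x y z : 0 < t < 6^-1 -> triv_form t x y z = 0 ->
  [/\ x = 0, y = 0 & z = 0].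
Proof.
move=> /andP[t0 t6]; apply: form3_eq0 A_triv _ _.
  by apply: triv_minor; rewrite !ltW.
rewrite triv_schur !mulr_gt0 ?exprn_gt0 ?subr_gt0 //; lra.
Qed.

Lemma quad_form_ge0 t c : 0 <= t <= 6^-1 -> 0 <= quad_form t c.
Proof.
move=> t06; rewrite quad_formE.
do 3![apply: addr_ge0; last by rewrite divr_ge0 // std_form_ge0].
apply: addr_ge0; last by rewrite divr_ge0 // triv_form_ge0.
by rewrite divr_ge0 ?addr_ge0 ?sqr_ge0.
Qed.

Lemma quad_form_eq0 t (c : nat -> K) : 0 < t < 6^-1 -> quad_form t c = 0 ->
  forall n, (n < 12)%N -> c n = 0.
Proof.
move=> t06; have t06' : 0 <= t <= 6^-1 by case/andP: t06 => ? ?; rewrite !ltW.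
rewrite quad_formE.
set T := triv_form t _ _ _; set S1 := std_form t _ _ _.
set S2 := std_form t _ _ _; set S3 := std_form t _ _ _.
set D0 := _ ^+ 2; set D1 := _ ^+ 2; set D2 := _ ^+ 2 => q0.
have [T0 [S10 [S20 S30]]] : 0 <= T /\ 0 <= S1 /\ 0 <= S2 /\ 0 <= S3.
  by rewrite triv_form_ge0 // !std_form_ge0.
have [D00 [D10 D20]] : 0 <= D0 /\ 0 <= D1 /\ 0 <= D2 by rewrite !sqr_ge0.
have q : T = 0 by lra.
have q1 : S1 = 0 by lra.
have q2 : S2 = 0 by lra.
have q3 : S3 = 0 by lra.
have /eqP : D0 = 0 by lra.
rewrite sqrf_eq0 => /eqP d0.
have /eqP : D1 = 0 by lra.
rewrite sqrf_eq0 => /eqP d1.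
have /eqP : D2 = 0 by lra.
rewrite sqrf_eq0 => /eqP d2.
have [x0 y0 z0] := triv_form_eq0 t06 q.
have [x1 y1 z1] := std_form_eq0 t06 q1.
have [x2 y2 z2] := std_form_eq0 t06 q2.
clear - d0 d1 d2 x0 y0 z0 x1 y1 z1 x2 y2 z2.
move=> n; do 12?[case: n => [_|n]]; rewrite //.
all: move: d0 d1 d2 x0 y0 z0 x1 y1 z1 x2 y2 z2.
all: move: (c 0%N) (c 1%N) (c 2%N) (c 3%N) (c 4%N) (c 5%N) (c 6%N) (c 7%N)
  (c 8%N) (c 9%N) (c 10%N) (c 11%N) => *; lra.
Qed.
End Forms3.

(** * Signature of the form on M(t) *)

Section Signature.
Variables (K : realType) (t : K).

(** A scalar with image 0 would give a relation between the twelve basis elements, so freeness makes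
    it 0. Values of the form can therefore be compared in K. *)
Lemma M_emb_inj : injective (fa_emb (M t)).
Proof.
move=> c d cd; have cd0 : fa_emb (M t) (c - d) = 0 by rewrite rmorphB cd subrr.
apply/eqP; rewrite -subr_eq0; apply/eqP.
have sum0 : \sum_(n < 12) fa_emb (M t) (c - d) *: M_basis t n = 0.
  by apply: big1 => n _; rewrite cd0; exact: scale0r.
exact: (@M_free K t (fun=> c - d) sum0 0%N isT).
Qed.

Let comb (c : nat -> K) : M t := \sum_(n < 12) fa_emb (M t) (c n) *: M_basis t n.

Lemma psd_ge0 c : positive_semidefinite (M t) -> 0 <= quad_form t c.
Proof.
by move=> /(_ (comb c))[r r0]; rewrite M_form => /M_emb_inj ->.
Qed.

Lemma pd_gt0 c n : (n < 12)%N -> c n != 0 -> positive_definite (M t) ->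
  0 < quad_form t c.
Proof.
move=> n12 cn /(_ (comb c))[|r r0].
  by move=> /M_free/(_ _ n12)/eqP; apply/negP.
by rewrite M_form => /M_emb_inj ->.
Qed.

(* The norms of u_1 and of sum_i (a_i + a_{-i} - v_i - 4 u_i), which lie in the
   radical of the form at t = 0 and at t = 1/6 respectively. *)
Lemma quad_form_u1 : quad_form t (fun n => (n == 9)%:R) = (t - t ^+ 2) / 4.
Proof. by rewrite quad_formE /= /triv_form /std_form /form3; lra. Qed.

Lemma quad_form_w : quad_form t
    (fun n => if (n < 6)%N then 1 else if (n < 9)%N then -1 else - 4%:R) =
  3 * (1 - 6 * t) * (9 / 4 + 19 / 6 * t).
Proof. by rewrite quad_formE /= /triv_form /std_form /form3; lra. Qed.

Lemma M_psdP : positive_semidefinite (M t) <-> 0 <= t <= 6^-1.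
Proof.
split=> [psd|t06 x]; last first.
  have [c ->] := M_span x; exists (quad_form t c); last exact: M_form.
  exact: quad_form_ge0.
(* For t < 0 the norm t (1 - t)/4 of u_1 is negative. *)
have t0 : 0 <= t.
  rewrite leNgt; apply/negP => t0.
  have := psd_ge0 (fun n => (n == 9)%:R) psd; rewrite quad_form_u1.
  by apply/negP; rewrite -ltNge; nra.
(* For t > 1/6 the factor 1 - 6 t makes the norm of the second test vector negative. *)
rewrite t0 /= leNgt; apply/negP => t6.
have := psd_ge0 (fun n => if (n < 6)%N then 1 else if (n < 9)%N then -1
  else - 4%:R) psd.
by rewrite quad_form_w; apply/negP; rewrite -ltNge; nra.
Qed.

Lemma M_pd : 0 < t < 6^-1 -> positive_definite (M t).
Proof.
move=> t06 x; have [c ->] := M_span x => c0; exists (quad_form t c); last exact: M_form.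
rewrite lt_neqAle quad_form_ge0 ?andbT; last first.
  by case/andP: t06 => ? ?; rewrite !ltW.
apply/eqP => /esym/(quad_form_eq0 t06) c0'; apply: c0.
by apply: big1 => n _; rewrite c0' // rmorph0 scale0r.
Qed.
End Signature.

Theorem proposition6p5 (K : realType) (t : K) :
  (positive_semidefinite (M t) <-> 0 <= t <= 6^-1) /\
  (positive_semidefinite (M t) /\ ~ positive_definite (M t) <->
   t = 0 \/ t = 6^-1).
Proof.
split; first exact: M_psdP.
rewrite M_psdP; split=> [[/andP[t0 t6] npd]|t06].
  have [->|tn0] := eqVneq t 0; first by left.
  have [->|tn6] := eqVneq t 6^-1; first by right.
  by case: npd; apply: M_pd; rewrite !lt_neqAle eq_sym tn0 t0 tn6 t6.
split; first by case: t06 => ->; rewrite lexx ?andbT /=; lra.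
(* At each endpoint one of the two test vectors is nonzero of norm 0. *)
move=> pd; case: t06 => tE.
  have := @pd_gt0 _ _ (fun n => (n == 9)%:R) 9%N isT (oner_neq0 _) pd.
  by rewrite quad_form_u1 tE expr0n subrr mul0r ltxx.
have := @pd_gt0 _ _ (fun n => if (n < 6)%N then 1 else if (n < 9)%N then -1
  else - 4%:R) 0%N isT (oner_neq0 _) pd.
by rewrite quad_form_w tE mulfV ?subrr ?mulr0 ?mul0r ?ltxx // pnatr_eq0.
Qed.
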